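(* Let $k\ge 3$ be an integer and let $n=3k+1$. Then $\mathrm{ex}_{\mathrm{lin}}(n,F^3)=k^2+1$. Moreover, the extremal hypergraphs (the linear $3$-uniform hypergraphs on $n$ vertices with exactly $\mathrm{ex}_{\mathrm{lin}}(n,F^3)$ edges containing no copy of $F^3$) are, up to isomorphism, exactly the hypergraphs on $3k+1$ vertices that can be obtained by one of Constructions 1, 2, 3, 4 described in the context (Construction 2 applies only when $3\mid k$, and Constructions 3 and 4 apply only when $k=3$).
   Context: A $3$-uniform hypergraph $H=(V,E)$ consists of a finite vertex set $V$ and a set $E$ of $3$-element subsets of $V$ (edges). It is linear if any two distinct edges meet in at most one vertex. We write $xyz$ for the edge $\{x,y,z\}$ and $xy$ for the graph edge $\{x,y\}$. The sail $F^3$ is the $3$-uniform linear hypergraph with four edges $f_1,f_2,f_3,g$ such that $f_1,f_2,f_3$ pairwise intersect in exactly the same vertex $v$, and $g$ intersects each $f_i$ in a vertex different from $v$ (so $F^3$ has $7$ vertices and $v\notin g$). A hypergraph contains a copy of $F^3$ if it has a (not necessarily induced) subhypergraph isomorphic to $F^3$. The linear Turán number $\mathrm{ex}_{\mathrm{lin}}(n,F^3)$ is the maximum number of edges in a $3$-uniform linear hypergraph on $n$ vertices containing no copy of $F^3$. A $2$-factor of a graph is a spanning $2$-regular subgraph, i.e. a collection of vertex-disjoint cycles covering all vertices. Graphs are identified with their edge sets; for graphs $G,G'$ on the same vertex set, $G\setminus G'$ is the graph with edge set $E(G)\setminus E(G')$. **Construction 1** ($k\ge 3$). Let $X=\{x_1,\dots,x_k\}$,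 $Y=\{y_1,\dots,y_k\}$, $Z=\{z_1,\dots,z_{k-2},a,b,c\}$ be disjoint sets, and let $B$ be the complete bipartite graph with parts $X$ and $Y$. Let $B_0=\{C_1,\dots,C_l\}$ be a $2$-factor of $B$, where each $C_i$ is a cycle and $C_l$ has length at least $6$. Choose two disjoint edges $a'c',x'y'\in C_l$ with $a',x'\in X$ and $c',y'\in Y$ such that $a'y',c'x'\notin C_l$. Properly $2$-color the edges of $B_0\setminus\{a'c',x'y'\}$ with colors $a$ and $c$ (edges sharing a vertex get different colors) so that the edge of $B_0\setminus\{a'c',x'y'\}$ incident to $a'$ has color $a$ and the edge of $B_0\setminus\{a'c',x'y'\}$ incident to $c'$ has color $c$. Color $x'y'$ with color $b$. The hypergraph has vertex set $X\cup Y\cup Z$ and the following edges: for each edge $uv\in B_0\setminus\{a'c'\}$, the edge $uvw$, where $w\in\{a,b,c\}$ is the color of $uv$; for an arbitrary decomposition of the $(k-2)$-regular graph $B\setminus B_0$ into perfect matchings $M_1,\dots,M_{k-2}$ (each of size $k$), the edges $xyz_i$ for all $xy\in M_i$ and all $i\in\{1,\dots,k-2\}$; and the two edges $a'bc$ and $c'ab$. **Construction 2** ($k\ge 3$ divisible by $3$). Let $X=\{x_1,\dots,x_k\}$, $Y=\{y_1,\dots,y_k\}$, $Z=\{z_1,\dots,z_{k-2},a,b,c\}$ be disjoint sets, and let $B$ be the complete bipartite graph with parts $X$ and $Y$. Let $B_0$ be any $2$-factor of $B$ all of whose cycles have length divisible by $6$. Color the edges of $B_0$ with colors $a,b,c$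 so that any $3$ consecutive edges on a cycle of $B_0$ have pairwise different colors. The hypergraph has vertex set $X\cup Y\cup Z$ and the following edges: for each $uv\in B_0$, the edge $uvw$, where $w\in\{a,b,c\}$ is the color of $uv$; for an arbitrary decomposition of the $(k-2)$-regular graph $B\setminus B_0$ into perfect matchings $M_1,\dots,M_{k-2}$, the edges $xyz_i$ for all $xy\in M_i$ and all $i\in\{1,\dots,k-2\}$; and the edge $abc$. **Construction 3** ($k=3$). Let $B$ be the graph on $\{x_1,x_2,x_3,y_1,y_2,y_3\}$ with edge set $\{x_1x_2,x_2x_3,x_3x_1,y_1y_2,y_2y_3,y_3y_1,x_1y_1,x_2y_2,x_3y_3\}$, and let $Z=\{a,b,c,v\}$ be a set of four further vertices. Let $M_v=\{x_1y_1,x_2y_2,x_3y_3\}$. Decompose $B\setminus M_v$ into three matchings $M_a,M_b,M_c$, each of size two. The hypergraph has the $10$ vertices $\{x_1,x_2,x_3,y_1,y_2,y_3,a,b,c,v\}$ and the following $10$ edges: $\{w\}\cup e$ for each $w\in\{a,b,c,v\}$ and each $e\in M_w$; and the edge $abc$. **Construction 4** ($k=3$). Take disjoint vertex sets $\{x_1,x_2,x_3,y_1,y_2,y_3\}$ and $\{v,a,b,c\}$. Let $M_a=\{y_1y_2,x_1x_2\}$, $M_b=\{x_2x_3\}$, $M_c=\{y_1y_3,x_1x_3\}$, and let $M_v$ be one of $\{x_1y_1,x_2y_2,x_3y_3\}$, $\{x_1y_2,x_2y_1,x_3y_3\}$, $\{x_1y_3,x_3y_1,x_2y_2\}$. The hypergraph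 has these $10$ vertices and the following $10$ edges: $\{w\}\cup e$ for each $w\in\{a,b,c,v\}$ and each $e\in M_w$; and the edges $aby_3$ and $bcy_2$. *)

(* Defs.v *)
From mathcomp Require Import all_boot.

Set Implicit Arguments.
Unset Strict Implicit.
Unset Printing Implicit Defensive.

(* A hypergraph (or a graph) on a finite vertex type is identified with its
   set of edges, each edge being a set of vertices. *)

Section Hypergraphs.

Variable V : finType.
Implicit Type E : {set {set V}}.

Definition uniform3 E := [forall e in E, #|e| == 3].

Definition linear E :=
  [forall e in E, forall f in E, (e != f) ==> (#|e :&: f| <= 1)].

End Hypergraphs.

(* Not necessarily induced copies. *)
Definition contains_copy (U V : finType) (F : {set {set U}})
    (E : {set {set V}}) :=
  [exists f : {ffun U -> V},
    injectiveb f && [forall e in F, f @: e \in E]].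

Definition isomorphic (V W : finType) (E : {set {set V}})
    (E' : {set {set W}}) : Prop :=
  exists f : V -> W, bijective f /\ [set f @: e | e : {set V} in E] = E'.

(* The vertex v is None, the edge f_i is {v, (i, true), (i, false)}, and g
   meets f_i in (i, true). *)
Definition sail : {set {set option ('I_3 * bool)}} :=
  [set [set None; Some (i, true); Some (i, false)] | i : 'I_3]
    :|: [set [set Some (i, true) | i : 'I_3]].

Definition ex_lin (n : nat) (U : finType) (F : {set {set U}}) : nat :=
  \max_(E : {set {set 'I_n}}
         | [&& uniform3 E, linear E & ~~ contains_copy F E]) #|E|.

Definition extremal (V U : finType) (F : {set {set U}})
    (E : {set {set V}}) : bool :=
  [&& uniform3 E, linear E, ~~ contains_copy F E & #|E| == ex_lin #|V| F].

Section Graphs.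

Variable V : finType.
Implicit Types (G F M : {set {set V}}) (S : {set V}).

(* F is a 2-factor of the graph G, whose set of vertices is S. *)
Definition two_factor S G F :=
  (F \subset G) && [forall v in S, #|[set e in F | v \in e]| == 2].

(* The cycle v_0 v_1 ... v_(m-1) v_0 in G is the duplicate-free sequence of its
   vertices; its length m is the size of the sequence. *)
Definition is_cycle G (C : seq V) :=
  (2 < size C) && ucycleb (fun u v => [set u; v] \in G) C.

Definition cycle_edges (C : seq V) : {set {set V}} :=
  [set [set v; next C v] | v in C].

Definition matching M := trivIset M.

Definition perfect_matching S M := matching M && (cover M == S).

Definition decomposition (I : finType) G (M : I -> {set {set V}}) : Prop :=
  \bigcup_i M i = G /\ (forall i j, i != j -> [disjoint M i & M j]).

(* All hyperedges {w} \cup e with e in M. *)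
Definition extend (w : V) M : {set {set V}} := [set w |: e | e : {set V} in M].

End Graphs.

(* Disjoint union of X, Y, {z_1, ..., z_(k-2)} and {a, b, c}. *)
Definition vertex (k : nat) : finType := ('I_k + 'I_k + 'I_(k - 2) + 'I_3)%type.

Definition i0 : 'I_3 := @Ordinal 3 0 isT.
Definition i1 : 'I_3 := @Ordinal 3 1 isT.
Definition i2 : 'I_3 := @Ordinal 3 2 isT.

Definition vx k (i : 'I_k) : vertex k := inl (inl (inl i)).
Definition vy k (i : 'I_k) : vertex k := inl (inl (inr i)).
Definition vz k (i : 'I_(k - 2)) : vertex k := inl (inr i).
Definition vabc k (i : 'I_3) : vertex k := inr i.
Definition va k : vertex k := vabc k i0.
Definition vb k : vertex k := vabc k i1.
Definition vc k : vertex k := vabc k i2.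

Definition X k : {set vertex k} := [set vx i | i : 'I_k].
Definition Y k : {set vertex k} := [set vy i | i : 'I_k].

Definition bip k : {set {set vertex k}} :=
  [set [set x; y] | x in X k, y in Y k].

(* A coloring with colors a, b, c is a function to the vertices whose relevant
   values are in {a, b, c}. *)
Definition colored_edges k (col : {set vertex k} -> vertex k)
    (G : {set {set vertex k}}) : {set {set vertex k}} :=
  [set col e |: e | e : {set vertex k} in G].

Definition matching_edges k (M : 'I_(k - 2) -> {set {set vertex k}}) :
    {set {set vertex k}} :=
  \bigcup_i extend (vz i) (M i).

Variant construction1 (k : nat) : {set {set vertex k}} -> Prop :=
  Construction1 (B0 : {set {set vertex k}}) (Cl : seq (vertex k))
      (a' c' x' y' : vertex k) (col : {set vertex k} -> vertex k)
      (M : 'I_(k - 2) -> {set {set vertex k}})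
      (R := B0 :\: [set [set a'; c']; [set x'; y']]) of
    two_factor (X k :|: Y k) (bip k) B0
  & is_cycle B0 Cl
  & 6 <= size Cl
  & a' \in X k & x' \in X k & c' \in Y k & y' \in Y k
  & [set a'; c'] \in cycle_edges Cl
  & [set x'; y'] \in cycle_edges Cl
  & [disjoint [set a'; c'] & [set x'; y']]
  & [set a'; y'] \notin cycle_edges Cl
  & [set c'; x'] \notin cycle_edges Cl
  & (forall e, e \in R -> col e \in [set va k; vc k])
  & (forall e f, e \in R -> f \in R -> e != f -> ~~ [disjoint e & f] ->
       col e != col f)
  & (forall e, e \in R -> a' \in e -> col e = va k)
  & (forall e, e \in R -> c' \in e -> col e = vc k)
  & col [set x'; y'] = vb k
  & decomposition (bip k :\: B0) M
  & (forall i, perfect_matching (X k :|: Y k) (M i)) :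
  construction1 (colored_edges col (B0 :\ [set a'; c'])
    :|: matching_edges M
    :|: [set [set a'; vb k; vc k]; [set c'; va k; vb k]]).

Variant construction2 (k : nat) : {set {set vertex k}} -> Prop :=
  Construction2 (B0 : {set {set vertex k}})
      (col : {set vertex k} -> vertex k)
      (M : 'I_(k - 2) -> {set {set vertex k}}) of
    3 %| k
  & two_factor (X k :|: Y k) (bip k) B0
  & (forall C, is_cycle B0 C -> 6 %| size C)
  & (forall e, e \in B0 -> col e \in [set va k; vb k; vc k])
  & (forall C v0, is_cycle B0 C -> v0 \in C ->
       let v1 := next C v0 in
       let v2 := next C v1 in
       let v3 := next C v2 in
       uniq [:: col [set v0; v1]; col [set v1; v2]; col [set v2; v3]])
  & decomposition (bip k :\: B0) M
  & (forall i, perfect_matching (X k :|: Y k) (M i)) :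
  construction2 (colored_edges col B0 :|: matching_edges M
    :|: [set [set va k; vb k; vc k]]).

(* When k = 3 the only vertex z_i plays the role of v. *)
Definition vv : vertex 3 := @vz 3 ord0.

Definition prism_matching : {set {set vertex 3}} :=
  [set [set vx i; vy i] | i : 'I_3].

Definition prism : {set {set vertex 3}} :=
  [set [set vx i0; vx i1]; [set vx i1; vx i2]; [set vx i2; vx i0];
       [set vy i0; vy i1]; [set vy i1; vy i2]; [set vy i2; vy i0]]
    :|: prism_matching.

Variant construction3 : {set {set vertex 3}} -> Prop :=
  Construction3 (M : 'I_3 -> {set {set vertex 3}}) of
    decomposition (prism :\: prism_matching) M
  & (forall i, matching (M i) /\ #|M i| = 2) :
  construction3 (extend vv prism_matching
    :|: \bigcup_i extend (vabc 3 i) (M i)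
    :|: [set [set va 3; vb 3; vc 3]]).

Variant construction4 : {set {set vertex 3}} -> Prop :=
  Construction4 (Mv : {set {set vertex 3}}) of
    [\/ Mv = [set [set vx i0; vy i0]; [set vx i1; vy i1]; [set vx i2; vy i2]],
        Mv = [set [set vx i0; vy i1]; [set vx i1; vy i0]; [set vx i2; vy i2]]
      | Mv = [set [set vx i0; vy i2]; [set vx i2; vy i0]; [set vx i1; vy i1]]] :
  construction4
    (extend (va 3) [set [set vy i0; vy i1]; [set vx i0; vx i1]]
    :|: extend (vb 3) [set [set vx i1; vx i2]]
    :|: extend (vc 3) [set [set vy i0; vy i2]; [set vx i0; vx i2]]
    :|: extend vv Mv
    :|: [set [set va 3; vb 3; vy i2]; [set vb 3; vc 3; vy i1]]).

(* Main.v *)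
(* A linear hypergraph has no sail iff every edge e meets, for each vertex v
   outside e, the set co v of non-neighbours of v. Let |E| = k^2 + 1 + t with
   t >= 0. Counting the incidences of E with co v bounds all degrees by k and the
   total deficiency sum_x (k - deg x) by k - 3 - 3t. If v is full (of degree k),
   then |co v| = k and the excess sum_e (|e /\ co v| - 1) over the edges outside
   the star of v is k - 1 - t minus the deficiency of co v. A study of the edges
   of positive excess gives t = 0 and a full v such that co v contains all the
   deficient vertices. The excess at v is then 2: either one edge lies inside
   co v, or two edges have two vertices in it. For a suitable edge vxy the
   neighbours of v split into the k neighbours of x and the k neighbours of y; if
   both sides are independent this is the bipartite picture of Constructions 2
   and 1 respectively, and otherwise k = 3 and E is Construction 3 or 4.
   The bipartite case is a (partial) Latin square with symbols z_l, a, b, c; its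
   cells with symbols a, b, c are the 2-factor B_0 and the absence of sails
   dictates how the colors vary along the cycles. *)
Require Import Defs.
From mathcomp Require Import all_boot zify.

Set Implicit Arguments.
Unset Strict Implicit.
Unset Printing Implicit Defensive.

(** * Non-neighbours and sails *)

(** The surplus [t] stays general until it is forced to be zero, so the bound and the structure come
    out of one argument. The obstacle is the deficient vertices. Two adjacent full vertices have at
    most one common non-neighbour, which makes non-adjacency nearly an equivalence on full vertices,
    with three classes; deficient vertices escape this. The search for [v] therefore branches: an
    edge lies inside some [co v] with [v] full; or some [co p] with [p] full contains two adjacent
    full vertices; or non-adjacency is transitive on full vertices, and each deficient vertex is
    assigned to a class whose full members all miss it (for [k = 3] no vertex is deficient). Once
    [co v] holds all deficient vertices, its deficiency is the whole [k - 3], whence the excess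
    [(k - 1) - (k - 3) = 2]; moreover all neighbours of [v] are full, and the counts around them
    become equalities. *)

Lemma card3P (T : finType) (e : {set T}) x y : #|e| = 3 -> x != y ->
  x \in e -> y \in e -> exists z, [/\ z != x, z != y & e = [set x; y; z]].
Proof.
move=> e3 xy xe ye.
have /cards1P [z ez] : #|e :\ x :\ y| == 1.
  have := cardsD1 x e; have := cardsD1 y (e :\ x).
  by rewrite e3 xe !inE ye eq_sym xy; lia.
have : z \in e :\ x :\ y by rewrite ez set11.
rewrite !inE => /and3P[zy zx ze]; exists z; split=> //.
apply/setP=> u; have := congr1 (fun A : {set T} => u \in A) ez; rewrite !inE.
case: (eqVneq u y) => [->|_] /=; first by rewrite ye orbT.
by case: (eqVneq u x) => [->|_] /=.
Qed.

Lemma cards3 (T : finType) (x y z : T) : x != y -> x != z -> y != z ->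
  #|[set x; y; z]| = 3.
Proof.
by move=> xy xz yz; rewrite setUC cardsU1 cards2 !inE xy negb_or !(eq_sym z) xz yz.
Qed.

Section Adjacency.

Variables (V : finType) (E : {set {set V}}).
Implicit Types (e f S : {set V}) (x y z u w : V).

Definition adj x y := (x != y) && [exists e in E, (x \in e) && (y \in e)].
Definition nbr x := [set y | adj x y].
Definition co x := [set y | (x != y) && ~~ adj x y].
Definition star x := [set e in E | x \in e].
Definition deg x := #|star x|.

Record sail_free : Prop := SailFree {
  sf_card : forall e, e \in E -> #|e| = 3;
  sf_lin : forall e f x y, e \in E -> f \in E -> x != y ->
    x \in e -> y \in e -> x \in f -> y \in f -> e = f;
  sf_sail : forall e w, e \in E -> w \notin e -> exists2 x, x \in e & x \in co w
}.

Lemma adjP x y : reflect (x != y /\ exists e, [/\ e \in E, x \in e & y \in e])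
  (adj x y).
Proof.
apply: (iffP andP) => -[xy].
  by case/exists_inP=> e eE /andP[xe ye]; split=> //; exists e.
by case=> e [eE xe ye]; split=> //; apply/exists_inP; exists e; rewrite ?xe.
Qed.

Lemma adj_edge e x y : e \in E -> x \in e -> y \in e -> x != y -> adj x y.
Proof. by move=> eE xe ye xy; apply/adjP; split=> //; exists e. Qed.

Lemma adj_sym x y : adj x y = adj y x.
Proof. by apply/adjP/adjP => -[xy [e [eE xe ye]]]; rewrite eq_sym; split=> //; exists e. Qed.

Lemma adj_neq x y : adj x y -> x != y.
Proof. by case/andP. Qed.

Lemma adjxx x : adj x x = false.
Proof. by rewrite /adj eqxx. Qed.

Lemma in_nbr x y : (y \in nbr x) = adj x y.
Proof. by rewrite inE. Qed.

Lemma in_co x y : (y \in co x) = (x != y) && ~~ adj x y.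
Proof. by rewrite inE. Qed.

Lemma co_sym x y : (y \in co x) = (x \in co y).
Proof. by rewrite !in_co eq_sym adj_sym. Qed.

Lemma coxx x : (x \in co x) = false.
Proof. by rewrite in_co eqxx. Qed.

Lemma co_nadj x y : y \in co x -> adj x y = false.
Proof. by rewrite in_co => /andP[_ /negbTE]. Qed.

Lemma in_coN x y : x != y -> (y \in co x) = ~~ adj x y.
Proof. by rewrite in_co => ->. Qed.

Lemma co_edge e x y : e \in E -> x \in e -> y \in e -> y \notin co x.
Proof.
move=> eE xe ye; rewrite in_co; case: eqVneq => //= xy.
by rewrite negbK (adj_edge eE).
Qed.

Lemma sum_card_incidence (A : {set {set V}}) S :
  \sum_(e in A) #|e :&: S| = \sum_(x in S) #|[set e in A | x \in e]|.
Proof.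
under eq_bigr => e _ do rewrite -sum1_card.
under [RHS]eq_bigr => x _ do rewrite -sum1_card.
rewrite (exchange_big_dep (mem S)) /=; last by move=> e x _; rewrite inE => /andP[].
by apply: eq_bigr => x xS; apply: eq_bigl => e; rewrite !inE xS andbT.
Qed.

Hypothesis sfE : sail_free.

Lemma card_star2 x y : #|[set e in star x | y \in e]| =
  (if x == y then deg x else adj x y).
Proof.
case: eqVneq => [<-|xy].
  by apply: eq_card => e; rewrite !inE -andbA andbb.
case: (boolP (adj x y)) => [/adjP[_ [e [eE xe ye]]]|nxy].
  rewrite (_ : [set _ in _ | _] = [set e]) ?cards1 //.
  apply/setP=> f; rewrite !inE; apply/andP/eqP => [[/andP[fE xf] yf]|->].
    exact: (sf_lin sfE _ _ xy).
  by rewrite eE.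
apply: eq_card0 => e; rewrite !inE; apply/negP=> /andP[/andP[eE xe] ye].
by case/negP: nxy; apply/adjP; split=> //; exists e.
Qed.

(** By linearity each neighbour of [u] lies on exactly one edge of the star, so the edges at [u] cut
    [nbr u :&: S] into disjoint pieces. *)
Lemma sum_star u S : u \notin S ->
  \sum_(e in star u) #|e :&: S| = #|nbr u :&: S|.
Proof.
move=> uS; rewrite sum_card_incidence -sum1_card [RHS]big_mkcond.
rewrite [LHS]big_mkcond; apply: eq_bigr => x _; rewrite !inE card_star2.
case: ifP => xS; last by rewrite andbF.
by case: eqVneq uS => [->|_ _]; rewrite ?xS // andbT; case: adj.
Qed.

Lemma card_nbr x : #|nbr x| = (deg x).*2.
Proof.
have -> : nbr x = nbr x :&: [set~ x].
  apply/setP=> y; rewrite !inE; case: eqVneq => [->|]; rewrite ?andbT //.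
  by rewrite adjxx.
rewrite -sum_star ?inE ?eqxx // -muln2 -sum_nat_const.
apply: eq_bigr => e; rewrite inE => /andP[eE xe].
by have := cardsD1 x e; rewrite xe (sf_card sfE eE) -setDE; lia.
Qed.

Lemma card_co x : #|co x| + (deg x).*2 + 1 = #|V|.
Proof.
rewrite -card_nbr -(cardsC (nbr x)).
have -> : ~: nbr x = x |: co x.
  apply/setP=> y; rewrite !inE eq_sym; case: eqVneq => //= <-.
  by rewrite adjxx.
by rewrite cardsU1 coxx; lia.
Qed.

Lemma sum_deg : \sum_x deg x = 3 * #|E|.
Proof.
have -> : 3 * #|E| = \sum_(e in E) #|e :&: setT|.
  rewrite mulnC -sum_nat_const; apply: eq_bigr => e eE.
  by rewrite setIT (sf_card sfE).
by rewrite sum_card_incidence; apply: eq_big => x; rewrite ?inE.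
Qed.

Lemma meet_co e v : e \in E -> v \notin e -> 0 < #|e :&: co v|.
Proof.
move=> eE ve; have [x xe xv] := sf_sail sfE eE ve.
by apply/card_gt0P; exists x; rewrite inE xe.
Qed.

Lemma disj_co e v : e \in E -> v \in e -> #|e :&: co v| = 0.
Proof.
move=> eE ve; apply: eq_card0 => x; rewrite !inE.
apply/negP=> /and3P[xe vx] /negP; apply; exact: (adj_edge eE).
Qed.

Lemma sum_co v : \sum_(x in co v) deg x = \sum_(e in E) #|e :&: co v|.
Proof. by rewrite sum_card_incidence. Qed.

Lemma edge_size e x y z : e \in E -> x \in e -> y \in e -> z \in e ->
  x != y -> x != z -> y != z -> e = [set x; y; z].
Proof.
move=> eE xe ye ze xy xz yz.
apply/esym/eqP; rewrite eqEcard (sf_card sfE eE) cards3 // andbT.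
by apply/subsetP=> u; rewrite !inE => /orP[/orP[]|] /eqP->.
Qed.

Lemma card_edgeI e f : e \in E -> f \in E -> e != f -> #|e :&: f| <= 1.
Proof.
move=> eE fE ef; rewrite leqNgt; apply/negP=> /card_gt1P[x [y [+ + xy]]].
rewrite !inE => /andP[xe xf] /andP[ye yf].
by case/eqP: ef; apply: (sf_lin sfE _ _ xy).
Qed.

End Adjacency.

(** If [w] is adjacent to all of [e], linearity keeps the three joining edges distinct and their
    third vertices off [e], so they form a sail with [e] in the role of [g]. Conversely the apex of
    a sail is adjacent to all of [g]. *)
Lemma sail_freeP (V : finType) (E : {set {set V}}) :
  reflect (sail_free E) [&& uniform3 E, linear E & ~~ contains_copy sail E].
Proof.
apply: (iffP and3P) => [[/'forall_implyP u3 lin nocopy]|sfE].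
  have card3 e : e \in E -> #|e| = 3 by move/u3/eqP.
  have line e f x y : e \in E -> f \in E -> x != y ->
    x \in e -> y \in e -> x \in f -> y \in f -> e = f.
    move=> eE fE xy xe ye xf yf.
    move/forall_inP/(_ e eE)/forall_inP/(_ f fE)/implyP: lin.
    case: eqVneq => // _ /(_ isT); rewrite leqNgt => /negP[].
    by apply/card_gt1P; exists x, y; rewrite !inE xe ye.
  split=> // e w eE we; apply/exists_inP; case: (boolP [exists x in e, x \in co E w]) => // allw'; case/negP: nocopy.
  have allw x (xe : x \in e) : x \notin co E w.
    by apply: contraNN allw' => xw; apply/exists_inP; exists x.
  have awx x : x \in e -> adj E w x.
    move=> xe; have := allw x xe; rewrite in_co; case: eqVneq => [wx|_].
      by rewrite wx xe in we.
    by rewrite negbK.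
  have [x xinj xe] : exists2 x : 'I_3 -> V, injective x & e = [set x i | i in 'I_3].
    have e3 := card3 e eE.
    exists (fun i => enum_val (cast_ord (esym e3) i)).
      by move=> i j /enum_val_inj/cast_ord_inj.
    apply/setP=> z; apply/idP/imsetP => [ze|[i _ ->]]; last exact: enum_valP.
    exists (cast_ord e3 (enum_rank_in ze z)) => //.
    by rewrite cast_ordK enum_rankK_in.
  have xie i : x i \in e by rewrite xe imset_f.
  have /fin_all_exists[y yP] i : exists y, [/\ y != w, y != x i & [set w; x i; y] \in E].
    have /adjP[wx [f [fE wf xf]]] := awx _ (xie i).
    have [y [yw yx fe]] := card3P (card3 f fE) wx wf xf.
    by exists y; rewrite -fe.
  have wx i : w != x i by apply: contraNneq we => ->.
  have yE i : [set w; x i; y i] \in E by case: (yP i).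
  have ye i : y i \notin e.
    apply/negP=> yie; case: (yP i) => _ yx _.
    have : [set w; x i; y i] = e by apply: (line _ _ _ _ (yE i) eE yx); rewrite ?inE ?eqxx ?orbT.
    by move/setP/(_ w); rewrite !inE eqxx (negbTE we).
  have yinj : injective y.
    move=> i j yij; apply: xinj; apply/eqP/negPn/negP=> xij.
    have wy : w != y i by rewrite eq_sym; case: (yP i).
    have ff : [set w; x i; y i] = [set w; x j; y j].
      by apply: (line _ _ _ _ (yE i) (yE j) wy); rewrite ?yij ?inE ?eqxx ?orbT.
    have : [set w; x i; y i] = e.
      apply: (line _ _ _ _ (yE i) eE xij); rewrite ?xie //.
        by rewrite !inE eqxx orbT.
      by rewrite ff !inE eqxx orbT.
    by move/setP/(_ w); rewrite !inE eqxx (negbTE we).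
  pose h (o : option ('I_3 * bool)) :=
    match o with None => w | Some (i, true) => x i | Some (i, false) => y i end.
  apply/existsP; exists (finfun h); apply/andP; split.
    apply/injectiveP => -[[i [|]]|] [[j [|]]|]; rewrite !ffunE /=.
    - by move/xinj->.
    - by move=> xy; have := ye j; rewrite -xy xie.
    - by move/esym/eqP; rewrite (negbTE (wx i)).
    - by move=> xy; have := ye i; rewrite xy xie.
    - by move/yinj->.
    - by move/eqP; case: (yP i) => /negbTE->.
    - by move/eqP; rewrite (negbTE (wx j)).
    - by move/esym/eqP; case: (yP j) => /negbTE->.
    by [].
  apply/forall_inP=> f; rewrite inE => /orP[/imsetP[i _ ->]|/set1P->].
    by rewrite !imsetU !imset_set1 !ffunE /= (yE i).
  suff -> : finfun h @: [set Some (i, true) | i : 'I_3] = e by [].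
  by rewrite -imset_comp xe; apply: eq_imset => i; rewrite /= ffunE.
split.
- by apply/forall_inP=> e eE; rewrite (sf_card sfE).
- apply/forall_inP=> e eE; apply/forall_inP=> f fE; apply/implyP=> ef.
  exact: (card_edgeI sfE).
apply/negP=> /existsP[h /andP[/injectiveP hinj /forall_inP hE]].
have gE : h @: [set Some (i, true) | i : 'I_3] \in E.
  by apply: hE; rewrite inE set11 orbT.
have [|z] := sf_sail sfE (w := h None) gE.
  by apply/imsetP=> -[_ /imsetP[i _ ->] /hinj].
case/imsetP=> _ /imsetP[i _ ->] ->; rewrite in_co => /andP[ne /negP[]].
apply/adjP; split=> //; exists (h @: [set None; Some (i, true); Some (i, false)]).
split; try by rewrite imset_f // !inE eqxx ?orbT.
by apply: hE; rewrite inE; apply/orP; left; apply/imsetP; exists i.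
Qed.

(** * Counting incidences *)

Record large (V : finType) (E : {set {set V}}) (k : nat) : Prop := Large {
  large_sf : sail_free E;
  large_k : 3 <= k;
  large_V : #|V| = 3 * k + 1;
  large_E : k ^ 2 + 1 <= #|E|
}.

Section Counting.

Variables (V : finType) (E : {set {set V}}) (k : nat).
Hypothesis lE : large E k.

Let sfE := large_sf lE.
Let k3 := large_k lE.
Let cardV := large_V lE.
Let cardE := large_E lE.

Implicit Types (e f S : {set V}) (x y z u v w : V).

Local Notation adj := (adj E).
Local Notation nbr := (nbr E).
Local Notation co := (co E).
Local Notation star := (star E).
Local Notation deg := (deg E).

(** Each vertex of [S] is outside [e], hence missed by some vertex of [e]; the sum counts these
    misses. *)
Lemma cover_edge e S : e \in E -> [disjoint e & S] ->
  #|S| <= \sum_(x in e) #|co x :&: S|.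
Proof.
move=> eE /pred0P eS.
have -> : \sum_(x in e) #|co x :&: S| = \sum_(x in e) \sum_(y in S | y \in co x) 1.
  by apply: eq_bigr => x _; rewrite -sum1_card; apply: eq_bigl => y; rewrite inE andbC.
rewrite -[leqLHS]sum1_card (exchange_big_dep (mem S)) /=; last by move=> x y _ /andP[].
apply: leq_sum => y yS.
have ye : y \notin e by have := eS y; rewrite /= yS andbT => ->.
have [x xe xy] := sf_sail sfE eE ye.
by rewrite (bigD1 x) //= xe yS co_sym.
Qed.

(** At a vertex of maximum degree [d], the edges outside the star all meet the [3k - 2d]
    non-neighbours, whose degrees are at most [d]. So [|E| <= d (3k + 1 - 2d)], which is below [k^2]
    for [d > k]. *)
Lemma deg_le x : deg x <= k.
Proof.
have [v _ vmax] := @arg_maxnP _ x xpredT deg isT.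
apply: leq_trans (vmax x isT) _; rewrite leqNgt; apply/negP=> kv.
have := card_co sfE v; rewrite cardV => coV.
have sumle : \sum_(u in co v) deg u <= #|co v| * deg v.
  by rewrite -sum_nat_const; apply: leq_sum => u _; apply: vmax.
have : #|E| <= deg v + \sum_(u in co v) deg u.
  rewrite sum_co -(cardsID (star v) E) leq_add //.
    by apply: subset_leq_card; apply: subsetIr.
  rewrite -sum1_card [leqRHS](big_setID (star v)) /= -[leqLHS]add0n leq_add //.
  apply: leq_sum => e; rewrite !inE => /andP[] /[swap] eE; rewrite eE /= => ve.
  exact: meet_co.
nia.
Qed.

Definition def x := k - deg x.
Definition full x := deg x == k.
Definition defset := [set x | ~~ full x].
Definition deficit_sum S := \sum_(x in S) def x.
(** This is [t] of the overview; the truncated subtraction is exact under [large]. *)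
Definition surplus := #|E| - (k ^ 2 + 1).
(** Edges off the star of [v] meet [co v] at least once, and only the further incidences count; on
    the star the truncated predecessor gives 0. *)
Definition excess v e := #|e :&: co v|.-1.
Definition texcess v := \sum_(e in E) excess v e.

Lemma deg_def x : deg x + def x = k.
Proof. by rewrite /def subnKC ?deg_le. Qed.

Lemma def_full x : full x -> def x = 0.
Proof. by move/eqP; rewrite /def => ->; rewrite subnn. Qed.

Lemma def_gt0 x : (0 < def x) = (x \in defset).
Proof. by rewrite inE /full; have := deg_def x; lia. Qed.

Lemma in_defset x : (x \in defset) = ~~ full x.
Proof. by rewrite inE. Qed.

(** Handshake: [3 |E|] plus the total deficiency is [k (3k + 1)]. *)
Lemma sum_def : deficit_sum setT + 3 * surplus + 3 = k.
Proof.
have : \sum_x (deg x + def x) = (3 * k + 1) * k.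
  by rewrite (eq_bigr (fun=> k)) ?sum_nat_const ?cardV // => x _; apply: deg_def.
rewrite big_split /= (sum_deg sfE).
have -> : deficit_sum setT = \sum_x def x by apply: eq_bigl => x; rewrite inE.
rewrite /surplus; nia.
Qed.

Lemma sdefU S1 S2 : [disjoint S1 & S2] -> deficit_sum (S1 :|: S2) = deficit_sum S1 + deficit_sum S2.
Proof.
move=> dS; rewrite /deficit_sum -bigU //; apply: eq_bigl => x; exact: in_setU.
Qed.

Lemma sdefS S1 S2 : S1 \subset S2 -> deficit_sum S1 <= deficit_sum S2.
Proof.
move=> /setIidPr S12; rewrite /deficit_sum [leqRHS](big_setID S1) /= S12; exact: leq_addr.
Qed.

Lemma sdef_card S : #|S :&: defset| <= deficit_sum S.
Proof.
rewrite /deficit_sum (big_setID defset) -sum1_card /= -[leqLHS]addn0 leq_add //.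
by apply: leq_sum => x; rewrite inE -def_gt0 => /andP[].
Qed.

Lemma sdef0 S x : deficit_sum S = 0 -> x \in S -> full x.
Proof.
move=> S0 xS; apply: contraT => nx; have := def_gt0 x; rewrite inE nx.
by move: S0; rewrite /deficit_sum (bigD1 x) //=; lia.
Qed.

Lemma card_defset : #|defset| + 3 <= k.
Proof.
by have := sdef_card setT; have := sum_def; rewrite setTI; lia.
Qed.

Lemma card_coE x : #|co x| = k + (def x).*2.
Proof. by have := card_co sfE x; have := deg_def x; rewrite cardV; lia. Qed.

Lemma card_co_full v : full v -> #|co v| = k.
Proof. by move=> fv; rewrite card_coE def_full // addn0. Qed.

Lemma card_nbr_full v : full v -> #|nbr v| = k.*2.
Proof. by move=> /eqP fv; rewrite card_nbr // fv. Qed.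

Lemma sum_edges_meet v (S : {set {set V}}) : S \subset E -> v \notin cover S ->
  \sum_(e in S) #|e :&: co v| = \sum_(e in S) excess v e + #|S|.
Proof.
move=> SE vS; rewrite -sum1_card -big_split /=; apply: eq_bigr => e eS.
rewrite /excess addn1 prednK //; apply: meet_co; rewrite ?(subsetP SE) //.
by apply: contraNN vS => ve; apply/bigcupP; exists e.
Qed.

(** The [k] vertices of [co v] have [k^2] incidences minus their deficiency, and the [|E| - k] edges
    off the star use one each; the rest is excess. *)
Lemma texcess_full v : full v -> texcess v + surplus + 1 + deficit_sum (co v) = k.
Proof.
move=> fv; have /eqP dv := fv.
have : \sum_(u in co v) (deg u + def u) = k * k.
  rewrite (eq_bigr (fun=> k)) ?sum_nat_const ?card_co_full // => x _; exact: deg_def.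
rewrite big_split /= sum_co (big_setID (star v)) /= -/(deficit_sum _) big1; last first.
  by move=> e; rewrite !inE => /and3P[eE _ ve]; apply: disj_co.
rewrite sum_edges_meet ?subsetDl //; last first.
  by apply/bigcupP=> -[e]; rewrite !inE => /andP[] /[swap] -> /=/negbTE->.
have -> : \sum_(e in E :\: star v) excess v e = texcess v.
  rewrite /texcess [RHS](big_setID (star v)) /= [X in X + _]big1 //.
  by move=> e; rewrite !inE => /and3P[eE _ ve]; rewrite /excess disj_co.
have := cardsD E (star v); have := cardE.
have -> : #|E :&: star v| = k.
  by rewrite -dv; apply: eq_card => e; rewrite !inE andbA andbb.
rewrite /surplus; nia.
Qed.

(** An edge at [u] already meets [co v] in [u], so its excess counts its other vertices in [co v],
    and these are neighbours of [u]. *)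
Lemma excess_star v u : u \in co v ->
  \sum_(e in star u) excess v e = #|nbr u :&: co v|.
Proof.
move=> uv; have -> : nbr u :&: co v = nbr u :&: (co v :\ u).
  by apply/setP=> x; rewrite !in_setI in_setD1 in_nbr; case: (eqVneq x u) => // ->; rewrite adjxx.
rewrite -sum_star ?setD11 //; apply: eq_bigr => e; rewrite inE => /andP[eE ue].
rewrite /excess setIDA.
by have := cardsD1 u (e :&: co v); rewrite inE ue uv => ->.
Qed.

(** Remove the common neighbours from [nbr v], of size [2k], and from [nbr u], of size [2 deg u]:
    what is left of the first is missed by [u], what is left of the second lies in [co v]. *)
Lemma co_nbr v u : full v -> u \in co v ->
  #|co u :&: nbr v| = (def u).*2 + #|nbr u :&: co v|.
Proof.
move=> fv uv.
have := card_nbr_full fv; rewrite -(cardsID (nbr u)).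
have -> : nbr v :\: nbr u = co u :&: nbr v.
  apply/setP=> x; rewrite in_setD in_setI !in_nbr in_co.
  by case: (eqVneq u x) => [<-|_] //=; rewrite (co_nadj uv) andbF.
have := card_nbr sfE u; rewrite -(cardsID (nbr v)) setIC.
have -> : nbr u :\: nbr v = nbr u :&: co v.
  apply/setP=> x; rewrite in_setD in_setI !in_nbr in_co andbC.
  by case: (eqVneq v x) => [<-|_] //=; rewrite adj_sym (co_nadj uv).
by have := deg_def u; lia.
Qed.

(** Besides the edge through [v], the [deg r - 1] edges at [r] meet [co v] once each plus their
    excess, and they cover exactly the vertices of [co v] that [r] sees. *)
Lemma adj_co v r : full v -> adj v r ->
  #|co r :&: co v| + \sum_(e in star r) excess v e = (def r).+1.
Proof.
move=> fv /[dup] /adj_neq vr /[dup] avr /adjP[_ [e0 [e0E ve0 re0]]].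
have rco : r \notin co v by rewrite in_co avr andbF.
have := card_co_full fv; rewrite -(cardsID (nbr r)).
have -> : co v :\: nbr r = co r :&: co v.
  apply/setP=> x; rewrite in_setD in_setI in_nbr.
  case: (eqVneq r x) => [<-|rx]; first by rewrite (negbTE rco) !andbF.
  by rewrite (in_coN _ rx).
rewrite setIC -sum_star //.
have e0s : e0 \in star r by rewrite inE e0E.
rewrite (big_setD1 e0) //= disj_co // add0n.
rewrite sum_edges_meet; last 2 first.
- by apply/subsetP=> e; rewrite !inE => /and3P[].
- apply/bigcupP=> -[e]; rewrite !inE => /and3P[ee0 eE re] ve.
  by case/eqP: ee0; apply: (sf_lin sfE eE e0E vr).
have -> : \sum_(e in star r :\ e0) excess v e = \sum_(e in star r) excess v e.
  by rewrite [RHS](big_setD1 e0) //= /excess disj_co.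
have := cardsD1 e0 (star r); rewrite e0s -/(deg r) add1n.
by move=> dr; have := deg_def r; rewrite dr; set a := \sum_(e in _) _; set b := #|_ :\ _|; set c := #|_|; lia.
Qed.

Lemma card_coI v r : full v -> full r -> adj v r -> #|co r :&: co v| <= 1.
Proof.
by move=> fv fr vr; have := adj_co fv vr; rewrite (def_full fr); lia.
Qed.

(** Each of the [2k] neighbours of [v] is missed by a vertex of [e]. By [co_nbr] and [excess_star]
    there are at most [2 deficit_sum e + 4 + texcess v] such misses; with [texcess_full] and
    [sum_def] this reaches [2k] only if the surplus and the deficiency outside [e] vanish. *)
Lemma edge_in_co v e : full v -> e \in E -> e \subset co v ->
  surplus = 0 /\ defset \subset e.
Proof.
move=> fv eE ev.
have eco x : x \in e -> x \in co v by apply: subsetP.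
have dis : [disjoint e & nbr v].
  apply/pred0P=> x /=; apply/negP=> /andP[/eco]; rewrite in_co in_nbr.
  by case/andP=> _ /negbTE->.
have := cover_edge eE dis; rewrite card_nbr_full //.
rewrite (eq_bigr (fun x => (def x).*2 + \sum_(f in star x) excess v f)); last first.
  by move=> x xe; rewrite co_nbr ?eco // excess_star ?eco.
rewrite big_split /=.
have -> : \sum_(x in e) (def x).*2 = (deficit_sum e).*2.
  by rewrite -mul2n big_distrr /=; apply: eq_bigr => x _; rewrite mul2n.
have -> : \sum_(x in e) \sum_(f in star x) excess v f =
          \sum_(f in E) #|e :&: f| * excess v f.
  rewrite (exchange_big_dep (mem E)) /=; last by move=> x f _; rewrite inE => /andP[].
  apply: eq_bigr => f fE; rewrite -sum1_card big_distrl /=.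
  by apply: eq_big => x; rewrite ?inE ?fE ?mul1n.
have exe : excess v e = 2 by rewrite /excess (setIidPl ev) (sf_card sfE eE).
(* The edge [e] contributes [3 * 2 = 6], which is 4 more than its share 2 of [texcess]; any other
   edge meets [e] at most once. *)
have : \sum_(f in E) #|e :&: f| * excess v f <= 4 + texcess v.
  rewrite /texcess (bigD1 e) //= [in leqRHS](bigD1 e) //= exe setIid.
  rewrite (sf_card sfE eE) addnA leq_add //.
  apply: leq_sum => f /andP[fE fe].
  by rewrite -[leqRHS]mul1n leq_mul // (card_edgeI sfE) // eq_sym.
have := texcess_full fv; have := sdefS ev; have := sum_def.
have : deficit_sum e + deficit_sum (~: e) = deficit_sum setT.
  by rewrite -sdefU ?setUCr // -setI_eq0 setICr.
move=> H1 H2 H3 H4 H5 H6.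
have s0 : surplus = 0 by lia.
split=> //; have ec0 : deficit_sum (~: e) = 0 by lia.
apply/subsetP=> x; rewrite inE; apply: contraR => xe.
by apply: (sdef0 ec0); rewrite inE.
Qed.

End Counting.

(* Abstracting the numerical terms keeps [lia] from comparing cardinals up to
   conversion, which is very slow. *)
Ltac nlia :=
  repeat match goal with
  | H := _ : is_true _ |- _ => clearbody H
  end;
  repeat match goal with
  | H : is_true (leq _ _) |- _ => revert H
  | H : @eq nat _ _ |- _ => revert H
  end;
  repeat match goal with
  | H : ?T |- _ => match type of T with Prop => clear H end
  end;
  repeat match goal with
  | |- context [@bigop.body ?R ?I ?a ?b ?c] => generalize (@bigop.body R I a b c); intro
  | |- context [@card.body ?T ?A] => generalize (@card.body T A); intro
  | |- context [def ?E ?k ?x] => generalize (def E k x); intro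
  | |- context [deg ?E ?x] => generalize (deg E x); intro
  | |- context [deficit_sum ?E ?k ?x] => generalize (deficit_sum E k x); intro
  | |- context [excess ?E ?k ?x] => generalize (excess E k x); intro
  | |- context [texcess ?E ?x] => generalize (texcess E x); intro
  | |- context [surplus ?E ?x] => generalize (surplus E x); intro
  end; lia.

(** * Adjacent full vertices among the non-neighbours of a full vertex *)

Section Isolated.

Variables (V : finType) (E : {set {set V}}) (k : nat).
Hypothesis lE : large E k.
Let sfE := large_sf lE.
Let k3 := large_k lE.

Implicit Types (e f S : {set V}) (x y z u v w : V).

Local Notation adj := (adj E).
Local Notation nbr := (nbr E).
Local Notation co := (co E).
Local Notation star := (star E).
Local Notation full := (full E k).
Local Notation defset := (defset E k).
Local Notation sdef := (deficit_sum E k).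
Local Notation surplus := (surplus E k).

Hypothesis noin : forall v e, full v -> e \in E -> ~~ (e \subset co v).

(** By [card_coI], [p] is the only common non-neighbour of [u] and [v], so their neighbourhoods
    cover [co p]. The edges at [u] or [v] then have excess at least [k - 1] (the common edge counted
    once), the most that [texcess_full] allows, so every inequality is tight. *)
Lemma adj_in_co p u v : full p -> u \in co p -> v \in co p ->
    full u -> full v -> adj u v ->
  [/\ surplus = 0, sdef (co p) = 0,
      forall x, x \in co p -> adj u x != adj v x
    & forall x y, x \in co p -> y \in co p -> adj x y ->
        [|| x == u, x == v, y == u | y == v]].
Proof.
move=> fp up vp fu fv uv; have /adjP[neq [e [eE ue ve]]] := uv.
have cocap x : x \in co p -> adj u x || adj v x.
  move=> xp; have := card_coI lE fv fu; rewrite adj_sym uv => /(_ isT).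
  case: (boolP (adj u x)) => //= nux; case: (boolP (adj v x)) => //= nvx le1.
  case: (eqVneq u x) => [ux|ux]; first by rewrite adj_sym -ux uv in nvx.
  case: (eqVneq v x) => [vx|vx]; first by rewrite -vx uv in nux.
  have /card_le1_eqP/(_ p x) := le1; rewrite !in_setI !(in_coN _ ux) !(in_coN _ vx).
  rewrite nux nvx co_sym up co_sym vp => /(_ isT isT) px.
  by rewrite -px coxx in xp.
have exe : excess E p e = 1.
  rewrite /excess; suff -> : #|e :&: co p| = 2 by [].
  have le3 : #|e :&: co p| < 3.
    rewrite -(sf_card sfE eE) proper_card // properEneq subsetIl andbT.
    by apply: contraNneq (noin fp eE) => /setIidPl.
  suff : 1 < #|e :&: co p| by nlia.
  by apply/card_gt1P; exists u, v; rewrite !inE -!in_co; split; rewrite ?ue ?ve.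
have := texcess_full lE fp; rewrite /texcess (big_setID (star u)) /=.
have -> : E :&: star u = star u by apply/setP=> f; rewrite !inE andbA andbb.
rewrite (excess_star lE) // (big_setID (A := E :\: star u) (star v)) /=.
have -> : \sum_(f in (E :\: star u) :&: star v) excess E p f
          = #|nbr v :&: co p| - 1.
  rewrite -(excess_star lE) // [X in X - 1](big_setD1 e) ?inE ?eE //= exe addKn.
  apply: eq_bigl => f; rewrite !inE; case: (boolP (f \in E)) => fE; rewrite ?andbF //=.
  case: (eqVneq f e) => [->|fe]; first by rewrite ue.
  case: (boolP (v \in f)) => vf; rewrite ?andbF //= !andbT.
  by apply: contraNN fe => uf; apply/eqP/(sf_lin sfE fE eE neq).
set rest := \sum_(_ in _) _.
have := cardsUI (nbr u :&: co p) (nbr v :&: co p).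
have -> : (nbr u :&: co p) :|: (nbr v :&: co p) = co p.
  rewrite -setIUl; apply/setIidPr/subsetP=> x /cocap.
  by rewrite in_setU !in_nbr.
rewrite (card_co_full lE fp); set I := _ :&: _ => cUI ctot.
(* The counts combine to surplus + deficiency of [co p] + overlap [I] + leftover excess [rest] =
   0. *)
have [[s0 d0] [I0 r0]] : (surplus = 0 /\ sdef (co p) = 0) /\ (#|I| = 0 /\ rest = 0) by nlia.
split=> // [x xp|x y xp yp /adjP[xy [f [fE xf yf]]]].
  have := cocap x xp; case: (boolP (adj u x)) => ux; last by move=> /= ->.
  move=> _; apply/negP=> /eqP vx.
  by have/cards0_eq/setP/(_ x) := I0; rewrite !in_setI !in_nbr ux -vx xp inE.
have : f \in star u :|: star v.
  apply/negP=> /negP nf; have : 0 < rest.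
    rewrite /rest (bigD1 f) /=; last first.
      by rewrite !inE fE /= andbT; move: nf; rewrite !inE fE /= negb_or andbC.
    suff : 0 < excess E p f by nlia.
    rewrite /excess -subn1 subn_gt0; apply/card_gt1P; exists x, y.
    by rewrite !in_setI xf yf xp yp.
  by rewrite r0.
have key z : z \in co p -> z \in f -> (x == z) || (y == z).
  move=> zp zf; apply: contraT; rewrite negb_or => /andP[xz yz].
  case/negP: (noin fp fE); rewrite (edge_size sfE fE xf yf zf) //.
  by apply/subsetP=> a; rewrite !inE -orbA => /or3P[] /eqP->; rewrite -in_co.
by rewrite !inE fE /= => /orP[/(key u up)|/(key v vp)] /orP[] ->; rewrite ?orbT.
Qed.

(* Lax vertices are the only obstruction to the transitivity of non-adjacency
   on full vertices, hence to a partition into three classes. *)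
Definition lax p := full p && [exists u, exists v,
  [&& u \in co p, v \in co p, full u, full v & adj u v]].

(** A third vertex [a] of [co p] is adjacent to exactly one of [u] and [v], say [v]. Then
    adjacencies in [co p] must touch both [{u, v}] and [{a, v}], while [u] and [a] are not adjacent:
    they all pass through [v], and adjacency on [co p] is a star with centre [v]. *)
Lemma laxP p : lax p -> exists s, [/\ s \in co p,
    forall x, x \in co p -> x != s -> adj s x &
    forall x y, x \in co p -> y \in co p -> x != s -> y != s -> ~~ adj x y].
Proof.
case/andP=> fp /existsP[u /existsP[v /and5P[up vp fu fv uv]]].
have [a] : exists a, a \in co p :\ u :\ v.
  apply/card_gt0P; have := cardsD1 u (co p); have := cardsD1 v (co p :\ u).
  rewrite in_setD1 up vp (card_co_full lE fp) eq_sym (adj_neq uv); nlia.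
rewrite !in_setD1 => /and3P[av au ap].
wlog va : u v up vp fu fv uv av au / adj v a.
  move=> wl; have [_ _ /(_ a ap) ex _] := adj_in_co fp up vp fu fv uv.
  case: (boolP (adj v a)) => [|nva]; first exact: (wl u v).
  apply: (wl v u) => //; first by rewrite adj_sym.
  by move: ex; rewrite (negbTE nva); case: adj.
have [_ sd0 xoruv touch] := adj_in_co fp up vp fu fv uv.
have fa : full a := sdef0 lE sd0 ap.
have [_ _ xorav _] := adj_in_co fp ap vp fa fv (etrans (adj_sym _ _ _) va).
exists v; split=> // [x xp xv|x y xp yp xv yv].
  apply: contraT => nvx; case: (eqVneq x u) => [xu|xu].
    by rewrite xu adj_sym uv in nvx.
  have ax : adj a x by move: (xorav x xp); rewrite (negbTE nvx); case: adj.
  by have := touch a x ap xp ax; rewrite (negbTE av) (negbTE au) (negbTE xu) (negbTE xv).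
have vadj z : z \in co p -> z != v -> adj v z -> ~~ adj u z.
  by move=> zp zv vz; have := xoruv z zp; rewrite vz; case: adj.
apply/negP=> xy; have := touch x y xp yp xy; rewrite (negbTE xv) (negbTE yv) /= orbF.
have va2 z : z \in co p -> z != v -> adj v z.
  move=> zp zv; apply: contraT => nvz; case: (eqVneq z u) => [zu|zu].
    by rewrite zu adj_sym uv in nvz.
  have az : adj a z by move: (xorav z zp); rewrite (negbTE nvz); case: adj.
  by have := touch a z ap zp az; rewrite (negbTE av) (negbTE au) (negbTE zu) (negbTE zv).
case/orP=> /eqP eu.
  by have := vadj y yp yv (va2 y yp yv); rewrite -eu xy.
by have := vadj x xp xv (va2 x xp xv); rewrite -eu adj_sym xy.
Qed.

Lemma lax_def p : lax p -> surplus = 0 /\ sdef (co p) = 0.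
Proof.
case/andP=> fp /existsP[u /existsP[v /and5P[up vp fu fv uv]]].
by have [] := adj_in_co fp up vp fu fv uv.
Qed.

Lemma lax_full p x : lax p -> x \in co p -> full x.
Proof. by case/lax_def=> _; apply: sdef0. Qed.

Lemma laxI p u v : full p -> u \in co p -> v \in co p -> full u -> full v ->
  adj u v -> lax p.
Proof.
by move=> fp up vp fu fv uv; rewrite /lax fp; apply/existsP; exists u;
  apply/existsP; exists v; apply/and5P.
Qed.

(** [co a] has [k] vertices and already contains [p] and the [k - 2] vertices of [co p] other than
    [s] and [a]; there is room for only one more. *)
Lemma co_isolated p s a y y' : lax p -> s \in co p ->
    (forall x y, x \in co p -> y \in co p -> x != s -> y != s -> ~~ adj x y) ->
  a \in co p -> a != s -> y \in co a -> y' \in co a ->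
  adj p y -> adj p y' -> y = y'.
Proof.
move=> lp sp indep ap as_ ya y'a py py'; apply/eqP/negPn/negP=> yy'.
have fa := lax_full lp ap; have /andP[fp _] := lp.
have sub : p |: (y |: (y' |: (co p :\ s :\ a))) \subset co a.
  apply/subsetP=> x; rewrite !in_setU1 !in_setD1.
  case/or4P=> [/eqP->|/eqP->|/eqP->|/and3P[xa xs xp]] //; first by rewrite co_sym.
  by rewrite in_coN 1?eq_sym // indep.
have := subset_leq_card sub; rewrite (card_co_full lE fa).
have nin z : adj p z -> z \notin co p by move=> pz; rewrite in_co pz andbF.
rewrite !cardsU1 !in_setU1 !in_setD1 coxx (negbTE (adj_neq py)) (negbTE (adj_neq py')).
rewrite (negbTE (nin y py)) (negbTE (nin y' py')) (negbTE yy') !andbF /=.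
have := cardsD1 s (co p); have := cardsD1 a (co p :\ s).
by rewrite in_setD1 as_ ap sp (card_co_full lE fp) /=; nlia.
Qed.

(** With [s] the centre of [co p], the vertex [s] is itself lax with centre [p], and the [k + 1]
    vertices outside [co p] and [co s] form a set [S] that contains all deficient ones. A full [y]
    in [S] turns out to miss exactly the rest of [S]. *)
Lemma lax_case p : lax p -> 2 <= #|defset| ->
  exists2 y, full y & defset \subset co y.
Proof.
move=> lp W2; have [s [sp sadj indep]] := laxP lp; have /andP[fp _] := lp.
have fs := lax_full lp sp; have Wk := card_defset lE.
have ps : p \in co s by rewrite co_sym.
have Tp x : x \in co s -> x != p -> adj p x.
  move=> xs xp; apply: contraT => npx.
  have xcp : x \in co p by rewrite in_coN // eq_sym.
  have : adj s x by apply: sadj => //; apply: contraTneq xs => ->; rewrite coxx.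
  by rewrite (co_nadj xs).
have cardT : #|co s :\ p| = k - 1.
  by have := cardsD1 p (co s); rewrite ps (card_co_full lE fs); nlia.
(* A full vertex of [co s :\ p] exists because at most [k - 3] vertices are deficient; it and [p]
   are adjacent non-neighbours of [s]. *)
have ls : lax s.
  have [t] : exists t, t \in (co s :\ p) :\: defset.
    apply/card_gt0P; have := cardsID defset (co s :\ p).
    have := subset_leq_card (subsetIr (co s :\ p) defset); nlia.
  rewrite in_setD in_setD1 in_defset negbK => /and3P[ft tp ts].
  exact: (laxI fs ps ts fp ft (Tp t ts tp)).
have [p' [p's p'adj indep']] := laxP ls.
have pp' : p' = p.
  apply/eqP/negPn/negP=> p'p.
  have [t] : exists t, t \in co s :\ p :\ p'.
    apply/card_gt0P; have := cardsD1 p' (co s :\ p); rewrite cardT; nlia.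
  rewrite !in_setD1 => /and3P[tp' tp ts].
  have := indep' p t ps ts; rewrite (Tp t ts tp) eq_sym p'p tp'.
  by move=> /(_ isT isT).
rewrite {p' p's p'adj}pp' in indep' *.
pose S := nbr p :&: nbr s.
have cover x : [|| x \in co p, x \in co s | x \in S].
  rewrite in_setI !in_nbr; case: (eqVneq p x) => [<-|px]; first by rewrite ps orbT.
  case: (eqVneq s x) => [<-|sx]; first by rewrite sp.
  by rewrite !in_coN //; do 2 case: adj.
have WS w : w \in defset -> w \in S.
  rewrite in_defset => nfw; have := cover w.
  case: (boolP (w \in co p)) => [/(lax_full lp)|_ /=]; first by rewrite (negbTE nfw).
  by case: (boolP (w \in co s)) => [/(lax_full ls)|_ //]; rewrite (negbTE nfw).
have cardS : #|S| = k + 1.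
  have := card_nbr_full lE fp; rewrite -(cardsID (nbr s)) -/S.
  suff -> : nbr p :\: nbr s = co s :\ p by nlia.
  apply/setP=> x; rewrite in_setD in_setD1 !in_nbr.
  case: (eqVneq x p) => [->|xp]; first by rewrite adjxx andbF.
  case: (eqVneq s x) => [<-|sx]; first by rewrite (co_nadj sp) coxx andbF.
  rewrite in_coN //; case: (boolP (adj s x)) => //= nsx.
  by rewrite Tp // in_coN.
have [y] : exists y, y \in S :\: defset.
  apply/card_gt0P; have := cardsID defset S.
  have := subset_leq_card (subsetIr S defset); nlia.
rewrite in_setD in_defset negbK => /andP[fy yS]; exists y => //.
move: (yS); rewrite in_setI !in_nbr => /andP[py sy].
have le1p : #|co y :&: co p| <= 1 := card_coI lE fp fy py.
have le1s : #|co y :&: co s| <= 1 := card_coI lE fs fy sy.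
have split_co : #|co y| <= #|co y :&: co p| + #|co y :&: co s| + #|co y :&: S|.
  apply: leq_trans (leq_add (leq_card_setU _ _) (leqnn _)).
  apply: leq_trans (leq_card_setU _ _); apply: subset_leq_card.
  by apply/subsetP=> x xy; rewrite !in_setU !(in_setI x (co y)) xy /= -orbA; apply: cover.
rewrite (card_co_full lE fy) in split_co.
(* Otherwise [co x] would contain both [y] and [y'], two common neighbours of [p] and [s], against
   [co_isolated]. *)
have far x y' : x \in co y -> (x \in co p) || (x \in co s) ->
    y' \in co y :&: S -> adj x y' /\ full x.
  move=> xy xps; rewrite !in_setI !in_nbr => /and3P[y'y py' sy'].
  have yx : y \in co x by rewrite co_sym.
  have y'y0 : y' != y by apply: contraTneq y'y => ->; rewrite coxx.
  have xs : x != s by apply: contraTneq xy => ->; rewrite in_co adj_sym sy andbF.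
  have xp : x != p by apply: contraTneq xy => ->; rewrite in_co adj_sym py andbF.
  have xy' : x != y'.
    case/orP: xps => xc; apply: contraTneq xc => ->; rewrite in_co ?py' ?sy' andbF //.
  split; last by case/orP: xps; [apply: lax_full lp|apply: lax_full ls].
  apply: contraT => nxy'; have y'x : y' \in co x by rewrite in_coN.
  case/negP: y'y0; apply/eqP; case/orP: xps => xc.
    exact: (co_isolated lp sp indep xc xs y'x yx).
  exact: (co_isolated ls ps indep' xc xp y'x yx).
(* If [y] missed a vertex outside [S], [far] would make [y] lax and [co y] free of deficient
   vertices. As there are at least two of these in [S], [co y :&: S] has at most [k - 2] vertices,
   so [co y] meets both [co p] and [co s]. A vertex found there and one of [S], both off the centre
   of [co y], are then adjacent by [far] but not by [laxP]. *)
have none : co y :&: co p = set0 /\ co y :&: co s = set0.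
  suff none : (co y :&: co p) :|: (co y :&: co s) = set0.
    by split; apply/eqP; rewrite -subset0 -none ?subsetUl ?subsetUr.
  apply/eqP; apply: contraT => /set0Pn[x xU].
  have [xy xps] : x \in co y /\ (x \in co p) || (x \in co s).
    by move: xU; rewrite in_setU !in_setI; case: (x \in co y).
  have [y'] : exists y', y' \in (co y :&: S) :\: defset.
    apply/card_gt0P; have := cardsID defset (co y :&: S).
    have := subset_leq_card (subsetIr (co y :&: S) defset); nlia.
  rewrite in_setD in_defset negbK => /andP[fy' y'yS].
  have [xy' fx] := far x y' xy xps y'yS.
  have ly : lax y.
    by apply: (laxI fy xy _ fx fy' xy'); move: y'yS; rewrite in_setI => /andP[].
  have leS : #|co y :&: S| + #|defset| <= k.
    have : (co y :&: S) :|: defset \subset S :\ y.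
      apply/subsetP=> z; rewrite in_setU in_setD1 => /orP[|zW].
        by case: (eqVneq z y) => [->|_]; rewrite (in_setI _ (co y)) ?coxx // => /andP[].
      rewrite WS // andbT; apply: contraTneq zW => ->.
      by rewrite in_defset fy.
    move/subset_leq_card; have := cardsUI (co y :&: S) defset.
    have -> : (co y :&: S) :&: defset = set0.
      apply/setP=> z; rewrite !in_setI in_set0 in_defset; apply/negP.
      by case/andP=> /andP[/(lax_full ly) ->].
    by have := cardsD1 y S; rewrite yS cards0; nlia.
  have [s'' [s''y _ indep'']] := laxP ly.
  have [z [zy zps zs'']] : exists z, [/\ z \in co y, (z \in co p) || (z \in co s) & z != s''].
    have /card_gt0P[a] : 0 < #|co y :&: co p| by nlia.
    have /card_gt0P[b] : 0 < #|co y :&: co s| by nlia.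
    rewrite !in_setI => /andP[by_ bs] /andP[ay ap].
    case: (eqVneq a s'') => [as_|]; last by exists a; rewrite ap.
    exists b; rewrite bs orbT; split=> //; rewrite -as_.
    apply: contraTneq bs => ba; rewrite in_co negb_and; apply/orP; right; rewrite negbK.
    apply: sadj; first by rewrite ba.
    by apply: contraTneq ay => bs'; rewrite -ba bs' in_co adj_sym sy andbF.
  have [c] : exists c, c \in (co y :&: S) :\ s''.
    by apply/card_gt0P; have := cardsD1 s'' (co y :&: S); nlia.
  rewrite in_setD1 => /andP[cs'' cyS]; have [zc _] := far z c zy zps cyS.
  move: cyS; rewrite in_setI => /andP[cy _].
  by have := indep'' z c zy cy zs'' cs''; rewrite zc.
have sub : co y \subset S :\ y.
  apply/subsetP=> x xy; rewrite in_setD1; have := cover x.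
  case: none => /setP/(_ x) + /setP/(_ x); rewrite !in_setI !in_set0 xy /= => -> -> /= ->.
  by rewrite andbT; apply: contraTneq xy => ->; rewrite coxx.
have /eqP -> : co y == S :\ y.
  rewrite eqEcard sub (card_co_full lE fy); have := cardsD1 y S; rewrite yS; nlia.
apply/subsetP=> w wW; rewrite in_setD1 WS // andbT; apply: contraTneq wW => ->.
by rewrite in_defset fy.
Qed.

End Isolated.

(** * A full vertex that misses every deficient vertex *)

(** The shortfall from [3 (k + 1)] is 2, spread as 0, 1, 1 or as 0, 0, 2. *)
Lemma ord3_sum (F : 'I_3 -> nat) k : 3 <= k -> (forall i, F i <= k + 1) ->
    \sum_i F i = 3 * k + 1 ->
  exists i j l, [/\ i != j, i != l & j != l] /\ F i = k + 1 /\
    ((F j = k /\ F l = k) \/ (F j = k + 1 /\ F l = k - 1)).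
Proof.
rewrite !big_ord_recl big_ord0; set a := ord0; set b := lift _ _; set c := lift _ _.
move=> k3 le; have := (le a, le b, le c) => -[[la lb] lc] sum.
have [Fa|[Fb|Fc]] : F a = k + 1 \/ F b = k + 1 \/ F c = k + 1 by lia.
- have [Fb|[Fb|Fb]] : F b = k + 1 \/ F b = k \/ F b = k - 1 by lia.
  + by exists a, b, c; split=> //; split=> //; right; split=> //; lia.
  + by exists a, b, c; split=> //; split=> //; left; split=> //; lia.
  + by exists a, c, b; rewrite (eq_sym c); split=> //; split=> //; right; split=> //; lia.
- have [Fa|[Fa|Fa]] : F a = k + 1 \/ F a = k \/ F a = k - 1 by lia.
  + by exists b, a, c; rewrite (eq_sym b); split=> //; split=> //; right; split=> //; lia.
  + by exists b, a, c; rewrite (eq_sym b); split=> //; split=> //; left; split=> //; lia.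
  + by exists b, c, a; rewrite !(eq_sym _ a); split=> //; split=> //; right; split=> //; lia.
- have [Fa|[Fa|Fa]] : F a = k + 1 \/ F a = k \/ F a = k - 1 by lia.
  + exists c, a, b; rewrite !(eq_sym c); split=> //; split=> //; right; split=> //; lia.
  + exists c, a, b; rewrite !(eq_sym c); split=> //; split=> //; left; split=> //; lia.
  + exists c, b, a; rewrite !(eq_sym c) (eq_sym b); split=> //; split=> //; right; split=> //; lia.
Qed.

Lemma ord3_case (i j l m : 'I_3) : i != j -> i != l -> j != l ->
  [|| m == i, m == j | m == l].
Proof.
by case: i j l m => [[|[|[|?]]] ?] [[|[|[|?]]] ?] [[|[|[|?]]] ?] [[|[|[|?]]] ?].
Qed.

(** * The partition into three classes when non-adjacency is transitive *)

Section Classes.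

Variables (V : finType) (E : {set {set V}}) (k : nat).
Hypothesis lE : large E k.
Let sfE := large_sf lE.
Let k3 := large_k lE.

Implicit Types (e f S : {set V}) (x y z u v w : V).

Local Notation adj := (adj E).
Local Notation nbr := (nbr E).
Local Notation co := (co E).
Local Notation star := (star E).
Local Notation full := (full E k).
Local Notation defset := (defset E k).
Local Notation sdef := (deficit_sum E k).
Local Notation surplus := (surplus E k).

(** Otherwise the at most [k - 3] deficient vertices, of degree at most [k], would meet all of the
    at least [k^2 + 1] edges. *)
Lemma full_edge : exists2 e, e \in E & forall x, x \in e -> full x.
Proof.
case: (boolP [exists e in E, [forall x in e, full x]]).
  by case/exists_inP=> e eE /forall_inP; exists e.
move/exists_inPn => allE.
have : #|E| <= \sum_(e in E) #|e :&: defset|.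
  rewrite -sum1_card; apply: leq_sum => e /allE; rewrite negb_forall_in.
  case/exists_inP=> x xe nf; apply/card_gt0P; exists x.
  by rewrite in_setI xe in_defset.
rewrite sum_card_incidence => leS.
have : \sum_(x in defset) deg E x <= #|defset| * k.
  by rewrite -sum_nat_const; apply: leq_sum => x _; apply: deg_le.
have := leS; have := card_defset lE; have := large_E lE; clear.
set s := \sum_(_ in _) _; rewrite -/s; set d := #|defset|; set m := #|E|; nia.
Qed.

Hypothesis noin : forall v e, full v -> e \in E -> ~~ (e \subset co v).
Hypothesis nolax : forall p, ~~ lax E k p.

Lemma nadj_trans x y z : full x -> full y -> full z ->
  ~~ adj x y -> ~~ adj y z -> ~~ adj x z.
Proof.
move=> fx fy fz nxy nyz; case: (eqVneq y x) => [<- //|yx].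
case: (eqVneq y z) => [<- //|yz].
apply: contraNN (nolax y) => xz; apply: (laxI fy _ _ fx fz xz); rewrite in_coN //.
by rewrite adj_sym.
Qed.

Lemma three_classes : exists c : V -> 'I_3,
  (forall x y, full x -> full y -> adj x y = (c x != c y)) /\
  (forall i, exists2 x, full x & c x = i).
Proof.
have [e eE fe] := full_edge.
have [v [vinj eim]] : exists v : 'I_3 -> V, injective v /\ e = v @: setT.
  have e3 := sf_card sfE eE.
  exists (fun i => enum_val (cast_ord (esym e3) i)); split.
    by move=> i j /enum_val_inj/cast_ord_inj.
  apply/setP=> z; apply/idP/imsetP => [ze|[i _ ->]]; last exact: enum_valP.
  by exists (cast_ord e3 (enum_rank_in ze z)); rewrite ?cast_ordK ?enum_rankK_in.
have ve i : v i \in e by rewrite eim imset_f.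
have fv i : full (v i) by apply: fe.
have vadj i j : i != j -> adj (v i) (v j).
  by move=> ij; apply: (adj_edge eE) => //; apply: contraNneq ij => /vinj->.
pose c x := odflt ord0 [pick i | ~~ adj x (v i)].
have cP x : full x -> ~~ adj x (v (c x)).
  move=> fx; rewrite /c; case: pickP => [//|none] /=.
  case: (boolP (x \in e)) => [|xe].
    by rewrite eim => /imsetP[i _ xi]; have := none i; rewrite -xi adjxx.
  have [y] := sf_sail sfE eE xe; rewrite eim => /imsetP[i _ ->].
  by rewrite in_co => /andP[_]; rewrite (none i).
exists c; split=> [x y fx fy|i]; last first.
  exists (v i) => //; apply/eqP/negPn/negP=> /vadj.
  by rewrite adj_sym (negbTE (cP _ (fv i))).
case: eqVneq => /= cxy.
  apply/negbTE; apply: (nadj_trans fx (fv (c x)) fy (cP x fx)).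
  by rewrite cxy adj_sym cP.
apply: contraT => nxy.
have nx : ~~ adj (v (c x)) x by rewrite adj_sym cP.
have ny := nadj_trans fx fy (fv (c y)) nxy (cP y fy).
by have := nadj_trans (fv (c x)) fx (fv (c y)) nx ny; rewrite vadj.
Qed.

(* Every deficient vertex lies with two full vertices in an edge, and misses
   the third class entirely: that class is its home. *)
Lemma home_class : exists h : V -> 'I_3,
  [/\ forall x y, full x -> h x = h y -> ~~ adj x y,
      forall x y, full x -> full y -> h x != h y -> adj x y,
      forall x i, i != h x -> exists y, [/\ full y, h y = i & adj x y]
    & forall i, exists2 x, full x & h x = i].
Proof.
have [c [cadj cex]] := three_classes.
have home w : ~~ full w -> exists i,
    (forall x, full x -> c x = i -> ~~ adj x w) /\
    (forall j, j != i -> exists y, [/\ full y, c y = j & adj w y]).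
  move=> nfw.
  (* If each edge at [w] had a second deficient vertex, [deg w] would be less than [#|defset|]. The
     deficiency of [w], with at least 1 for every other deficient vertex, would then reach [k],
     above the total of at most [k - 3]. *)
  have [e [eE we fe]] : exists e, [/\ e \in E, w \in e & forall x, x \in e -> x != w -> full x].
    case: (boolP [exists e in star w, [forall x in e, (x != w) ==> full x]]).
      case/exists_inP=> e; rewrite inE => /andP[eE we] /forall_inP fe.
      by exists e; split=> // x xe xw; have := fe x xe; rewrite xw.
    move/exists_inPn => allw.
    have ex (e : {set V}) : exists x, e \in star w -> [/\ x \in e, x != w & ~~ full x].
      case: (boolP (e \in star w)) => [/allw|_]; last by exists w.
      rewrite negb_forall_in => /exists_inP[x xe]; rewrite negb_imply => /andP[xw nf].
      by exists x.
    have [g gP] := fin_all_exists ex.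
    have ginj : {in star w &, injective g}.
      move=> e f es fs gef; have [ge gw _] := gP e es; have [gf _ _] := gP f fs.
      move: es fs; rewrite !inE => /andP[eE we] /andP[fE wf].
      by apply: (sf_lin sfE eE fE gw ge we _ wf); rewrite gef.
    have : g @: star w \subset defset :\ w.
      by apply/subsetP=> _ /imsetP[e /gP[_ gw nf] ->]; rewrite in_setD1 gw in_defset.
    move/subset_leq_card; rewrite card_in_imset // -/(deg E w) => degle.
    have := sdef_card lE [set: V]; rewrite setTI.
    have wW : w \in defset by rewrite in_defset.
    have := cardsD1 w defset; rewrite wW.
    have : sdef [set: V] = def E k w + sdef [set~ w].
      by rewrite /deficit_sum (bigD1 w) //=; congr (_ + _); apply: eq_bigl => x; rewrite !inE.
    have := sdef_card lE [set~ w]; rewrite setIC -setDE.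
    by have := deg_def lE w; have := sum_def lE; nlia.
  have [x [y [wx wy xy ee]]] : exists x y, [/\ w != x, w != y, x != y & e = [set w; x; y]].
    have e3 := sf_card sfE eE; have := cardsD1 w e; rewrite we e3 => -[/esym/eqP/cards2P].
    case=> x [y [xy exy]]; exists x, y.
    have /setD1P[xw _] : x \in e :\ w by rewrite exy !inE eqxx.
    have /setD1P[yw _] : y \in e :\ w by rewrite exy !inE eqxx orbT.
    by rewrite !(eq_sym w); split=> //; rewrite -(setD1K we) exy setUA.
  have xe : x \in e by rewrite ee !inE eqxx orbT.
  have ye : y \in e by rewrite ee !inE eqxx orbT.
  have fx : full x by apply: fe => //; rewrite eq_sym.
  have fy : full y by apply: fe => //; rewrite eq_sym.
  have cxy : c x != c y by rewrite -cadj //; apply: (adj_edge eE).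
  have [i [ix iy]] : exists i : 'I_3, i != c x /\ i != c y.
    have /card_gt0P[i] : 0 < #|~: [set c x; c y]|.
      by rewrite cardsCs setCK card_ord cards2 cxy.
    by rewrite !inE negb_or => /andP[ix iy]; exists i.
  (* A full [z] of the third class sees [x] and [y], so by [sf_sail] on [e] it misses [w]. *)
  exists i; split=> [z fz cz|j ji].
    have zx : adj z x by rewrite cadj // cz.
    have zy : adj z y by rewrite cadj // cz.
    have ze : z \notin e.
      rewrite ee !inE !negb_or (adj_neq zx) (adj_neq zy) !andbT.
      by apply: contraNneq nfw => <-.
    have [u] := sf_sail sfE eE ze.
    rewrite ee !inE -orbA => /or3P[] /eqP->; rewrite ?zx ?zy ?andbF //.
    by case/andP.
  have := ord3_case j ix iy cxy; rewrite (negbTE ji) /= => /orP[] /eqP->.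
    by exists x; split=> //; apply: (adj_edge eE).
  by exists y; split=> //; apply: (adj_edge eE).
have home' w : exists i, ~~ full w ->
    (forall x, full x -> c x = i -> ~~ adj x w) /\
    (forall j, j != i -> exists y, [/\ full y, c y = j & adj w y]).
  case: (boolP (full w)) => [_|/home[i]]; first by exists ord0.
  by exists i.
have [g gP] := fin_all_exists home'.
pose h x := if full x then c x else g x.
have hc x : full x -> h x = c x by rewrite /h => ->.
exists h; split=> [x y fx|x y fx fy|x i|i].
- rewrite hc // /h; case: ifP => [fy|/negbT/gP[gy _]].
    by rewrite cadj // negbK => /eqP.
  exact: gy.
- by rewrite !hc // -cadj.
- rewrite {1}/h; case: ifP => [fx|/negbT/gP[_ gx]] ix.
    have [y fy cy] := cex i; exists y; rewrite hc // cadj // cy eq_sym ix.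
    by [].
  by have [y [fy cy xy]] := gx i ix; exists y; rewrite hc.
- by have [x fx cx] := cex i; exists x; rewrite // hc.
Qed.

(** A full [u] misses its own class [K] and [k + 1 - |K|] further vertices, [out u]; so the class
    sizes are [k + 1, k, k] or [k + 1, k + 1, k - 1]. For a class of size [k + 1] the edges of
    positive excess are those with two vertices in it. The first shape gives [co u] the whole
    deficiency; the second would need five such edges where only four fit. *)
Lemma nolax_case : 4 <= k ->
  surplus = 0 /\ exists2 v, full v & defset \subset co v.
Proof.
move=> k4; have [h [Hin Hout Hadj Hex]] := home_class.
pose K i := [set x | h x == i].
have inK x i : (x \in K i) = (h x == i) by rewrite inE.
have subK u : full u -> K (h u) :\ u \subset co u.
  move=> fu; apply/subsetP=> x; rewrite in_setD1 inK => /andP[xu /eqP hx].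
  by rewrite in_coN 1?eq_sym //; apply: Hin.
pose out u := co u :\: K (h u).
have outE u : full u -> #|out u| + #|K (h u)| = k + 1.
  move=> fu; have := cardsID (K (h u)) (co u); rewrite (card_co_full lE fu) -/(out u).
  have -> : co u :&: K (h u) = K (h u) :\ u.
    apply/setP=> x; rewrite in_setI in_setD1 andbC.
    case: (boolP (x \in K (h u))) => xK; rewrite ?andbF //= andbT.
    case: (eqVneq x u) => [->|xu]; first by rewrite coxx.
    by rewrite (subsetP (subK u fu)) // in_setD1 xu.
  by have := cardsD1 u (K (h u)); rewrite inK eqxx; nlia.
have leK i : #|K i| <= k + 1.
  by have [u fu <-] := Hex i; have := outE u fu; nlia.
have sumK : \sum_i #|K i| = 3 * k + 1.
  rewrite -(large_V lE) -[RHS]sum1_card [RHS](partition_big h xpredT) //=.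
  by apply: eq_bigr => i _; rewrite -sum1_card; apply: eq_bigl => x; rewrite inK.
have [i [j [l [[ij il jl] [Ki Kjl]]]]] := ord3_sum k3 leK sumK.
pose EX i := [set f in E | 1 < #|f :&: K i|].
have outW u x : full u -> x \in out u -> x \in co u /\ h x != h u.
  by move=> fu; rewrite in_setD inK => /andP[].
have exE m u : full u -> h u = m -> #|K m| = k + 1 ->
    (forall f, f \in E -> excess E u f = (f \in EX m)) /\
    co u = K m :\ u.
  move=> fu hu Km.
  have coK : co u = K m :\ u.
    apply/esym/eqP; rewrite eqEcard (card_co_full lE fu) -hu subK //= hu.
    by have := cardsD1 u (K m); rewrite inK hu eqxx Km; nlia.
  split=> // f fE; rewrite inE fE /=.
  have le3 : #|f :&: co u| < 3.
    rewrite -(sf_card sfE fE) proper_card // properEneq subsetIl andbT.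
    by apply: contraNneq (noin fu fE) => /setIidPl.
  case: (boolP (u \in f)) => uf.
    have := disj_co fE uf; rewrite /excess => f0; rewrite f0.
    have := cardsD1 u (f :&: K m); rewrite in_setI uf inK hu eqxx -setIDA -coK f0.
    by move=> ->.
  have <- : f :&: co u = f :&: K m.
    apply/setP=> x; rewrite coK !in_setI in_setD1.
    by case: (eqVneq x u) => [->|//]; rewrite (negbTE uf).
  by rewrite /excess; move: le3; case: #|_| => [|[|[|]]].
have cardEX m : #|K m| = k + 1 -> #|EX m| + surplus + 1 + sdef (K m) = k.
  move=> Km; have [u fu hu] := Hex m; have [exu cou] := exE m u fu hu Km.
  apply: etrans (texcess_full lE fu); rewrite /texcess cou.
  have -> : sdef (K m :\ u) = sdef (K m).
    rewrite /deficit_sum [RHS](big_setD1 u) ?inK ?hu //=.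
    by rewrite (def_full fu).
  congr (_ + _ + _ + _); rewrite -sum1_card big_mkcond [RHS]big_mkcond /=.
  apply: eq_bigr => f _; case: ifP => [fX|].
    by rewrite exu ?fX; move: fX; rewrite inE => /andP[->].
  by case: ifP => // fE fX; rewrite exu // fX.
have EXP m f : #|K m| = k + 1 -> f \in EX m ->
    exists r, [/\ r \in f, h r != m & forall x, x \in f -> x != r -> h x = m].
  move=> Km; rewrite inE => /andP[fE].
  case/card_gt1P=> x [y []]; rewrite !in_setI !inK => /andP[xf /eqP hx] /andP[yf /eqP hy] xy.
  have [z [zx zy fz]] := card3P (sf_card sfE fE) xy xf yf.
  have zf : z \in f by rewrite fz !inE eqxx !orbT.
  exists z; split=> // [|t]; last by rewrite fz !inE => /orP[/orP[]|] /eqP->; rewrite ?hx ?hy ?eqxx.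
  apply/eqP=> hz; have [u fu hu] := Hex m; have [_ cou] := exE m u fu hu Km.
  case: (boolP (u \in f)) => uf.
    suff [a [af au ha]] : exists a, [/\ a \in f, a != u & h a = m].
      have := co_edge fE uf af; rewrite cou in_setD1 au inK ha eqxx.
      by [].
    case: (eqVneq x u) => [xu|xu]; last by exists x.
    by exists y; rewrite -xu eq_sym xy.
  case/negP: (noin fu fE); apply/subsetP=> t tf; rewrite cou in_setD1 inK.
  have -> : t != u by apply: contraNneq uf => <-.
  by move: tf; rewrite fz !inE => /orP[/orP[]|] /eqP->; rewrite ?hx ?hy ?hz eqxx.
(* The edge [f] avoids the class of [y], so the non-neighbour of [y] on [f] belongs to [out y]. *)
have hit m f r y : #|K m| = k + 1 -> f \in EX m -> r \in f -> h r != m ->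
    full y -> h y != m -> h y != h r -> exists2 x, x \in f & x \in out y.
  move=> Km fX rf hr fy ym yr; have fE : f \in E by move: fX; rewrite inE => /andP[].
  have [r' [r'f hr' allm]] := EXP m f Km fX.
  have r'r : r = r' by apply/eqP; apply: contraNT hr => rr'; apply/eqP/allm.
  have yf x : x \in f -> h x != h y.
    move=> xf; case: (eqVneq x r') => [->|xr']; first by rewrite eq_sym -r'r.
    by rewrite (allm x xf xr') eq_sym.
  have nyf : y \notin f by apply/negP=> /yf; rewrite eqxx.
  have [x xf xy] := sf_sail sfE fE nyf; exists x => //.
  by rewrite in_setD xy inK yf.
have sumsdef S : sdef S + sdef (~: S) + 3 * surplus + 3 = k.
  by rewrite -sdefU -?setI_eq0 ?setICr // setUCr (sum_def lE).
case: Kjl => [[Kj Kl]|[Kj Kl]].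
  (* For [y] in the class [m'] the set [out y] has one element, so two such edges would share it; a
     [y1] of [m'] adjacent to that vertex yields a second shared vertex, against linearity. *)
  have le1 (A : {set {set V}}) m m' : A \subset EX i -> m != i -> m != m' ->
      #|K m'| = k -> m' != i ->
      (forall f, f \in A -> exists2 r, r \in f & h r = m) -> #|A| <= 1.
    move=> AX mi mm' Km' m'i Ar; rewrite leqNgt; apply/negP.
    case/card_gt1P=> f [f' [fA f'A ff']].
    have fX := subsetP AX f fA; have f'X := subsetP AX f' f'A.
    have [r rf hr] := Ar f fA; have [r' r'f hr'] := Ar f' f'A.
    have both y : full y -> h y = m' -> exists o, [/\ o \in f, o \in f' & o \in out y].
      move=> fy hy.
      have hyi : h y != i by rewrite hy.
      have [hri hr'i] : h r != i /\ h r' != i by rewrite hr hr'.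
      have [hyr hyr'] : h y != h r /\ h y != h r' by rewrite hr hr' hy eq_sym.
      have [o of_ oy] := hit i f r y Ki fX rf hri fy hyi hyr.
      have [o' o'f oy'] := hit i f' r' y Ki f'X r'f hr'i fy hyi hyr'.
      have : #|out y| <= 1 by have := outE y fy; rewrite hy Km'; nlia.
      by move/card_le1_eqP/(_ o o' oy oy') => oo'; exists o; split=> //; rewrite -oo'.
    have [y0 fy0 hy0] := Hex m'; have [o [of_ of' oy0]] := both y0 fy0 hy0.
    have [_ ho] := outW y0 o fy0 oy0.
    have [|y1 [fy1 hy1 ay1]] := Hadj o m'; first by rewrite eq_sym -hy0.
    have [o1 [o1f o1f' oy1]] := both y1 fy1 hy1.
    have [co1 _] := outW y1 o1 fy1 oy1.
    have oo1 : o != o1.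
      by apply: contraTneq co1 => <-; rewrite in_co adj_sym ay1 andbF.
    case/eqP: ff'.
    by apply: (sf_lin sfE _ _ oo1) => //; [move: fX|move: f'X]; rewrite inE => /andP[].
  pose A m := [set f in EX i | [exists r in f, h r == m]].
  have Ar m f : f \in A m -> exists2 r, r \in f & h r = m.
    by rewrite inE => /andP[_ /exists_inP[r rf /eqP hr]]; exists r.
  have Aj : #|A j| <= 1.
    by apply: (le1 _ j l) => //; rewrite 1?eq_sym ?subsetIl //; [apply/subsetP=> f; rewrite inE => /andP[]|apply: Ar].
  have Al : #|A l| <= 1.
    by apply: (le1 _ l j) => //; rewrite 1?eq_sym ?subsetIl //; [apply/subsetP=> f; rewrite inE => /andP[]|apply: Ar].
  have : #|EX i| <= #|A j| + #|A l|.
    apply: leq_trans (leq_card_setU _ _); apply: subset_leq_card; apply/subsetP=> f fX.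
    have [r [rf hr _]] := EXP i f Ki fX.
    have := ord3_case (h r) ij il jl; rewrite (negbTE hr) /= => hrjl.
    rewrite in_setU; apply/orP; case/orP: hrjl => hrm; [left|right];
      by rewrite in_set fX; apply/exists_inP; exists r.
  (* At most two edges carry excess, so [K i] has deficiency at least [k - 3 - surplus], while the
     total is [k - 3 - 3 surplus]. *)
  have := sumsdef (K i); have := cardEX i Ki => H1 H2 H3.
  have [s0 d0] : surplus = 0 /\ sdef (~: K i) = 0 by nlia.
  split=> //; have [u fu hu] := Hex i; exists u => //; apply/subsetP=> w wW.
  have nfw : ~~ full w by rewrite -in_defset.
  have [_ ->] := exE i u fu hu Ki; rewrite in_setD1; apply/andP; split.
    by apply: contraNneq nfw => ->.
  by apply: contraNT nfw => wK; apply: (sdef0 lE d0); rewrite inE.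
pose F := EX i :|: EX j.
have dFi : [disjoint EX i & EX j].
  apply/pred0P=> f /=; apply/negP=> /andP[fi fj].
  have [r [rf hr ri]] := EXP i f Ki fi.
  move: fj; rewrite inE => /andP[fE /card_gt1P[x [y []]]].
  rewrite !in_setI !inK => /andP[xf /eqP hx] /andP[yf /eqP hy] xy.
  have xr : x = r by apply/eqP; apply: contraNT ij => /(ri x xf) <-; rewrite hx.
  have yr : y = r by apply/eqP; apply: contraNT ij => /(ri y yf) <-; rewrite hy.
  by rewrite xr yr eqxx in xy.
(* The two instances of [cardEX] add up to at least [k + 1 + surplus] edges; this is where [4 <= k]
   enters. *)
have cardF : 5 <= #|F|.
  have -> : #|F| = #|EX i| + #|EX j|.
    by apply/eqP; rewrite (leq_card_setU _ _).2.
  have := cardEX i Ki; have := cardEX j Kj.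
  have : sdef (K i) + sdef (K j) <= sdef setT.
    rewrite -sdefU; first exact/sdefS/subsetT.
    apply/pred0P=> x /=; rewrite !inK; apply/negP=> /andP[/eqP->].
    by rewrite (negbTE ij).
  by have := sum_def lE; nlia.
have FE f : f \in F -> f \in E by rewrite !inE => /orP[] /andP[].
(* The third vertex of [f] lies in the other class of size [k + 1]: were it in class [l], a full
   vertex of that other class would be hit although its [out] is empty. *)
have hitF f y : f \in F -> full y -> h y = l -> exists2 x, x \in f & x \in out y.
  have aux m m' : #|K m| = k + 1 -> #|K m'| = k + 1 -> m != m' -> m != l -> m' != l ->
      f \in EX m -> full y -> h y = l -> exists2 x, x \in f & x \in out y.
    move=> Km Km' mm' ml m'l fX fy hy.
    have [r [rf hr _]] := EXP m f Km fX.
    have hrm' : h r = m'.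
      have := ord3_case (h r) mm' ml m'l; rewrite (negbTE hr) /= => /orP[/eqP//|/eqP hrl].
      have [z fz hz] := Hex m'.
      have [zm zr] : h z != m /\ h z != h r by rewrite hz hrl (eq_sym m').
      have [x _] := hit m f r z Km fX rf hr fz zm zr.
      suff -> : out z = set0 by rewrite inE.
      by apply/eqP; rewrite -cards_eq0; have := outE z fz; rewrite hz Km'; nlia.
    by apply: (hit m f r y) => //; rewrite hy ?hrm' // eq_sym.
  rewrite in_setU => /orP[fX|fX]; first exact: (aux i j).
  by apply: (aux j i) => //; rewrite eq_sym.
have out2 y : full y -> h y = l -> #|out y| = 2.
  by move=> fy hy; have := outE y fy; rewrite hy Kl; nlia.
have [y fy hy] := Hex l.
(* With [y1] adjacent to [o], each edge of [F] through [o] also meets the two-element set [out y1],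
   and by linearity each of its points accounts for at most one edge. *)
have few o : o \in out y -> #|F :&: star o| <= 2.
  move=> oy; have [_ ho] := outW y o fy oy.
  have [|y1 [fy1 hy1 ay1]] := Hadj o l; first by rewrite -hy eq_sym.
  have step : #|F :&: star o| <= \sum_(p in out y1) #|star o :&: star p|.
    have : F :&: star o \subset \bigcup_(p in out y1) (star o :&: star p).
      apply/subsetP=> f; rewrite in_setI => /andP[fF fo].
      have [p pf py] := hitF f y1 fF fy1 hy1; apply/bigcupP; exists p => //.
      by rewrite in_setI fo inE pf FE.
    move/subset_leq_card => le; apply: leq_trans le _.
    apply: (big_rec2 (fun (A : {set {set V}}) n => #|A| <= n)); rewrite ?cards0 //.
    by move=> p n A _ An; apply: leq_trans (leq_card_setU _ _) _; rewrite leq_add2l.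
  apply: leq_trans step _; rewrite -(out2 y1 fy1 hy1) -[leqRHS]sum1_card.
  apply: leq_sum => p py.
  have [cp _] := outW y1 p fy1 py.
  have op : o != p.
    by apply: contraTneq cp => <-; rewrite in_co adj_sym ay1 andbF.
  apply/card_le1_eqP=> f f'; rewrite !inE => /andP[/andP[fE of_] /andP[_ pf]].
  move=> /andP[/andP[f'E of'] /andP[_ pf']].
  exact: (sf_lin sfE f'E fE op).
have : #|F| <= \sum_(o in out y) #|F :&: star o|.
  have : F \subset \bigcup_(o in out y) (F :&: star o).
    apply/subsetP=> f fF; have [o of_ oy] := hitF f y fF fy hy.
    by apply/bigcupP; exists o; rewrite // in_setI fF inE of_ FE.
  move/subset_leq_card => le; apply: leq_trans le _.
  apply: (big_rec2 (fun (A : {set {set V}}) n => #|A| <= n)); rewrite ?cards0 //.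
  by move=> p n A _ An; apply: leq_trans (leq_card_setU _ _) _; rewrite leq_add2l.
have : \sum_(o in out y) #|F :&: star o| <= #|out y| * 2.
  by rewrite -sum_nat_const; apply: leq_sum.
by rewrite out2 //; move: cardF; nlia.
Qed.

End Classes.

(** * Existence of the full vertex and the exact number of edges *)

Section Isolation.

Variables (V : finType) (E : {set {set V}}) (k : nat).
Hypothesis lE : large E k.

Lemma isolation : surplus E k = 0 /\
  exists2 v, full E k v & defset E k \subset co E v.
Proof.
case: (boolP [exists v, [exists e, [&& full E k v, e \in E & e \subset co E v]]]).
  case/existsP=> v /existsP[e /and3P[fv eE ev]].
  have [s0 We] := edge_in_co lE fv eE ev.
  by split=> //; exists v => //; apply: subset_trans We ev.
move=> noin0; have noin v e : full E k v -> e \in E -> ~~ (e \subset co E v).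
  move=> fv eE; apply: contraNN noin0 => ev; apply/existsP; exists v.
  by apply/existsP; exists e; rewrite fv eE.
(* A single deficient vertex has a non-neighbour, which is full because no other vertex is
   deficient. *)
have small : surplus E k = 0 -> #|defset E k| <= 1 ->
    exists2 v, full E k v & defset E k \subset co E v.
  move=> _ W1; case: (set_0Vmem (defset E k)) => [W0|[w wW]].
    have [e eE fe] := full_edge lE.
    have /card_gt0P[x xe] : 0 < #|e| by rewrite (sf_card (large_sf lE) eE).
    by exists x; rewrite ?fe // W0 sub0set.
  have /card_gt0P[v vw] : 0 < #|co E w|.
    by rewrite (card_coE lE); have := large_k lE; lia.
  have eW x : x \in defset E k -> x = w by move/card_le1_eqP: W1; apply.
  exists v; last by apply/subsetP=> x /eW ->; rewrite co_sym.
  apply: contraTT vw => nfv; have -> : v = w by apply: eW; rewrite in_defset.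
  by rewrite coxx.
case: (boolP [exists p, lax E k p]) => [/existsP[p lp]|].
  have [s0 _] := lax_def lE noin lp; split=> //.
  case: (leqP #|defset E k| 1) => [|W2]; first exact: small.
  exact: lax_case lp W2.
rewrite negb_exists => /forallP nolax.
(* For [k = 3], [sum_def] leaves neither surplus nor deficiency. *)
case: (leqP k 3) => k3; last exact: nolax_case.
have := sum_def lE; have := sdef_card lE setT; rewrite setTI => W1 sd.
have s0 : surplus E k = 0 by nlia.
by split=> //; apply: small => //; nlia.
Qed.

Lemma card_extremal : #|E| = k ^ 2 + 1.
Proof.
have [s0 _] := isolation; have := large_E lE; move: s0; rewrite /surplus; lia.
Qed.

End Isolation.

(** * The neighbourhood of such a vertex *)

Section Structure.

Variables (V : finType) (E : {set {set V}}) (k : nat).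
Hypothesis lE : large E k.
Let sfE := large_sf lE.
Let k3 := large_k lE.

Implicit Types (e f S : {set V}) (x y z u w p q r : V).

Local Notation adj := (adj E).
Local Notation nbr := (nbr E).
Local Notation co := (co E).
Local Notation star := (star E).
Local Notation full := (full E k).

Variable v : V.
Hypotheses (fv : full v) (Wv : defset E k \subset co v).

Local Notation U := (co v).
Local Notation N := (nbr v).
Local Notation exc := (excess E v).

Lemma nbr_full r : adj v r -> full r.
Proof.
move=> vr; apply: contraT => nf; have := subsetP Wv r.
by rewrite in_defset nf in_co vr andbF => /(_ isT).
Qed.

Lemma texcess2 : texcess E v = 2.
Proof.
have [s0 _] := isolation lE; have := texcess_full lE fv; have := sum_def lE.
have -> : deficit_sum E k setT = deficit_sum E k U.
  rewrite /deficit_sum [LHS](big_setID U) /= setTI [X in _ + X]big1 ?addn0 // => x.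
  rewrite !inE -[_ && ~~ _]in_co andbT => xU; apply: def_full.
  by apply: contraNT xU => nf; apply: (subsetP Wv); rewrite in_defset.
by rewrite s0; nlia.
Qed.

Lemma card_miss r : adj v r ->
  #|co r :&: U| + \sum_(f in star r) exc f = 1.
Proof. by move=> vr; rewrite (adj_co lE fv vr) (def_full (nbr_full vr)). Qed.

Lemma card_miss1 r : adj v r -> #|co r :&: U| <= 1.
Proof. by move/card_miss; nlia. Qed.

Lemma miss_eq r z z' : adj v r -> z \in co r -> z' \in co r -> z \in U -> z' \in U ->
  z = z'.
Proof.
move=> /card_miss1/card_le1_eqP H zr z'r zU z'U.
by apply/esym/H; rewrite in_setI ?zr ?z'r.
Qed.

Lemma edge_third r r' f : adj v r -> adj v r' -> r != r' -> f \in E -> r \in f ->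
  r' \in f -> v \notin f -> exists2 z, z \in U & f = [set r; r'; z].
Proof.
move=> vr vr' rr' fE rf r'f vf.
have /card_gt0P[z] := meet_co sfE fE vf; rewrite in_setI => /andP[zf zU].
have [w [wr wr' fe]] := card3P (sf_card sfE fE) rr' rf r'f.
exists z => //; have zr : z != r by apply: contraTneq zU => ->; rewrite in_co vr andbF.
have zr' : z != r' by apply: contraTneq zU => ->; rewrite in_co vr' andbF.
by move: zf; rewrite fe !inE (negbTE zr) (negbTE zr') => /eqP->.
Qed.

(** Of its [2k] neighbours, [r] has [v] and the vertices of [U] that it does not miss outside
    [N]. *)
Lemma card_nbrI r : adj v r -> #|nbr r :&: N| + 1 = k + #|co r :&: U|.
Proof.
move=> vr; have fr := nbr_full vr.
have := card_nbr_full lE fr; rewrite -(cardsID N).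
have := card_co_full lE fv; rewrite -(cardsID (nbr r)).
have -> : U :\: nbr r = co r :&: U.
  apply/setP=> x; rewrite in_setD in_setI in_nbr.
  case: (eqVneq r x) => [<-|rx]; first by rewrite in_co vr !andbF.
  by rewrite (in_coN _ rx).
have -> : nbr r :\: N = v |: (U :&: nbr r).
  apply/setP=> x; rewrite in_setU1 in_setD in_setI !in_nbr in_co.
  case: (eqVneq x v) => [->|_] //=; first by rewrite adjxx adj_sym vr.
by rewrite cardsU1 in_setI coxx /=; nlia.
Qed.

(* The other neighbours of [v] miss exactly one vertex of [U]. *)
Definition tight := [set r in N | co r :&: U == set0].

Lemma tight_nadj r z : r \in tight -> z \in U -> adj r z.
Proof.
rewrite inE in_nbr => /andP[vr /eqP/setP/(_ z)]; rewrite in_setI in_set0 => H zU.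
move: H; rewrite zU andbT => /negbT; rewrite in_coN ?negbK //.
by apply: contraTneq zU => <-; rewrite in_co vr andbF.
Qed.

Lemma card_nbr_tight r : r \in tight -> #|nbr r :&: N| + 1 = k.
Proof.
by rewrite inE in_nbr => /andP[vr /eqP H]; rewrite card_nbrI // H cards0 addn0.
Qed.

Lemma card_nbr_ntight r : adj v r -> r \notin tight -> #|nbr r :&: N| = k.
Proof.
move=> vr; rewrite inE in_nbr vr -cards_eq0 /= => nz.
by have := card_miss1 vr; have := card_nbrI vr; move: nz; case: #|co r :&: U| => [|[|]] //; nlia.
Qed.

(** By [sf_sail] the edge [f] contains a non-neighbour of [q]; since [p], [p'] and [v] are all
    adjacent to [q], it is a third vertex, lying in [U]. *)
Lemma triangle_miss p p' q f : adj v p -> adj v p' -> adj v q -> adj p p' ->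
    adj p q -> adj p' q -> f \in E -> p \in f -> p' \in f ->
  exists2 z, f = [set p; p'; z] & (z \in U) && (z \in co q).
Proof.
move=> vp vp' vq pp' pq p'q fE pf p'f.
have ne := adj_neq pp'.
case: (boolP (v \in f)) => vf.
  have fe := edge_size sfE fE vf pf p'f (adj_neq vp) (adj_neq vp') ne.
  have qf : q \notin f.
    by rewrite fe !inE !negb_or !(eq_sym q) (adj_neq vq) (adj_neq pq) (adj_neq p'q).
  have [z] := sf_sail sfE fE qf; rewrite fe !inE -orbA.
  by case/or3P=> /eqP->; rewrite adj_sym ?vq ?pq ?p'q ?andbF.
have [z zU fe] := edge_third vp vp' ne fE pf p'f vf; exists z => //; rewrite zU /=.
have qz : q != z by apply: contraTneq zU => <-; rewrite in_co vq andbF.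
have qf : q \notin f.
  by rewrite fe !inE !negb_or qz !(eq_sym q) (adj_neq pq) (adj_neq p'q).
have [z'] := sf_sail sfE fE qf; rewrite fe !inE -orbA.
by case/or3P=> /eqP->; rewrite ?(adj_sym _ q) ?pq ?p'q ?andbF // adj_sym pq andbF.
Qed.

Lemma triangle_ntight p p' q : adj v p -> adj v p' -> adj v q -> adj p p' ->
  adj p q -> adj p' q -> q \notin tight.
Proof.
move=> vp vp' vq pp' pq p'q; have /adjP[_ [f [fE pf p'f]]] := pp'.
have [z _ /andP[zU zq]] := triangle_miss vp vp' vq pp' pq p'q fE pf p'f.
by apply/negP=> /tight_nadj/(_ zU); rewrite (co_nadj zq).
Qed.

Lemma edge_pair_inj p z q q' : z != p -> q != p -> q != z -> q' != p -> q' != z ->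
  [set p; q; z] = [set p; q'; z] -> q = q'.
Proof.
move=> zp qp qz q'p q'z /setP/(_ q); rewrite !inE eqxx orbT /= (negbTE qp) (negbTE qz) /=.
by rewrite orbF => /esym/eqP.
Qed.

(** Vertices that are not tight have [k] neighbours among the [2k] vertices of [N], and the edge
    [vxy] makes the two neighbourhoods disjoint: they are the two sides. *)
Definition good_pair x y := [&& ([set v; x; y] \in E) && (x != y), adj v x, adj v y,
  x \notin tight & y \notin tight].

Lemma good_pair_sym x y : good_pair x y -> good_pair y x.
Proof. by case/and5P=> *; apply/and5P; rewrite setUAC eq_sym. Qed.

Section GoodPair.

Variables x y : V.
Hypothesis gxy : good_pair x y.

Let xyE : [set v; x; y] \in E. Proof. by case/and5P: gxy => /andP[]. Qed.
Let xy : x != y. Proof. by case/and5P: gxy => /andP[]. Qed.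
Let vx : adj v x. Proof. by case/and5P: gxy. Qed.
Let vy : adj v y. Proof. by case/and5P: gxy. Qed.
Let axy : adj x y.
Proof. by apply: (adj_edge xyE); rewrite ?inE ?eqxx ?orbT. Qed.

Lemma card_side : #|nbr x :&: N| = k.
Proof. by apply: card_nbr_ntight => //; case/and5P: gxy. Qed.

(** By [triangle_miss] a common neighbour would force the third vertex of the edge through [x] and
    [y] into [U], but that vertex is [v]. *)
Lemma side_disj r : adj v r -> adj x r -> adj y r = false.
Proof.
move=> vr xr; apply/negP=> yr.
have [z ze /andP[zU _]] : exists2 z, [set v; x; y] = [set x; y; z] & (z \in U) && (z \in co r).
  by apply: triangle_miss; rewrite // !inE eqxx ?orbT.
move/setP/(_ v): ze; rewrite !inE eqxx (negbTE (adj_neq vx)) (negbTE (adj_neq vy)) /=.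
by move=> /esym/eqP vz; rewrite -vz coxx in zU.
Qed.

End GoodPair.

Lemma side_cover x y r : good_pair x y -> adj v r -> adj x r = ~~ adj y r.
Proof.
move=> gxy vr; case: (boolP (adj x r)) => xr; first by rewrite (side_disj gxy).
apply/esym/negPn; have gyx := good_pair_sym gxy.
have := cardsUI (nbr x :&: N) (nbr y :&: N).
have -> : (nbr x :&: N) :&: (nbr y :&: N) = set0.
  apply/setP=> z; rewrite !in_setI !in_nbr in_set0; apply/negP.
  by case/andP=> /andP[xz vz]; rewrite (side_disj gxy).
rewrite cards0 addn0 (card_side gxy) (card_side gyx) => cU.
have : nbr x :&: N :|: nbr y :&: N == N.
  by rewrite eqEcard subUset !subsetIr cU (card_nbr_full lE fv) addnn leqnn.
by move/eqP/setP/(_ r); rewrite in_setU !in_setI !in_nbr vr (negbTE xr) /= !andbT.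
Qed.

Section Inner.

Variables x y p p' : V.
Hypotheses (gxy : good_pair x y) (vp : adj v p) (vp' : adj v p').
Hypotheses (xp : adj x p) (xp' : adj x p') (pp' : adj p p').

Let vx : adj v x. Proof. by case/and5P: gxy. Qed.
Let px : adj p x. Proof. by rewrite adj_sym. Qed.
Let p'x : adj p' x. Proof. by rewrite adj_sym. Qed.

Lemma co_neq q z : adj v q -> z \in U -> z != q.
Proof. by move=> vq; apply: contraTneq => ->; rewrite in_co vq andbF. Qed.

(** [x] misses only one vertex of [U], and [triangle_miss] puts it on both the edge through [p],
    [p'] and the one through [p], [p'']; so these edges coincide. *)
Lemma inner_uniq p'' : adj v p'' -> adj x p'' -> adj p p'' -> p'' = p'.
Proof.
move=> vp'' xp'' pp''; have p''x : adj p'' x by rewrite adj_sym.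
have /adjP[n1 [f [fE pf p'f]]] := pp'; have /adjP[n2 [g [gE pg p''g]]] := pp''.
have [z fe /andP[zU zx]] := triangle_miss vp vp' vx pp' px p'x fE pf p'f.
have [z' ge /andP[z'U z'x]] := triangle_miss vp vp'' vx pp'' px p''x gE pg p''g.
have zz' := miss_eq vx zx z'x zU z'U; rewrite -{}zz' in ge *.
have zp := co_neq vp zU.
have fg : f = g by apply: (sf_lin sfE fE gE zp); rewrite ?fe ?ge ?inE ?eqxx ?orbT.
rewrite fe ge in fg; apply: (edge_pair_inj zp _ _ _ _ (esym fg)); rewrite 1?eq_sym //.
  exact: co_neq.
exact: co_neq.
Qed.

(** The edge through [p'], [q] and the one through [p'], [x] share the only vertex of [U] missed by
    [p], hence coincide. *)
Lemma common_uniq q : adj v q -> adj p q -> adj p' q -> q = x.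
Proof.
move=> vq pq p'q; have qp : adj q p by rewrite adj_sym.
have /adjP[n1 [f [fE p'f qf]]] := p'q; have /adjP[n2 [g [gE p'g xg]]] := p'x.
have p'p : adj p' p by rewrite adj_sym.
have [z fe /andP[zU zp]] := triangle_miss vp' vq vp p'q p'p qp fE p'f qf.
have [z' ge /andP[z'U z'p]] := triangle_miss vp' vx vp p'x p'p xp gE p'g xg.
have zz' := miss_eq vp zp z'p zU z'U; rewrite -{}zz' in ge *.
have zp' := co_neq vp' zU.
have fg : f = g by apply: (sf_lin sfE fE gE zp'); rewrite ?fe ?ge ?inE ?eqxx ?orbT.
rewrite fe ge in fg; apply: (edge_pair_inj zp' _ _ _ _ fg); rewrite 1?eq_sym //.
  exact: co_neq.
exact: co_neq.
Qed.

Lemma inner_ntight : p \notin tight.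
Proof. by apply: (triangle_ntight vp' vx vp); rewrite // adj_sym. Qed.

Lemma card_cross : #|nbr p :&: (nbr y :&: N)| + 1 = k.
Proof.
rewrite -(card_nbr_ntight vp inner_ntight) -(cardsID (nbr x) (nbr p :&: N)).
have -> : (nbr p :&: N) :&: nbr x = [set p'].
  apply/setP=> q; rewrite in_set1 !in_setI !in_nbr; apply/idP/eqP => [|->].
    by case/andP=> /andP[pq vq] xq; apply: inner_uniq.
  by rewrite pp' vp' xp'.
have -> : (nbr p :&: N) :\: nbr x = nbr p :&: (nbr y :&: N).
  apply/setP=> q; rewrite in_setD !in_setI !in_nbr.
  by case: (boolP (adj v q)) => vq; rewrite ?andbF // (side_cover gxy) // negbK !andbT andbC.
by rewrite cards1 addnC.
Qed.

End Inner.

(** [p] and [p'] each have [k - 1] neighbours on the side of [y], which has [k] vertices, and only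
    [x] can be common to both: [2 (k - 1) - 1 <= k]. *)
Lemma inner_k3 x y p p' : good_pair x y -> adj v p -> adj v p' -> adj x p ->
  adj x p' -> adj p p' -> k = 3.
Proof.
move=> gxy vp vp' xp xp' pp'; have p'p : adj p' p by rewrite adj_sym.
have c1 := card_cross gxy vp vp' xp xp' pp'.
have c2 := card_cross gxy vp' vp xp' xp p'p.
have cy := card_side (good_pair_sym gxy).
have := cardsUI (nbr p :&: (nbr y :&: N)) (nbr p' :&: (nbr y :&: N)).
have : #|(nbr p :&: (nbr y :&: N)) :&: (nbr p' :&: (nbr y :&: N))| <= 1.
  apply/card_le1_eqP=> q q'; rewrite !in_setI !in_nbr.
  case/andP=> /and3P[pq yq vq] /and3P[p'q _ _] /andP[/and3P[pq' yq' vq'] /and3P[p'q' _ _]].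
  rewrite (common_uniq gxy vp vp' xp xp' pp' vq pq p'q).
  by rewrite (common_uniq gxy vp vp' xp xp' pp' vq' pq' p'q').
have : #|nbr p :&: (nbr y :&: N) :|: nbr p' :&: (nbr y :&: N)| <= k.
  by rewrite -cy subset_leq_card // subUset !subsetIr.
by have := k3; nlia.
Qed.

Lemma excess_cases :
  (exists e, [/\ e \in E, e \subset U & forall f, f \in E -> f != e -> exc f = 0]) \/
  (exists e1 e2, [/\ e1 \in E, e2 \in E, e1 != e2, exc e1 = 1 & exc e2 = 1] /\
     forall f, f \in E -> f != e1 -> f != e2 -> exc f = 0).
Proof.
have tot := texcess2; rewrite /texcess in tot.
have pos (A : {set {set V}}) : 0 < \sum_(e in A) exc e -> exists2 e, e \in A & 0 < exc e.
  move=> H; apply/exists_inP; apply: contraLR H => /exists_inPn none.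
  by rewrite -eqn0Ngt big1 // => e /none; rewrite lt0n negbK => /eqP.
have [|e1 e1E x1] := pos E; first by rewrite tot.
have tot1 : exc e1 + \sum_(e in E :\ e1) exc e = 2 by rewrite -tot [RHS](big_setD1 e1).
have zero (A : {set {set V}}) e : \sum_(f in A) exc f = 0 -> e \in A -> exc e = 0.
  by move=> /eqP; rewrite sum_nat_eq0 => /forall_inP H /H/eqP.
have [x2|x1'] : exc e1 = 2 \/ exc e1 = 1 by nlia.
  left; exists e1; split=> // [|f fE fe].
    apply/setIidPl/eqP; rewrite eqEcard subsetIl (sf_card sfE e1E) /=.
    by move: x2; rewrite /excess; nlia.
  apply: (zero (E :\ e1)); last by rewrite in_setD1 fe.
  by nlia.
right; have [|e2] := pos (E :\ e1); first by nlia.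
rewrite in_setD1 => /andP[e21 e2E] x2.
have tot2 : exc e2 + \sum_(e in E :\ e1 :\ e2) exc e = \sum_(e in E :\ e1) exc e.
  by rewrite [RHS](big_setD1 e2) // in_setD1 e21.
exists e1, e2; split; first by split=> //; [rewrite eq_sym|nlia].
move=> f fE f1 f2; apply: (zero (E :\ e1 :\ e2)); first by nlia.
by rewrite !in_setD1 f1 f2.
Qed.

(** The [k >= 3] edges at [v] are disjoint outside [v], so two tight vertices cannot meet all of
    them. *)
Lemma exists_good_pair : #|tight| <= 2 -> exists x y, good_pair x y.
Proof.
move=> t2; case: (boolP [forall f in star v, 0 < #|f :&: tight|]) => [/forall_inP allf|].
  have : \sum_(f in star v) 1 <= \sum_(f in star v) #|f :&: tight|.
    exact: leq_sum.
  rewrite sum_star //; last by rewrite inE in_nbr adjxx.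
  have := subset_leq_card (subsetIr N tight); have/eqP := fv; rewrite /deg sum1_card.
  by have := k3; nlia.
rewrite negb_forall_in => /exists_inP[f]; rewrite inE => /andP[fE vf].
rewrite -eqn0Ngt cards_eq0 => /eqP/setP ft.
have := cardsD1 v f; rewrite vf (sf_card sfE fE) => -[/esym/eqP/cards2P[x [y [xy fxy]]]].
have xf : x \in f :\ v by rewrite fxy !inE eqxx.
have yf : y \in f :\ v by rewrite fxy !inE eqxx orbT.
move: xf yf; rewrite !in_setD1 => /andP[xv xf] /andP[yv yf].
have fe : f = [set v; x; y] by rewrite -(setD1K vf) fxy setUA.
exists x, y; apply/and5P; rewrite -fe fE xy; split=> //.
- by apply: (adj_edge fE) => //; rewrite eq_sym.
- by apply: (adj_edge fE) => //; rewrite eq_sym.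
- by have := ft x; rewrite in_setI xf in_set0 /= => ->.
- by have := ft y; rewrite in_setI yf in_set0 /= => ->.
Qed.

End Structure.

(** * The bipartite case *)

(** [P], [Q] and [Z] are to become the parts [X], [Y] and [z_1, ..., z_(k-2)] of Constructions 1 and
    2. *)
Record tripartition (V : finType) (E : {set {set V}}) (k : nat)
    (P Q Z : {set V}) (a b c : V) : Prop := Tripartition {
  tri_P : #|P| = k;
  tri_Q : #|Q| = k;
  tri_Z : #|Z| = k - 2;
  tri_PQ : [disjoint P & Q];
  tri_PZ : [disjoint P & Z];
  tri_QZ : [disjoint Q & Z];
  tri_abc : uniq [:: a; b; c];
  tri_out : forall x, x \in [:: a; b; c] -> [&& x \notin P, x \notin Q & x \notin Z];
  tri_indepP : forall r s, r \in P -> s \in P -> ~~ adj E r s;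
  tri_indepQ : forall r s, r \in Q -> s \in Q -> ~~ adj E r s;
  tri_ZP : forall z r, z \in Z -> r \in P -> adj E z r;
  tri_ZQ : forall z r, z \in Z -> r \in Q -> adj E z r
}.

Lemma tripartition_sym (V : finType) (E : {set {set V}}) k P Q Z a b c :
  tripartition E k P Q Z a b c -> tripartition E k Q P Z a b c.
Proof.
case=> *; split=> //; first by rewrite disjoint_sym.
by move=> x; rewrite andbCA; auto.
Qed.

Section Outcome.

Variables (V : finType) (E : {set {set V}}) (k : nat).
Hypothesis lE : large E k.
Let sfE := large_sf lE.
Let k3 := large_k lE.

Implicit Types (e f S : {set V}) (x y z u w p q r : V).

Local Notation adj := (adj E).
Local Notation nbr := (nbr E).
Local Notation co := (co E).
Local Notation star := (star E).
Local Notation full := (full E k).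

Definition outcome2 := exists P Q Z a b c, [/\ tripartition E k P Q Z a b c,
  forall r s, r \in P -> s \in Q -> adj r s & [set a; b; c] \in E].

(** [r1] and [r2] are to become [a'] and [c'], whose pair is the uncoloured edge of the 2-factor. *)
Definition outcome1 := exists P Q Z a b c r1 r2, [/\ tripartition E k P Q Z a b c,
  r1 \in P, r2 \in Q,
  forall r s, r \in P -> s \in Q -> adj r s = ~~ ((r == r1) && (s == r2))
  & [set r1; b; c] \in E /\ [set r2; a; b] \in E].

Variable v : V.
Hypotheses (fv : full v) (Wv : defset E k \subset co v).

Local Notation U := (co v).
Local Notation N := (nbr v).
Local Notation exc := (excess E v).
Local Notation tight := (tight E v).

Lemma excess1 e : e \in E -> exc e = 1 ->
  exists p q r, [/\ e = [set p; q; r], uniq [:: p; q; r], p \in U, q \in U & r \in N].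
Proof.
rewrite /excess => eE x1.
have /eqP/cards2P[p [q [pq eU]]] : #|e :&: U| = 2 by move: x1; nlia.
have : p \in e :&: U by rewrite eU !inE eqxx.
have : q \in e :&: U by rewrite eU !inE eqxx orbT.
rewrite !in_setI => /andP[qe qU] /andP[pe pU].
have [r [rp rq ee]] := card3P (sf_card sfE eE) pq pe qe.
have re : r \in e by rewrite ee !inE eqxx orbT.
exists p, q, r; split=> //; first by rewrite /= !inE negb_or pq !(eq_sym _ r) rp rq.
have rU : r \notin U.
  apply/negP=> rU; have : r \in [set p; q] by rewrite -eU in_setI re.
  by rewrite !inE (negbTE rp) (negbTE rq).
have vr : v != r by apply/eqP=> vr; move: x1; rewrite disj_co // vr.
by rewrite in_nbr; move: rU; rewrite in_coN // negbK.
Qed.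

(** A neighbour of [v] is not on [e], so all edges at [r] have excess 0 and [card_miss] leaves one
    missed vertex of [U]. *)
Lemma inside_ntight e r : e \in E -> e \subset U ->
  (forall f, f \in E -> f != e -> exc f = 0) -> adj v r -> r \notin tight.
Proof.
move=> eE eU zero vr; have := card_miss lE fv Wv vr.
rewrite big1 => [|f]; first by rewrite addn0 inE -cards_eq0 andbC => ->.
rewrite inE => /andP[fE rf]; apply: zero => //.
by apply: contraTneq rf => ->; apply: contraL vr => /(subsetP eU)/co_nadj->.
Qed.

(** By [card_miss] a neighbour of [v] is tight exactly when it lies on an edge of positive excess,
    and then on one only; the neighbours of [v] on [e1] and [e2] are just [r1] and [r2]. *)
Lemma tight_pair e1 e2 p1 q1 r1 p2 q2 r2 : e1 \in E -> e2 \in E ->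
    exc e1 = 1 -> exc e2 = 1 -> e1 != e2 ->
    (forall f, f \in E -> f != e1 -> f != e2 -> exc f = 0) ->
    e1 = [set p1; q1; r1] -> e2 = [set p2; q2; r2] ->
    p1 \in U -> q1 \in U -> p2 \in U -> q2 \in U -> r1 \in N -> r2 \in N ->
  r1 != r2 /\ tight = [set r1; r2].
Proof.
rewrite !in_nbr => e1E e2E x1 x2 e12 zero e1e e2e p1U q1U p2U q2U vr1 vr2.
have tightE r e : adj v r -> e \in E -> exc e = 1 -> r \in e -> r \in tight.
  move=> vr eE xe re; rewrite inE in_nbr vr -cards_eq0.
  have := card_miss lE fv Wv vr; rewrite (bigD1 e) ?inE ?eE //= xe; nlia.
have r1e : r1 \in e1 by rewrite e1e !inE eqxx orbT.
have r2e : r2 \in e2 by rewrite e2e !inE eqxx orbT.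
have neq : r1 != r2.
  apply: contraNneq e12 => r12; apply: contraT => e12.
  have := card_miss lE fv Wv vr1; rewrite (bigD1 e1) ?inE ?e1E //= x1.
  rewrite (bigD1 e2) /= ?x2; first by nlia.
  by rewrite inE e2E r12 r2e eq_sym.
split=> //; apply/eqP; rewrite eqEsubset; apply/andP; split; apply/subsetP=> r.
  rewrite inE in_nbr -cards_eq0 => /andP[vr /eqP m0].
  have := card_miss lE fv Wv vr; rewrite m0 add0n; apply: contra_eqT.
  rewrite !inE negb_or => /andP[rr1 rr2]; rewrite big1 // => f.
  have rU z : z \in U -> r != z by rewrite eq_sym; apply: contraTneq => ->; rewrite in_co vr andbF.
  rewrite inE => /andP[fE rf]; apply: zero => //; apply: contraTneq rf => ->.
    by rewrite e1e !inE !negb_or rr1 !rU.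
  by rewrite e2e !inE !negb_or rr2 !rU.
by rewrite in_set2 => /orP[] /eqP->; [apply: (tightE _ e1)|apply: (tightE _ e2)].
Qed.

Lemma common_vertex e1 e2 p1 q1 r1 p2 q2 r2 b : e1 \in E -> e2 \in E -> e1 != e2 ->
    e1 = [set p1; q1; r1] -> e2 = [set p2; q2; r2] -> p1 != q1 -> p2 != q2 ->
    p1 \in U -> q1 \in U -> p2 \in U -> q2 \in U ->
    (b == p1) || (b == q1) -> (b == p2) || (b == q2) ->
  exists a c, [/\ e1 = [set a; b; r1], e2 = [set b; c; r2], uniq [:: a; b; c]
    & [/\ a \in U, b \in U & c \in U]].
Proof.
move=> e1E e2E e12 e1e e2e pq1 pq2 p1U q1U p2U q2U bA1 bA2.
have [a [e1e' ab aU]] : exists a, [/\ e1 = [set a; b; r1], a != b & a \in U].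
  case/orP: bA1 => /eqP->; last by exists p1.
  by exists q1; rewrite eq_sym; split=> //; rewrite e1e; apply/setP=> t;
    rewrite !inE -!orbA; do 3 case: (t == _).
have [c [e2e' cb cU]] : exists c, [/\ e2 = [set b; c; r2], c != b & c \in U].
  case/orP: bA2 => /eqP->; first by exists q2; rewrite eq_sym.
  by exists p2; split=> //; rewrite e2e; apply/setP=> t; rewrite !inE -!orbA; do 3 case: (t == _).
have bU : b \in U by case/orP: bA1 => /eqP->.
have ac : a != c.
  apply: contraNneq e12 => ac; apply: contraT => ne; case/eqP: ne.
  by apply: (sf_lin sfE e1E e2E ab); rewrite ?e1e' ?e2e' ?ac !inE eqxx ?orbT.
by exists a, c; split=> //; rewrite /= !inE negb_or ab ac eq_sym cb.
Qed.

Section Bipartite.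

Variables x y : V.
Hypothesis gxy : good_pair E v x y.
Let P := nbr x :&: N.
Let Q := nbr y :&: N.
Hypothesis indepP : forall r s, r \in P -> s \in P -> ~~ adj r s.
Hypothesis indepQ : forall r s, r \in Q -> s \in Q -> ~~ adj r s.

Let cardP : #|P| = k. Proof. exact: (card_side lE fv Wv gxy). Qed.
Let cardQ : #|Q| = k. Proof. exact: (card_side lE fv Wv (good_pair_sym gxy)). Qed.
Let PQN r : r \in N -> (r \in P) = (r \notin Q).
Proof. by rewrite !in_setI !in_nbr => vr; rewrite vr !andbT (side_cover lE fv Wv gxy). Qed.
Let PN r : r \in P -> r \in N. Proof. by rewrite in_setI => /andP[]. Qed.
Let QN r : r \in Q -> r \in N. Proof. by rewrite in_setI => /andP[]. Qed.

(** A vertex [r] that is not tight has [k] neighbours in [N], none of them on its own side, so it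
    sees the whole other side. *)
Lemma cross_complete r s : r \in P -> s \in Q -> r \notin tight -> adj r s.
Proof.
move=> rP sQ nt; have vr := PN rP; rewrite in_nbr in vr.
have sub : nbr r :&: N \subset Q.
  apply/subsetP=> t; rewrite in_setI in_nbr => /andP[rt tN].
  by apply: contraLR rt => tQ; apply: indepP => //; rewrite PQN.
have /eqP/setP/(_ s) : nbr r :&: N == Q.
  by rewrite eqEcard sub (card_nbr_ntight lE fv Wv vr nt) cardQ leqnn.
by rewrite sQ in_setI in_nbr => /andP[].
Qed.

Lemma bip_tripartition (T : {set V}) a b c : T = [set a; b; c] -> uniq [:: a; b; c] ->
    T \subset U ->
    (forall r z, r \in N -> z \in U :\: T -> adj z r) ->
  tripartition E k P Q (v |: (U :\: T)) a b c.
Proof.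
move=> Te abc TU compl.
have cT : #|T| = 3.
  move: abc => /= /and3P[]; rewrite !inE negb_or => /andP[ab ac] bc _.
  by rewrite Te cards3.
have NZ r : r \in N -> r \notin v |: (U :\: T).
  rewrite in_nbr in_setU1 in_setD in_co => vr.
  by rewrite vr !andbF orbF eq_sym (adj_neq vr).
split=> //.
- rewrite cardsU1 in_setD coxx andbF /= cardsD (setIidPr TU) cT (card_co_full lE fv).
  by have := k3; nlia.
- by apply/pred0P=> r /=; apply/negP=> /andP[rP rQ]; move: (rP); rewrite PQN ?rQ ?PN.
- by apply/pred0P=> r /=; apply/negP=> /andP[/PN/NZ/negP].
- by apply/pred0P=> r /=; apply/negP=> /andP[/QN/NZ/negP].
- move=> z zabc; have zT : z \in T by move: zabc; rewrite Te !inE orbA.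
  have zU := subsetP TU z zT; have zN : z \notin N by rewrite in_nbr (co_nadj zU).
  rewrite in_setU1 in_setD zT orbF; apply/and3P; split.
  + by apply: contraNN zN; apply: PN.
  + by apply: contraNN zN; apply: QN.
  by apply: contraTneq zU => ->; rewrite coxx.
- move=> z r; rewrite in_setU1 => /orP[/eqP->|zU] /PN; first by rewrite in_nbr.
  by move=> rN; apply: compl.
- move=> z r; rewrite in_setU1 => /orP[/eqP->|zU] /QN; first by rewrite in_nbr.
  by move=> rN; apply: compl.
Qed.

(** Each [r] in [N] misses a vertex of [e] by [sf_sail], and it misses only one vertex of [U]; hence
    it sees all of [U :\: e]. *)
Lemma bip_outcome2 e : e \in E -> e \subset U ->
  (forall f, f \in E -> f != e -> exc f = 0) -> outcome2.
Proof.
move=> eE eU zero.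
have [a ae] : exists a, a \in e by apply/card_gt0P; rewrite (sf_card sfE eE).
have [b be] : exists b, b \in e :\ a.
  by apply/card_gt0P; have := cardsD1 a e; rewrite ae (sf_card sfE eE); nlia.
have {be} [ba be] : b != a /\ b \in e by apply/andP; rewrite -in_setD1.
have ab : a != b by rewrite eq_sym.
have [c [ca cb ee]] := card3P (sf_card sfE eE) ab ae be.
exists P, Q, (v |: (U :\: e)), a, b, c; split; last by rewrite -ee.
  apply: bip_tripartition => //.
    by rewrite /= !inE negb_or ab !(eq_sym _ c) ca cb.
  move=> r z rN; rewrite in_setD => /andP[ze zU]; rewrite in_nbr in rN.
  have re : r \notin e by apply: contraL rN => /(subsetP eU)/co_nadj->.
  have [u ue ur] := sf_sail sfE eE re.
  rewrite adj_sym; apply: contraT => nrz.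
  have zr : z \in co r.
    by rewrite in_coN //; apply: contraTneq zU => <-; rewrite in_co rN andbF.
  have := miss_eq lE fv Wv rN zr ur zU (subsetP eU u ue) => zu.
  by rewrite zu ue in ze.
move=> r s rP sQ; apply: cross_complete => //.
by apply: (inside_ntight eE eU zero); rewrite -in_nbr PN.
Qed.

(** The tight [r1] has only [k - 1] neighbours in [N], so it misses a vertex of [Q], which is then
    tight as well and hence equal to [r2]. The main point left is that [e1] and [e2] share a vertex
    of [U]. *)
Lemma bip_outcome1 e1 e2 p1 q1 r1 p2 q2 r2 : e1 \in E -> e2 \in E ->
    exc e1 = 1 -> exc e2 = 1 -> e1 != e2 ->
    (forall f, f \in E -> f != e1 -> f != e2 -> exc f = 0) ->
    e1 = [set p1; q1; r1] -> e2 = [set p2; q2; r2] ->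
    uniq [:: p1; q1; r1] -> uniq [:: p2; q2; r2] ->
    p1 \in U -> q1 \in U -> p2 \in U -> q2 \in U -> r1 \in P -> r2 \in N -> outcome1.
Proof.
move=> e1E e2E x1 x2 e12 zero e1e e2e u1 u2 p1U q1U p2U q2U r1P r2N.
have r1N := PN r1P.
have [r12 tightE] := tight_pair e1E e2E x1 x2 e12 zero e1e e2e p1U q1U p2U q2U r1N r2N.
have r1t : r1 \in tight by rewrite tightE !inE eqxx.
have [pq1 pr1 qr1] : [/\ p1 != q1, p1 != r1 & q1 != r1].
  by move: u1; rewrite /= !inE negb_or => /and3P[/andP[-> ->] -> _].
have [pq2 pr2 qr2] : [/\ p2 != q2, p2 != r2 & q2 != r2].
  by move: u2; rewrite /= !inE negb_or => /and3P[/andP[-> ->] -> _].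
have nadjr1 q : q \in Q -> ~~ adj r1 q -> q = r2.
  move=> qQ nr1q; have qN := QN qQ; have vq : adj v q by rewrite -in_nbr.
  have qt : q \in tight.
    apply: contraNT nr1q => qnt; have := card_nbr_ntight lE fv Wv vq qnt.
    have sub : nbr q :&: N \subset P.
      apply/subsetP=> t; rewrite in_setI in_nbr => /andP[qt tN].
      by rewrite PQN //; apply: contraL qt => tQ; apply: indepQ.
    move=> cq; have /eqP/setP/(_ r1) : nbr q :&: N == P.
      by rewrite eqEcard sub cq cardP leqnn.
    by rewrite r1P in_setI in_nbr adj_sym => /andP[].
  move: qt; rewrite tightE !inE => /orP[/eqP qr|/eqP //].
  by move: r1P; rewrite PQN // -qr qQ.
have [q [qQ nr1q]] : exists q, q \in Q /\ ~~ adj r1 q.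
  have sub : nbr r1 :&: N \subset Q.
    apply/subsetP=> t; rewrite in_setI in_nbr => /andP[rt tN].
    by apply: contraLR rt => tQ; apply: indepP => //; rewrite PQN.
  have /set0Pn[q] : Q :\: (nbr r1 :&: N) != set0.
    rewrite -card_gt0; have := cardsD Q (nbr r1 :&: N); rewrite (setIidPr sub) cardQ.
    by have := card_nbr_tight lE fv Wv r1t; nlia.
  rewrite in_setD in_setI in_nbr => /andP[+ qQ]; rewrite (QN qQ) andbT => nq.
  by exists q.
have qe := nadjr1 q qQ nr1q; rewrite {q}qe in qQ nr1q.
rename qQ into r2Q.
have crossE r s : r \in P -> s \in Q -> adj r s = ~~ ((r == r1) && (s == r2)).
  move=> rP sQ; case: (boolP (r == r1)) => [/eqP->|rr1] /=.
    case: eqVneq => [->|sr2] /=; first exact/negbTE.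
    by apply: contraT => /(nadjr1 s sQ) H; rewrite H eqxx in sr2.
  apply: cross_complete => //; rewrite tightE !inE negb_or rr1 /=.
  by apply: contraTneq rP => ->; rewrite PQN // r2Q.
have NU z r : r \in N -> z \in U -> r != z.
  by move=> rN; apply: contraTneq => <-; rewrite in_co -in_nbr rN andbF.
have missQ w : w \in Q -> w != r2 -> exists2 u, u \in co w & (u == p1) || (u == q1).
  move=> wQ wr2; have wN := QN wQ.
  have wr1 : w != r1 by apply: contraTneq wQ => ->; rewrite -[_ \in Q]negbK -PQN // r1P.
  have we : w \notin e1 by rewrite e1e !inE !negb_or wr1 !NU.
  have [u ue uw] := sf_sail sfE e1E we; exists u => //.
  move: ue; rewrite e1e !inE => /orP[//|/eqP ur1].
  by move: uw; rewrite ur1 in_co adj_sym (crossE r1 w) // eqxx (negbTE wr2) /= andbF.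
have missP w : w \in P -> w != r1 -> exists2 u, u \in co w & (u == p2) || (u == q2).
  move=> wP wr1; have wN := PN wP.
  have wr2 : w != r2 by apply: contraTneq wP => ->; rewrite PQN // r2Q.
  have we : w \notin e2 by rewrite e2e !inE !negb_or wr2 !NU.
  have [u ue uw] := sf_sail sfE e2E we; exists u => //.
  move: ue; rewrite e2e !inE => /orP[//|/eqP ur2].
  by move: uw; rewrite ur2 in_co (crossE w r2) // (negbTE wr1) /= andbF.
have missU w u u' : w \in N -> u \in co w -> u' \in co w -> u \in U -> u' \in U -> u = u'.
  by rewrite in_nbr => vw; apply: (miss_eq lE fv Wv vw).
have nadjU w z : w \in N -> z \in U -> ~~ adj w z -> z \in co w.
  by move=> wN zU nwz; rewrite in_coN // NU.
(* If [e1] and [e2] were disjoint in [U], then [k >= 4]. The vertices of [P] other than the tight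
   [r1] spend their only miss on [e2], so [p1] and [q1] see all of [P], have degree [k], and by
   [co_nbr] miss at most one vertex of [N] each. But each of the at least three vertices of
   [Q :\ r2] misses [p1] or [q1]. *)
have [b [bA1 bA2]] : exists b, (b == p1) || (b == q1) /\ (b == p2) || (b == q2).
  case: (boolP [exists b, ((b == p1) || (b == q1)) && ((b == p2) || (b == q2))]).
    by case/existsP=> b /andP[]; exists b.
  move/existsPn=> dis.
  have U4 : 3 < #|U|.
    rewrite -(_ : #|[set p1; q1] :|: [set p2; q2]| = 4); last first.
      rewrite cardsU !cards2 pq1 pq2 (_ : _ :&: _ = set0) ?cards0 //.
      by apply/setP=> b; rewrite !inE; apply/negbTE/dis.
    by rewrite subset_leq_card //; apply/subsetP=> b; rewrite !inE -!in_co => /orP[] /orP[] /eqP->.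
  rewrite (card_co_full lE fv) in U4.
  have one p : (p == p1) || (p == q1) -> #|co p :&: N| <= 1.
    move=> pA; have pU : p \in U by case/orP: pA => /eqP->.
    have padj w : w \in P -> adj p w.
      move=> wP; have wN := PN wP; rewrite adj_sym.
      case: (eqVneq w r1) => [->|wr1]; first exact: (tight_nadj r1t pU).
      apply: contraT => /(nadjU w p wN pU) pw.
      have [u uw uA] := missP w wP wr1.
      have uU : u \in U by case/orP: uA => /eqP->.
      by have := dis p; rewrite pA (missU w p u) // uA.
    have dp : deg E p = k.
      apply/eqP; rewrite eqn_leq (deg_le lE) /=.
      have -> : k = #|nbr p :&: P|.
        rewrite -cardP; apply: eq_card => w; rewrite in_setI in_nbr.
        by case: (boolP (w \in P)) => [/padj->|]; rewrite ?andbF.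
      rewrite -sum_star //; last first.
        by apply: contraL pU => /PN; rewrite in_nbr in_co => ->; rewrite andbF.
      rewrite /deg -sum1_card; apply: leq_sum => f; rewrite inE => /andP[fE _].
      rewrite leqNgt; apply/negP=> /card_gt1P[s [t []]]; rewrite !(in_setI _ f).
      case/andP=> sf sP /andP[tf tP] st.
      by case/negP: (indepP sP tP); apply: (adj_edge fE).
    rewrite (co_nbr lE fv pU) /def dp subnn -(excess_star lE) // (bigD1 e1) /=; last first.
      by rewrite inE e1E e1e !inE pA.
    rewrite x1 big1 // => f; rewrite inE => /andP[/andP[fE pf] fe1]; apply: zero => //.
    apply: contraTneq pf => ->; rewrite e2e !inE negb_or.
    have := dis p; rewrite pA /= => ->; apply: contraTneq pU => ->.
    by move: r2N; rewrite in_nbr in_co => ->; rewrite andbF.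
  have : Q :\ r2 \subset (co p1 :&: N) :|: (co q1 :&: N).
    apply/subsetP=> w; rewrite in_setD1 => /andP[wr2 wQ].
    have [u uw uA] := missQ w wQ wr2; rewrite in_setU !in_setI (QN wQ) !andbT.
    by case/orP: uA => /eqP eu; rewrite eu co_sym in uw; rewrite uw ?orbT.
  move/subset_leq_card; have := leq_card_setU (co p1 :&: N) (co q1 :&: N).
  move=> [+ _] + .
  have o1 : #|co p1 :&: N| <= 1 by apply: one; rewrite eqxx.
  have o2 : #|co q1 :&: N| <= 1 by apply: one; rewrite eqxx orbT.
  by have := cardsD1 r2 Q; rewrite r2Q cardQ; nlia.
have [a [c [e1e' e2e' abc [aU bU cU]]]] :=
  common_vertex e1E e2E e12 e1e e2e pq1 pq2 p1U q1U p2U q2U bA1 bA2.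
have p1q1 t : (t == p1) || (t == q1) -> (t == a) || (t == b).
  move=> tA; have te : t \in e1 by rewrite e1e !inE tA.
  move: te; rewrite e1e' !inE => /orP[//|/eqP tr1].
  by move: tA; rewrite tr1 !(eq_sym r1) (negbTE pr1) (negbTE qr1).
have p2q2 t : (t == p2) || (t == q2) -> (t == b) || (t == c).
  move=> tA; have te : t \in e2 by rewrite e2e !inE tA.
  move: te; rewrite e2e' !inE => /orP[//|/eqP tr2].
  by move: tA; rewrite tr2 !(eq_sym r2) (negbTE pr2) (negbTE qr2).
(* The sides are swapped so that [e2 = {r2, b, c}] takes the place of [a'bc] and [e1 = {r1, a, b}]
   that of [c'ab]. *)
exists Q, P, (v |: (U :\: [set a; b; c])), a, b, c, r2, r1; split=> //.
- have TU : [set a; b; c] \subset U.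
    by apply/subsetP=> t; rewrite !inE -!in_co => /orP[/orP[]|] /eqP->.
  apply/tripartition_sym/(bip_tripartition erefl abc TU) => r z rN; rewrite in_setD => /andP[zabc zU].
  rewrite adj_sym; case: (boolP (r \in tight)) => [rt|]; first exact: (tight_nadj rt zU).
  rewrite tightE !inE negb_or => /andP[rr1 rr2].
  apply: contraT => /(nadjU r z rN zU) zr.
  case: (boolP (r \in Q)) => [rQ|]; last rewrite -PQN // => rP.
    have [u ur uA] := missQ r rQ rr2.
    have uU : u \in U by case/orP: uA => /eqP->.
    move: zabc; rewrite (missU r z u) // !inE; have := p1q1 u uA.
    by case/orP=> ->; rewrite ?orbT.
  have [u ur uA] := missP r rP rr1.
  have uU : u \in U by case/orP: uA => /eqP->.
  move: zabc; rewrite (missU r z u) // !inE; have := p2q2 u uA.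
  by case/orP=> ->; rewrite ?orbT.
- by move=> r s rQ sP; rewrite adj_sym crossE // andbC.
- by split; [rewrite -setUA setUC -e2e'|rewrite -setUA setUC -e1e'].
Qed.

End Bipartite.

End Outcome.

(** * The case of an edge inside a side *)

Section Sporadic.

Variables (V : finType) (E : {set {set V}}) (k : nat).
Hypothesis lE : large E k.
Let sfE := large_sf lE.

Implicit Types (e f S : {set V}) (x y z u w p q r : V).

Local Notation adj := (adj E).
Local Notation nbr := (nbr E).
Local Notation co := (co E).
Local Notation star := (star E).
Local Notation full := (full E k).

(** The third vertices of the triangle edges are not recorded; [prism_forward] recovers them. *)
Definition outcome3 := exists x0 x1 x2 y0 y1 y2 a b c v,
  [/\ uniq [:: x0; x1; x2; y0; y1; y2; a; b; c; v],
      [/\ [set v; x0; y0] \in E, [set v; x1; y1] \in E & [set v; x2; y2] \in E],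
      [set a; b; c] \in E,
      [/\ adj x0 x1, adj x0 x2 & adj x1 x2] &
      [/\ adj y0 y1, adj y0 y2 & adj y1 y2]].

Definition outcome4 := exists x0 x1 x2 y0 y1 y2 a b c v,
  [/\ uniq [:: x0; x1; x2; y0; y1; y2; a; b; c; v],
      [set a; b; y2] \in E /\ [set b; c; y1] \in E,
      [set a; y0; y1] \in E /\ [set c; y0; y2] \in E,
      [/\ [set a; x0; x1] \in E, [set b; x1; x2] \in E & [set c; x0; x2] \in E] &
      [\/ [/\ [set v; x0; y0] \in E, [set v; x1; y1] \in E & [set v; x2; y2] \in E],
          [/\ [set v; x0; y1] \in E, [set v; x1; y0] \in E & [set v; x2; y2] \in E] |
          [/\ [set v; x0; y2] \in E, [set v; x2; y0] \in E & [set v; x1; y1] \in E]]].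

(** With [m1 = y2] the vertex [x1] would see the whole edge [a b y2], and with [m2 = y1] the vertex
    [x2] the whole edge [b c y1]. Of the six bijections this leaves the three choices of [M_v]. *)
Lemma outcome4_mates x0 x1 x2 m0 m1 m2 y0 y1 y2 a b c v :
  uniq [:: x0; x1; x2; y0; y1; y2; a; b; c; v] ->
  [set a; b; y2] \in E -> [set b; c; y1] \in E ->
  [set a; y0; y1] \in E -> [set c; y0; y2] \in E ->
  [set a; x0; x1] \in E -> [set b; x1; x2] \in E -> [set c; x0; x2] \in E ->
  [set v; x0; m0] \in E -> [set v; x1; m1] \in E -> [set v; x2; m2] \in E ->
  uniq [:: m0; m1; m2] -> {subset [:: m0; m1; m2] <= [:: y0; y1; y2]} -> outcome4.
Proof.
move=> un E1 E2 E3 E4 E5 E6 E7 F0 F1 F2 um sm.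
have m1y2 : m1 != y2.
  apply/eqP=> m1y2; rewrite m1y2 in F1.
  have nx : x1 \notin [set a; b; y2].
    move: un; rewrite /= !inE !negb_or -!andbA.
    by do ?[case/andP=> ?]; move=> *; apply/and3P.
  have [u] := sf_sail sfE E1 nx; rewrite !inE -!orbA => /or3P[] /eqP-> /andP[nxu] /negP[].
  - by apply: (adj_edge E5) => //; rewrite !inE eqxx ?orbT.
  - by apply: (adj_edge E6) => //; rewrite !inE eqxx ?orbT.
  - by apply: (adj_edge F1) => //; rewrite !inE eqxx ?orbT.
have m2y1 : m2 != y1.
  apply/eqP=> m2y1; rewrite m2y1 in F2.
  have nx : x2 \notin [set b; c; y1].
    move: un; rewrite /= !inE !negb_or -!andbA.
    by do ?[case/andP=> ?]; move=> *; apply/and3P.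
  have [u] := sf_sail sfE E2 nx; rewrite !inE -!orbA => /or3P[] /eqP-> /andP[nxu] /negP[].
  - by apply: (adj_edge E6) => //; rewrite !inE eqxx ?orbT.
  - by apply: (adj_edge E7) => //; rewrite !inE eqxx ?orbT.
  - by apply: (adj_edge F2) => //; rewrite !inE eqxx ?orbT.
exists x0, x1, x2, y0, y1, y2, a, b, c, v; split=> //.
have h0 := sm m0; have h1 := sm m1; have h2 := sm m2; move: um h0 h1 h2.
rewrite /= !inE !eqxx !orbT negb_or -!andbA (negbTE m1y2) (negbTE m2y1) /= orbF.
case/and4P=> n01 n02 n12 _ /(_ isT) /or3P h0 /(_ isT) /orP h1 /(_ isT) /orP h2.
case: h1 => /eqP h1; case: h2 => /eqP h2; rewrite ?h1 ?h2 ?eqxx // in n01 n02 n12 F1 F2.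
- by case: h0 => /eqP h0; rewrite h0 ?eqxx // in n01 n02 F0; apply: Or32.
- by case: h0 => /eqP h0; rewrite h0 ?eqxx // in n01 n02 F0; apply: Or33.
- by case: h0 => /eqP h0; rewrite h0 ?eqxx // in n01 n02 F0; apply: Or31.
Qed.

Variable v : V.
Hypotheses (fv : full v) (Wv : defset E k \subset co v).

Local Notation U := (co v).
Local Notation N := (nbr v).
Local Notation exc := (excess E v).
Local Notation tight := (tight E v).

Lemma uniq_frame (s t : seq V) : uniq s -> uniq t -> {subset s <= N} -> {subset t <= U} ->
  uniq (s ++ t ++ [:: v]).
Proof.
move=> us ut sN tU; rewrite !cat_uniq us ut /= orbF andbT; apply/andP; split.
  apply/hasPn=> x; rewrite mem_cat inE => /orP[/tU|/eqP->].
    by rewrite in_co => /andP[_]; apply: contraNN => /sN; rewrite in_nbr.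
  by apply/negP=> /sN; rewrite in_nbr adjxx.
by apply/negP=> /tU; rewrite coxx.
Qed.

Lemma mate r : adj v r -> exists q, [/\ [set v; r; q] \in E, adj v q & q != r].
Proof.
move=> /[dup] vr /adjP[ne [f [fE vf rf]]].
have [q [qv qr fe]] := card3P (sf_card sfE fE) ne vf rf.
exists q; rewrite -fe; split=> //; apply: (adj_edge fE) => //; last by rewrite eq_sym.
by rewrite fe !inE eqxx orbT.
Qed.

Section Prism.

Hypothesis k_eq3 : k = 3.
Variables x y p p' q q' : V.
Hypotheses (gxy : good_pair E v x y) (vp : adj v p) (vp' : adj v p').
Hypotheses (xp : adj x p) (xp' : adj x p') (pp' : adj p p').
Hypotheses (pqE : [set v; p; q] \in E) (pqE' : [set v; p'; q'] \in E).
Hypotheses (vq : adj v q) (vq' : adj v q') (qp : q != p) (qp' : q' != p').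

Let xyE : [set v; x; y] \in E. Proof. by case/and5P: gxy => /andP[]. Qed.
Let vx : adj v x. Proof. by case/and5P: gxy. Qed.
Let vy : adj v y. Proof. by case/and5P: gxy. Qed.
Let axy : adj x y.
Proof.
apply: (adj_edge xyE); rewrite ?inE ?eqxx ?orbT //.
by case/and5P: gxy => /andP[].
Qed.
Let gyx := good_pair_sym gxy.
Let p'p : adj p' p. Proof. by rewrite adj_sym. Qed.
Let nyp : adj y p = false. Proof. exact: (side_disj lE gxy). Qed.
Let nyp' : adj y p' = false. Proof. exact: (side_disj lE gxy). Qed.
Let yp : y != p. Proof. by apply/eqP=> e; move: nyp'; rewrite e pp'. Qed.
Let yp' : y != p'. Proof. by apply/eqP=> e; move: nyp; rewrite e p'p. Qed.

(** If [s] were on the side of [x], then [x] would see the whole edge [v r s]. *)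
Lemma mate_side r r' s : adj v r -> adj v r' -> adj x r -> adj x r' -> adj r r' ->
  y != r -> [set v; r; s] \in E -> adj v s -> s != r -> adj y s /\ s != x.
Proof.
move=> vr vr' xr xr' rr' yr rsE vs sr.
split.
  apply: contraT; rewrite -(side_cover lE fv Wv gxy) // => xs.
  have nx : x \notin [set v; r; s].
    by rewrite !inE !negb_or (adj_neq xr) (adj_neq xs) eq_sym (adj_neq vx).
  have [u] := sf_sail sfE rsE nx; rewrite !inE -!orbA => /or3P[] /eqP->.
  - by rewrite (adj_sym _ x) vx andbF.
  - by rewrite xr andbF.
  - by rewrite xs andbF.
apply/eqP=> sx; rewrite sx in rsE.
have eq : [set v; r; x] = [set v; x; y].
  by apply: (sf_lin sfE rsE xyE (adj_neq vx)); rewrite ?inE ?eqxx ?orbT.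
move/setP/(_ r): eq; rewrite !inE eqxx !(eq_sym r) (negbTE yr) (negbTE (adj_neq vr)).
by rewrite (negbTE (adj_neq xr)).
Qed.

Let yq : adj y q. Proof. exact: (proj1 (mate_side vp vp' xp xp' pp' yp pqE vq qp)). Qed.
Let qx : q != x. Proof. exact: (proj2 (mate_side vp vp' xp xp' pp' yp pqE vq qp)). Qed.
Let yq' : adj y q'. Proof. exact: (proj1 (mate_side vp' vp xp' xp p'p yp' pqE' vq' qp')). Qed.
Let qx' : q' != x. Proof. exact: (proj2 (mate_side vp' vp xp' xp p'p yp' pqE' vq' qp')). Qed.
Let qp'0 : q != p'. Proof. by apply/eqP=> e; move: yq; rewrite e nyp'. Qed.
Let q'p0 : q' != p. Proof. by apply/eqP=> e; move: yq'; rewrite e nyp. Qed.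
Let pq : adj p q.
Proof. by apply: (adj_edge pqE); rewrite ?inE ?eqxx ?orbT // eq_sym. Qed.
Let p'q' : adj p' q'.
Proof. by apply: (adj_edge pqE'); rewrite ?inE ?eqxx ?orbT // eq_sym. Qed.
Let qq' : q != q'.
Proof.
apply/eqP=> qq'; have eq : [set v; p; q] = [set v; p'; q'].
  by apply: (sf_lin sfE pqE pqE' (adj_neq vq)); rewrite ?qq' ?inE ?eqxx ?orbT.
move/setP/(_ p): eq; rewrite !inE eqxx !(eq_sym p) (negbTE (adj_neq vp)).
by rewrite (negbTE (adj_neq p'p)) (negbTE q'p0).
Qed.

Let nbrx : nbr x :&: N = [set y; p; p'].
Proof.
apply/esym/eqP; rewrite eqEcard (card_side lE fv Wv gxy) k_eq3 cards3 ?(adj_neq pp') //.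
by rewrite andbT; apply/subsetP=> t; rewrite !inE -!in_nbr -!orbA => /or3P[] /eqP->;
  rewrite !in_nbr ?axy ?xp ?xp' ?vy ?vp ?vp'.
Qed.

Let nbry : nbr y :&: N = [set x; q; q'].
Proof.
apply/esym/eqP; rewrite eqEcard (card_side lE fv Wv gyx) k_eq3 cards3 ?(eq_sym x) //.
rewrite andbT; apply/subsetP=> t; rewrite !inE -!in_nbr -!orbA => /or3P[] /eqP->;
  by rewrite !in_nbr ?yq ?yq' ?vx ?vq ?vq' // adj_sym axy.
Qed.

Let nbrp r r' s : adj v r -> adj v r' -> adj v s -> adj x r -> adj x r' -> adj r r' ->
  adj r s -> s != x -> s != r' -> nbr r :&: N = [set r'; x; s].
Proof.
move=> vr vr' vs xr xr' rr' rs sx sr'.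
have nt := inner_ntight lE gxy vr vr' xr xr' rr'.
apply/esym/eqP; rewrite eqEcard (card_nbr_ntight lE fv Wv vr nt) k_eq3 cards3; last first.
- by rewrite eq_sym.
- by rewrite eq_sym.
- by rewrite eq_sym; apply: adj_neq xr'.
rewrite andbT; apply/subsetP=> t; rewrite !inE -!in_nbr -!orbA => /or3P[] /eqP->;
  by rewrite !in_nbr ?rr' ?vr' ?rs ?vs // adj_sym xr vx.
Qed.

Let in_N t : adj v t -> t \in [:: x; p; p'; y; q; q'].
Proof.
move=> vt; have xyt := side_cover lE fv Wv gxy vt.
case: (boolP (adj x t)) => xt.
  have : t \in nbr x :&: N by rewrite in_setI !in_nbr xt.
  by rewrite nbrx !inE -!orbA => /or3P[] ->; rewrite ?orbT.
have yt : adj y t by apply: contraNT xt; rewrite xyt.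
have : t \in nbr y :&: N by rewrite in_setI !in_nbr yt.
by rewrite nbry !inE -!orbA => /or3P[] ->; rewrite ?orbT.
Qed.

Let uniqN : uniq [:: x; p; p'; y; q; q'].
Proof.
rewrite /= !inE !negb_or (adj_neq xp) (adj_neq xp') (adj_neq axy) !(eq_sym x) qx qx'.
rewrite (adj_neq pp') !(eq_sym p) yp qp q'p0 !(eq_sym p') yp' qp'0 qp'.
by rewrite (adj_neq yq) (adj_neq yq') qq'.
Qed.

Let subN : {subset [:: x; p; p'; y; q; q'] <= N}.
Proof.
by move=> t; rewrite !inE => /or4P[/eqP->|/eqP->|/eqP->|/or3P[] /eqP->]; rewrite -in_nbr inE.
Qed.

(** No neighbour of [v] is tight here, so [q] has three neighbours in [N]; only [y], [p] and [q']
    qualify, and the second triangle [y q q'] appears. *)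
Lemma inner_outcome3 e : e \in E -> e \subset U ->
  (forall f, f \in E -> f != e -> exc f = 0) -> outcome3.
Proof.
move=> eE eU zero.
have aqq' : adj q q'.
  have qnt : q \notin tight := inside_ntight lE fv Wv eE eU zero vq.
  have sub : nbr q :&: N \subset [set y; p; q'].
    apply/subsetP=> t; rewrite in_setI !in_nbr => /andP[qt vt].
    have tq : adj t q by rewrite adj_sym.
    have := in_N vt; rewrite !inE => /or4P[/eqP te|->|/eqP te|/or3P[->|/eqP te|->]]; rewrite ?orbT //.
    - have : q \in nbr x :&: N by rewrite in_setI !in_nbr -te tq.
      by rewrite nbrx !inE !(eq_sym q) (negbTE (adj_neq yq)) !(eq_sym _ q) (negbTE qp) (negbTE qp'0).
    - have : q \in nbr p' :&: N by rewrite in_setI !in_nbr -te tq.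
      rewrite (nbrp vp' vp vq' xp' xp p'p p'q' qx' q'p0).
      by rewrite !inE (negbTE qp) (negbTE qx) (negbTE qq').
    - by rewrite te adjxx in qt.
  have /eqP/setP/(_ q') : nbr q :&: N == [set y; p; q'].
    rewrite eqEcard sub (card_nbr_ntight lE fv Wv vq qnt) k_eq3 cards3 //.
      exact: (adj_neq yq').
    by rewrite eq_sym.
  by rewrite !inE eqxx orbT => /andP[].
have [a ae] : exists a, a \in e by apply/card_gt0P; rewrite (sf_card sfE eE).
have [b be] : exists b, b \in e :\ a.
  by apply/card_gt0P; have := cardsD1 a e; rewrite ae (sf_card sfE eE); nlia.
have {be} [ba be] : b != a /\ b \in e by apply/andP; rewrite -in_setD1.
have ab : a != b by rewrite eq_sym.
have [c [ca cb ee]] := card3P (sf_card sfE eE) ab ae be.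
exists x, p, p', y, q, q', a, b, c, v; split=> //; last by rewrite -ee.
apply: (uniq_frame (t := [:: a; b; c]) uniqN _ subN).
  by rewrite /= !inE negb_or ab !(eq_sym _ c) ca cb.
by move=> t tabc; apply: (subsetP eU); rewrite ee !inE -orbA; move: tabc; rewrite !inE.
Qed.

Lemma tight_inner r : r \in tight -> (r == q) || (r == q').
Proof.
move=> rt; have : adj v r by move: rt; rewrite inE in_nbr => /andP[].
have [xt yt] : x \notin tight /\ y \notin tight by case/and5P: gxy.
have pt := inner_ntight lE gxy vp vp' xp xp' pp'.
have p't := inner_ntight lE gxy vp' vp xp' xp p'p.
move/in_N; rewrite !inE => /or4P[/eqP re|/eqP re|/eqP re|/or3P[/eqP re|->|->]]; rewrite ?orbT //;
  by move: rt; rewrite re ?(negbTE xt) ?(negbTE yt) ?(negbTE pt) ?(negbTE p't).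
Qed.

(** The set [U = {a, b, c}] colours the adjacent pairs of [N] that are not in an edge with [v], and
    pairs sharing a vertex get different colours. As [q] meets [a] and [b] on the first edge, [yq]
    has colour [c], and likewise [yq'] has colour [a]. The triangle [x p p'] uses all three colours,
    and its six colourings differ by a renaming of [x], [p], [p']. *)
Lemma inner_outcome4 a b c : [set a; b; q] \in E -> [set b; c; q'] \in E ->
  uniq [:: a; b; c] -> a \in U -> b \in U -> c \in U -> outcome4.
Proof.
move=> E1 E2 abc aU bU cU.
have Ue : U = [set a; b; c].
  move: (abc) => /= /and3P[]; rewrite !inE negb_or => /andP[ab ac] bc _.
  apply/esym/eqP; rewrite eqEcard (card_co_full lE fv) k_eq3 cards3 // andbT.
  by apply/subsetP=> t; rewrite !inE -!in_co -!orbA => /or3P[] /eqP->.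
have NU z r : adj v r -> z \in U -> r != z.
  by move=> vr; apply: contraTneq => <-; rewrite in_co vr andbF.
have colour r s m : adj v r -> adj v s -> adj r s -> [set v; r; m] \in E -> s != m ->
    exists z, z \in U /\ [set r; s; z] \in E.
  move=> vr vs /adjP[rs [f [fE rf sf]]] rmE sm.
  have vf : v \notin f.
    apply/negP=> vf; have fe : f = [set v; r; m].
      by apply: (sf_lin sfE fE rmE (adj_neq vr)); rewrite // !inE eqxx ?orbT.
    by move: sf; rewrite fe !inE !(eq_sym s) (negbTE (adj_neq vs)) (negbTE rs) (eq_sym m) (negbTE sm).
  have [z zU fe] := edge_third lE vr vs rs fE rf sf vf.
  by exists z; rewrite -fe.
have abcU z : z \in U -> [|| z == a, z == b | z == c] by rewrite Ue !inE -orbA.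
have yxE : [set v; y; x] \in E by rewrite setUAC.
have yqc : [set c; y; q] \in E.
  have [z [zU zE]] := colour y q x vy vq yq yxE qx.
  have nz u w : [set u; w; q] \in E -> u \in U -> w \in U -> (z != u) && (z != w).
    move=> uwE uU wU; rewrite -negb_or; apply/negP=> zuw.
    have eq : [set y; q; z] = [set u; w; q].
      apply: (sf_lin sfE zE uwE (NU z q vq zU)); rewrite !inE ?eqxx ?orbT //.
      by rewrite zuw.
    move/setP/(_ y): eq; rewrite !inE eqxx /= (negbTE (NU u y vy uU)) (negbTE (NU w y vy wU)).
    by rewrite (negbTE (adj_neq yq)).
  have /andP[za zb] := nz a b E1 aU bU.
  have := abcU z zU; rewrite (negbTE za) (negbTE zb) /= => /eqP zc.
  by rewrite -zc -setUA setUC.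
have yqa : [set a; y; q'] \in E.
  have [z [zU zE]] := colour y q' x vy vq' yq' yxE qx'.
  have nz u w : [set u; w; q'] \in E -> u \in U -> w \in U -> (z != u) && (z != w).
    move=> uwE uU wU; rewrite -negb_or; apply/negP=> zuw.
    have eq : [set y; q'; z] = [set u; w; q'].
      apply: (sf_lin sfE zE uwE (NU z q' vq' zU)); rewrite !inE ?eqxx ?orbT //.
      by rewrite zuw.
    move/setP/(_ y): eq; rewrite !inE eqxx /= (negbTE (NU u y vy uU)) (negbTE (NU w y vy wU)).
    by rewrite (negbTE (adj_neq yq')).
  have /andP[zb zc] := nz b c E2 bU cU.
  have := abcU z zU; rewrite (negbTE zb) (negbTE zc) /= orbF => /eqP za.
  by rewrite -za -setUA setUC.
have py : p != y by rewrite eq_sym.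
have p'y : p' != y by rewrite eq_sym.
have p'q : p' != q by rewrite eq_sym.
have [z1 [z1U F1]] := colour x p y vx vp xp xyE py.
have [z2 [z2U F2]] := colour x p' y vx vp' xp' xyE p'y.
have [z3 [z3U F3]] := colour p p' q vp vp' pp' pqE p'q.
have distinct r s s' z z' : [set r; s; z] \in E -> [set r; s'; z'] \in E ->
    adj v r -> adj v s -> z \in U -> r != s -> s != s' -> z != z'.
  move=> FE F'E vr vs zU rs ss'; apply/eqP=> zz'.
  have eq : [set r; s; z] = [set r; s'; z'].
    by apply: (sf_lin sfE FE F'E (NU z r vr zU)); rewrite ?zz' !inE eqxx ?orbT.
  move/setP/(_ s): eq; rewrite !inE eqxx orbT (eq_sym s r) (negbTE rs) (negbTE ss') -zz'.
  by rewrite (negbTE (NU z s vs zU)).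
have z12 := distinct x p p' z1 z2 F1 F2 vx vp z1U (adj_neq xp) (adj_neq pp').
have F1' : [set p; x; z1] \in E by rewrite [[set p; x]]setUC.
have F2' : [set p'; x; z2] \in E by rewrite [[set p'; x]]setUC.
have F3' : [set p'; p; z3] \in E by rewrite [[set p'; p]]setUC.
have z13 := distinct p x p' z1 z3 F1' F3 vp vx z1U (adj_neq (etrans (adj_sym _ _ _) xp)) (adj_neq xp').
have z23 := distinct p' x p z2 z3 F2' F3' vp' vx z2U (adj_neq (etrans (adj_sym _ _ _) xp')) (adj_neq xp).
have rot r s z : [set r; s; z] \in E -> [set z; r; s] \in E /\ [set z; s; r] \in E.
  by move=> rszE; split; rewrite -setUA setUC // [[set s; r]]setUC.
have [[[G1 G1'] [G2 G2']] [G3 G3']] := (rot _ _ _ F1, rot _ _ _ F2, rot _ _ _ F3).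
have final x0 x1 x2 m0 m1 m2 : perm_eq [:: x0; x1; x2] [:: x; p; p'] ->
    perm_eq [:: m0; m1; m2] [:: y; q'; q] ->
    [set a; x0; x1] \in E -> [set b; x1; x2] \in E -> [set c; x0; x2] \in E ->
    [set v; x0; m0] \in E -> [set v; x1; m1] \in E -> [set v; x2; m2] \in E -> outcome4.
  move=> px pm H1 H2 H3 J0 J1 J2.
  have pN : perm_eq [:: x0; x1; x2; y; q'; q] [:: x; p; p'; y; q; q'].
    apply: (perm_cat (s1 := [:: x0; x1; x2]) px (t1 := [:: y; q'; q])).
    by rewrite perm_cons (perm_catC [:: q'] [:: q]).
  apply: (outcome4_mates (y0 := y) (y1 := q') (y2 := q) _ E1 E2 yqa yqc H1 H2 H3 J0 J1 J2).
  - apply: (uniq_frame (s := [:: x0; x1; x2; y; q'; q]) (t := [:: a; b; c])) => //.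
    + by rewrite (perm_uniq pN).
    + by move=> t; rewrite (perm_mem pN); apply: subN.
    + by move=> t; rewrite Ue !inE -orbA.
  - rewrite (perm_uniq pm) /= !inE negb_or (adj_neq yq') (adj_neq yq) eq_sym.
    by rewrite qq'.
  - by move=> t; rewrite (perm_mem pm).
have perm3 (t0 t1 t2 : V) : [/\ perm_eq [:: t0; t2; t1] [:: t0; t1; t2],
    perm_eq [:: t1; t0; t2] [:: t0; t1; t2], perm_eq [:: t1; t2; t0] [:: t0; t1; t2],
    perm_eq [:: t2; t0; t1] [:: t0; t1; t2] & perm_eq [:: t2; t1; t0] [:: t0; t1; t2]].
  by split; apply/permP=> P /=; case: (P t0); case: (P t1); case: (P t2).
have [px1 px2 px3 px4 px5] := perm3 x p p'; have [pm1 pm2 pm3 pm4 pm5] := perm3 y q' q.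
have := abcU z1 z1U; have := abcU z2 z2U; have := abcU z3 z3U.
move=> /or3P[] /eqP e3 /or3P[] /eqP e2 /or3P[] /eqP e1;
  rewrite ?e1 ?e2 ?e3 ?eqxx // in z12 z13 z23 G1 G1' G2 G2' G3 G3'.
all: first
  [ by apply: (final x p p' y q q') | by apply: (final x p' p y q' q)
  | by apply: (final p x p' q y q') | by apply: (final p p' x q q' y)
  | by apply: (final p' x p q' y q) | by apply: (final p' p x q' q y) ].
Qed.

End Prism.

End Sporadic.

(** * Assembly of the four structural cases *)

Section Cases.

Variables (V : finType) (E : {set {set V}}) (k : nat).
Hypothesis lE : large E k.
Let sfE := large_sf lE.

Local Notation adj := (adj E).
Local Notation nbr := (nbr E).
Local Notation co := (co E).
Local Notation full := (full E k).

Theorem structure_cases :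
  [\/ outcome1 E k, outcome2 E k, k = 3 /\ outcome3 E | k = 3 /\ outcome4 E].
Proof.
have [_ [v fv Wv]] := isolation lE.
have indepVinner x : (forall r s, r \in nbr x :&: nbr v -> s \in nbr x :&: nbr v -> ~~ adj r s)
    \/ exists p p', [/\ adj v p, adj v p', adj x p, adj x p' & adj p p'].
  case: (boolP [exists p, [exists p', [&& adj v p, adj v p', adj x p, adj x p' & adj p p']]]).
    by case/existsP=> p /existsP[p' /and5P[]]; right; exists p, p'.
  move/existsPn=> none; left=> r s; rewrite !in_setI !in_nbr => /andP[xr vr] /andP[xs vs].
  by have /existsPn/(_ s) := none r; rewrite vr vs xr xs.
have inner_mates x y p p' : good_pair E v x y -> adj v p -> adj v p' -> adj x p ->
    adj x p' -> adj p p' -> k = 3 /\ exists q q', [/\ [set v; p; q] \in E,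
      [set v; p'; q'] \in E, adj v q /\ adj v q' & q != p /\ q' != p'].
  move=> gxy vp vp' xp xp' pp'; split; first exact: (inner_k3 lE fv Wv gxy vp vp').
  have [q [qE vq qp]] := mate lE vp; have [q' [q'E vq' q'p']] := mate lE vp'.
  by exists q, q'.
case: (excess_cases lE fv Wv) => [[e [eE eU zero]]|[e1 [e2 [[e1E e2E e12 x1 x2] zero]]]].
  have t0 : #|tight E v| <= 2.
    rewrite (_ : tight E v = set0) ?cards0 //; apply/setP=> r; rewrite [RHS]inE.
    apply/negP=> rt; have vr : adj v r by move: rt; rewrite inE in_nbr => /andP[].
    by case/negP: (inside_ntight lE fv Wv eE eU zero vr).
  have [x [y gxy]] := exists_good_pair lE fv t0.
  have sporadic x' y' : good_pair E v x' y' ->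
      (exists p p', [/\ adj v p, adj v p', adj x' p, adj x' p' & adj p p']) ->
      k = 3 /\ outcome3 E.
    move=> g [p [p' [vp vp' xp xp' pp']]].
    have [k3 [q [q' [pqE pqE' [vq vq'] [qp qp']]]]] := inner_mates _ _ _ _ g vp vp' xp xp' pp'.
    split=> //; exact: (inner_outcome3 lE fv Wv k3 g vp vp' xp xp' pp' pqE pqE' vq vq' qp qp' eE eU).
  have gyx := good_pair_sym gxy.
  have [ix|/(sporadic _ _ gxy)] := indepVinner x; last exact: Or43.
  have [iy|/(sporadic _ _ gyx)] := indepVinner y; last exact: Or43.
  by apply: Or42; apply: (bip_outcome2 lE fv Wv gxy ix iy eE eU).
have [p1 [q1 [r1 [e1e u1 p1U q1U r1N]]]] := excess1 lE e1E x1.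
have [p2 [q2 [r2 [e2e u2 p2U q2U r2N]]]] := excess1 lE e2E x2.
have [r12 tE] := tight_pair lE fv Wv e1E e2E x1 x2 e12 zero e1e e2e p1U q1U p2U q2U r1N r2N.
have [x [y gxy]] : exists x y, good_pair E v x y.
  by apply: (exists_good_pair lE fv); rewrite tE cards2 r12.
have sporadic x' y' : good_pair E v x' y' ->
    (exists p p', [/\ adj v p, adj v p', adj x' p, adj x' p' & adj p p']) ->
    k = 3 /\ outcome4 E.
  move=> g [p [p' [vp vp' xp xp' pp']]].
  have [k3 [q [q' [pqE pqE' [vq vq'] [qp qp']]]]] := inner_mates _ _ _ _ g vp vp' xp xp' pp'.
  split=> //.
  have [pq1 pq2] : p1 != q1 /\ p2 != q2.
    by move: u1 u2; rewrite /= !inE !negb_or => /and3P[/andP[-> _] _ _] /and3P[/andP[-> _] _ _].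
  have [b [bA1 bA2]] : exists b, ((b == p1) || (b == q1)) /\ ((b == p2) || (b == q2)).
    case: (boolP [exists b, ((b == p1) || (b == q1)) && ((b == p2) || (b == q2))]).
      by case/existsP=> b /andP[]; exists b.
    move/existsPn=> dis; have : 3 < #|co v|.
      rewrite -(_ : #|[set p1; q1] :|: [set p2; q2]| = 4); last first.
        rewrite cardsU !cards2 pq1 pq2 (_ : _ :&: _ = set0) ?cards0 //.
        by apply/setP=> b; rewrite !inE; apply/negbTE/dis.
      by rewrite subset_leq_card //; apply/subsetP=> b; rewrite !inE -!in_co => /orP[] /orP[] /eqP->.
    by rewrite (card_co_full lE fv) k3.
  have [a [c [e1e' e2e' abc [aU bU cU]]]] :=
    common_vertex lE e1E e2E e12 e1e e2e pq1 pq2 p1U q1U p2U q2U bA1 bA2.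
  have inner := tight_inner lE fv Wv k3 g vp vp' xp xp' pp' pqE pqE' vq vq' qp qp'.
  have r1t : r1 \in tight E v by rewrite tE !inE eqxx.
  have r2t : r2 \in tight E v by rewrite tE !inE eqxx orbT.
  have p'p : adj p' p by rewrite adj_sym.
  have := inner r1 r1t; have := inner r2 r2t.
  (* The tight vertices are [q] and [q'] in one of the two orders; in one of them [p] and [p']
     exchange roles. *)
  move=> /orP[] /eqP e2r /orP[] /eqP e1r; rewrite ?e1r ?e2r ?eqxx // in r12 e1e' e2e'.
    rewrite e1e' in e1E; rewrite e2e' in e2E.
    exact: (inner_outcome4 lE fv Wv k3 g vp' vp xp' xp p'p pqE' pqE vq' vq qp' qp e1E e2E).
  rewrite e1e' in e1E; rewrite e2e' in e2E.
  exact: (inner_outcome4 lE fv Wv k3 g vp vp' xp xp' pp' pqE pqE' vq vq' qp qp' e1E e2E).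
have gyx := good_pair_sym gxy.
have [ix|/(sporadic _ _ gxy)] := indepVinner x; last exact: Or44.
have [iy|/(sporadic _ _ gyx)] := indepVinner y; last exact: Or44.
have vr1 : adj v r1 by rewrite -in_nbr.
apply: Or41; case: (boolP (adj x r1)) => xr1.
  apply: (bip_outcome1 lE fv Wv gxy ix iy e1E e2E x1 x2 e12 zero e1e e2e) => //.
  by rewrite in_setI in_nbr xr1.
apply: (bip_outcome1 lE fv Wv gyx iy ix e1E e2E x1 x2 e12 zero e1e e2e) => //.
rewrite in_setI in_nbr r1N andbT; apply: contraNT xr1.
by rewrite (side_cover lE fv Wv gxy).
Qed.

End Cases.

(** * Transport along bijections *)

Section Transport.

Variables (V W : finType) (f : V -> W) (g : W -> V).
Hypotheses (fK : cancel f g) (gK : cancel g f).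
Variable E : {set {set V}}.

Definition image_hyp : {set {set W}} := [set f @: e | e : {set V} in E].

Let finj : injective f. Proof. exact: can_inj fK. Qed.

Lemma mem_image_hyp (e : {set V}) : (f @: e \in image_hyp) = (e \in E).
Proof. by rewrite mem_imset //; apply: imset_inj. Qed.

Lemma image_hypP (e : {set W}) : e \in image_hyp -> exists2 e0, e0 \in E & e = f @: e0.
Proof. by case/imsetP=> e0; exists e0. Qed.

Lemma adj_image x y : adj image_hyp (f x) (f y) = adj E x y.
Proof.
rewrite /adj (inj_eq finj); congr (_ && _); apply/exists_inP/exists_inP.
  by case=> _ /image_hypP[e eE ->]; rewrite !mem_imset //; exists e.
by case=> e eE xy; exists (f @: e); rewrite ?mem_image_hyp ?mem_imset.
Qed.

Lemma card_image_hyp : #|image_hyp| = #|E|.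
Proof. by rewrite card_imset //; apply: imset_inj. Qed.

Lemma sail_free_image : sail_free E -> sail_free image_hyp.
Proof.
case=> c3 lin sail; split.
- by move=> _ /image_hypP[e eE ->]; rewrite card_imset ?c3.
- move=> _ _ x y /image_hypP[e eE ->] /image_hypP[e' e'E ->] xy.
  rewrite -[x]gK -[y]gK !mem_imset // => *; suff -> : e = e' by [].
  by apply: (lin _ _ (g x) (g y)); rewrite // (can_eq gK).
- move=> _ w /image_hypP[e eE ->]; rewrite -[w]gK mem_imset // => we.
  have [x xe] := sail _ _ eE we; rewrite in_co => /andP[wx nwx].
  by exists (f x); rewrite ?mem_imset // in_co adj_image (inj_eq finj) wx.
Qed.

End Transport.

Lemma image_hypK (V W : finType) (f : V -> W) (g : W -> V) (E : {set {set V}}) :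
  cancel f g -> image_hyp g (image_hyp f E) = E.
Proof.
move=> fK; rewrite /image_hyp -imset_comp -[RHS]imset_id; apply: eq_imset => e /=.
by rewrite -imset_comp -[RHS]imset_id; apply: eq_imset => x /=.
Qed.

Lemma isomorphic_sail_free (V W : finType) (E : {set {set V}}) (E' : {set {set W}}) :
  isomorphic E E' -> sail_free E -> sail_free E' /\ #|E'| = #|E|.
Proof.
case=> f [[g fK gK] <-] sfE; split; first exact: (sail_free_image fK gK sfE).
exact: (card_image_hyp fK).
Qed.

Lemma pullback (V W : finType) (g : W -> V) (E : {set {set V}}) : bijective g ->
  exists H : {set {set W}}, [/\ isomorphic H E, sail_free E -> sail_free H, #|H| = #|E|,
    forall e, (e \in H) = (g @: e \in E) & forall x y, adj H x y = adj E (g x) (g y)].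
Proof.
case=> h gK hK; exists (image_hyp h E).
have EE : image_hyp g (image_hyp h E) = E by apply: image_hypK.
split; first by exists g; split; first by exists h.
- exact: (sail_free_image hK gK).
- exact: (card_image_hyp hK).
- by move=> e; rewrite -[in RHS]EE (mem_image_hyp gK).
- by move=> x y; rewrite -(adj_image gK) EE.
Qed.

Lemma card_vertex k : 2 <= k -> #|vertex k| = 3 * k + 1.
Proof. by move=> k2; rewrite /vertex !card_sum !card_ord; lia. Qed.

(** * Labelling a tripartition by the vertices of the constructions *)

Section Frame.

Variables (V : finType) (E : {set {set V}}) (k : nat) (P Q Z : {set V}) (a b c : V).
Hypotheses (k2 : 2 <= k) (cV : #|V| = 3 * k + 1) (tri : tripartition E k P Q Z a b c).

Definition frame (u : vertex k) : V :=
  match u with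
  | inl (inl (inl i)) => enum_val (cast_ord (esym (tri_P tri)) i)
  | inl (inl (inr i)) => enum_val (cast_ord (esym (tri_Q tri)) i)
  | inl (inr i) => enum_val (cast_ord (esym (tri_Z tri)) i)
  | inr i => tnth [tuple a; b; c] i
  end.

Lemma frame_vx i : frame (vx i) \in P. Proof. exact: enum_valP. Qed.
Lemma frame_vy i : frame (vy i) \in Q. Proof. exact: enum_valP. Qed.
Lemma frame_vz i : frame (vz i) \in Z. Proof. exact: enum_valP. Qed.
Lemma frame_abc i : frame (vabc k i) \in [:: a; b; c]. Proof. exact: mem_tnth. Qed.

Lemma frame_bij : bijective frame.
Proof.
apply: inj_card_bij; last by rewrite cV card_vertex.
have PQ i j : enum_val (cast_ord (esym (tri_P tri)) i) !=
              enum_val (cast_ord (esym (tri_Q tri)) j) :> V.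
  apply/eqP=> e; have /pred0P/(_ (frame (vx i))) := tri_PQ tri.
  by rewrite /= enum_valP e enum_valP.
have PZ i j : enum_val (cast_ord (esym (tri_P tri)) i) !=
              enum_val (cast_ord (esym (tri_Z tri)) j) :> V.
  apply/eqP=> e; have /pred0P/(_ (frame (vx i))) := tri_PZ tri.
  by rewrite /= enum_valP e enum_valP.
have QZ i j : enum_val (cast_ord (esym (tri_Q tri)) i) !=
              enum_val (cast_ord (esym (tri_Z tri)) j) :> V.
  apply/eqP=> e; have /pred0P/(_ (frame (vy i))) := tri_QZ tri.
  by rewrite /= enum_valP e enum_valP.
have out x i : [|| x \in P, x \in Q | x \in Z] -> x != tnth [tuple a; b; c] i.
  move=> xPQZ; apply/eqP=> e; have := tri_out tri (frame_abc i); rewrite /= -e.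
  by case/and3P=> /negbTE nP /negbTE nQ /negbTE nZ; rewrite nP nQ nZ in xPQZ.
have PT i j : enum_val (cast_ord (esym (tri_P tri)) i) != tnth [tuple a; b; c] j.
  by rewrite out // enum_valP.
have QT i j : enum_val (cast_ord (esym (tri_Q tri)) i) != tnth [tuple a; b; c] j.
  by rewrite out // enum_valP orbT.
have ZT i j : enum_val (cast_ord (esym (tri_Z tri)) i) != tnth [tuple a; b; c] j.
  by rewrite out // enum_valP !orbT.
move=> [[[i|i]|i]|i] [[[j|j]|j]|j] /= e.
- by rewrite (cast_ord_inj (enum_val_inj e)).
- by case/eqP: (PQ i j).
- by case/eqP: (PZ i j).
- by case/eqP: (PT i j).
- by case/eqP: (PQ j i).
- by rewrite (cast_ord_inj (enum_val_inj e)).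
- by case/eqP: (QZ i j).
- by case/eqP: (QT i j).
- by case/eqP: (PZ j i).
- by case/eqP: (QZ j i).
- by rewrite (cast_ord_inj (enum_val_inj e)).
- by case/eqP: (ZT i j).
- by case/eqP: (PT j i).
- by case/eqP: (QT j i).
- by case/eqP: (ZT j i).
have /tuple_uniqP tinj : uniq [tuple a; b; c] := tri_abc tri.
by rewrite (tinj _ _ e).
Qed.

Lemma frame_vxP r : r \in P -> exists i, r = frame (vx i).
Proof.
move=> rP; exists (cast_ord (tri_P tri) (enum_rank_in rP r)) => /=.
by rewrite cast_ordK enum_rankK_in.
Qed.

Lemma frame_vyP r : r \in Q -> exists i, r = frame (vy i).
Proof.
move=> rQ; exists (cast_ord (tri_Q tri) (enum_rank_in rQ r)) => /=.
by rewrite cast_ordK enum_rankK_in.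
Qed.

End Frame.

Record partite k (H : {set {set vertex k}}) : Prop := Partite {
  par_sf : sail_free H;
  par_card : #|H| = k ^ 2 + 1;
  par_X : forall i j, ~~ adj H (vx i) (vx j);
  par_Y : forall i j, ~~ adj H (vy i) (vy j);
  par_ZX : forall l i, adj H (vz l) (vx i);
  par_ZY : forall l i, adj H (vz l) (vy i)
}.

Section Pull.

Variables (V : finType) (E : {set {set V}}) (k : nat).
Hypothesis lE : large E k.

Let k2 : 2 <= k. Proof. by have := large_k lE; lia. Qed.

Lemma imset3 (W : finType) (g : W -> V) x y z :
  g @: [set x; y; z] = [set g x; g y; g z].
Proof. by rewrite !imsetU !imset_set1. Qed.

Lemma pull_partite P Q Z a b c : tripartition E k P Q Z a b c ->
  exists (H : {set {set vertex k}}) (g : vertex k -> V),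
  [/\ isomorphic H E, partite H, forall e, (e \in H) = (g @: e \in E),
    forall x y, adj H x y = adj E (g x) (g y) &
    [/\ injective g, (forall r, (r \in P) <-> exists i, r = g (vx i)),
       (forall r, (r \in Q) <-> exists i, r = g (vy i)) &
       [/\ g (va k) = a, g (vb k) = b & g (vc k) = c]]].
Proof.
move=> tri; have gb := frame_bij k2 (large_V lE) tri.
have [H [iso sfH cH memH adjH]] := pullback E gb.
exists H, (frame tri); split=> //.
  split.
  - exact: sfH (large_sf lE).
  - by rewrite cH (card_extremal lE).
  - by move=> i j; rewrite adjH (tri_indepP tri) ?frame_vx.
  - by move=> i j; rewrite adjH (tri_indepQ tri) ?frame_vy.
  - by move=> l i; rewrite adjH (tri_ZP tri) ?frame_vz ?frame_vx.
  - by move=> l i; rewrite adjH (tri_ZQ tri) ?frame_vz ?frame_vy.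
split=> //; first exact: bij_inj.
- by move=> r; split=> [/(frame_vxP tri)//|[i ->]]; apply: frame_vx.
- by move=> r; split=> [/(frame_vyP tri)//|[i ->]]; apply: frame_vy.
Qed.

Lemma pull_outcome2 : outcome2 E k -> exists H : {set {set vertex k}},
  [/\ isomorphic H E, partite H, forall i j, adj H (vx i) (vy j)
    & [set va k; vb k; vc k] \in H].
Proof.
case=> P [Q [Z [a [b [c [tri PQ abcE]]]]]].
have [H [g [iso parH memH adjH [ginj gP gQ [ga gb gc]]]]] := pull_partite tri.
exists H; split=> // [i j|]; last by rewrite memH imset3 ga gb gc.
by rewrite adjH PQ //; [apply/gP|apply/gQ]; [exists i|exists j].
Qed.

Lemma pull_outcome1 : outcome1 E k -> exists (H : {set {set vertex k}}) p0 q0,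
  [/\ isomorphic H E, partite H,
    forall i j, adj H (vx i) (vy j) = ~~ ((i == p0) && (j == q0)) &
    [set vx p0; vb k; vc k] \in H /\ [set vy q0; va k; vb k] \in H].
Proof.
case=> P [Q [Z [a [b [c [r1 [r2 [tri r1P r2Q PQ [E1 E2]]]]]]]]].
have [H [g [iso parH memH adjH [ginj gP gQ [ga gb gc]]]]] := pull_partite tri.
have [p0 r1e] := iffLR (gP r1) r1P; have [q0 r2e] := iffLR (gQ r2) r2Q.
exists H, p0, q0; split=> // [i j|].
  rewrite adjH PQ; [|by apply/gP; exists i|by apply/gQ; exists j].
  by rewrite r1e r2e !(inj_eq ginj).
by rewrite !memH !imset3 ga gb gc -r1e -r2e.
Qed.

End Pull.

(** * Cycles of 2-regular graphs *)

Lemma set2_inj (T : finType) (x y z : T) : [set x; y] = [set x; z] -> y = z.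
Proof.
move=> /setP e; have := e y; have := e z; rewrite !inE !eqxx !orbT.
by case: (eqVneq y x) => [->|_] /=; [move/orP=> [] /eqP|move=> _ /esym/eqP].
Qed.

Section Cycles.

Variables (T : finType) (S : {set T}) (G : {set {set T}}).
Hypothesis edgeG : forall e, e \in G -> exists x y, [/\ x \in S, y \in S, x != y & e = [set x; y]].
Hypothesis deg2 : forall x, x \in S -> #|[set e in G | x \in e]| = 2.

Local Notation edge x y := ([set x; y] \in G).

Lemma edge_sym x y : edge x y = edge y x.
Proof. by rewrite setUC. Qed.

Lemma edge_neq x y : edge x y -> x != y.
Proof.
case/edgeG=> a [b [_ _ ab]] /(congr1 (fun A : {set T} => #|A|)).
by rewrite !cards2 ab; case: eqP.
Qed.

Lemma edge_S x y : edge x y -> x \in S.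
Proof.
case/edgeG=> a [b [aS bS _]] /setP e; have := e x; rewrite !inE eqxx /=.
by move=> /esym/orP[] /eqP->.
Qed.

Lemma edge_two x y z t : edge x y -> edge x z -> edge x t -> y != z -> t = y \/ t = z.
Proof.
move=> xy xz xt yz; have xS := edge_S xy.
have /eqP/cards2P[e [f [ef Ge]]] := deg2 xS.
have mem u : edge x u -> [set x; u] \in [set e; f].
  by rewrite -Ge !inE eqxx => ->.
have := mem y xy; have := mem z xz; have := mem t xt; rewrite !inE.
case/orP=> /eqP et /orP[] /eqP ez /orP[] /eqP ey.
- by left; apply: (set2_inj (x := x)); rewrite et ey.
- by right; apply: (set2_inj (x := x)); rewrite et ez.
- by left; apply: (set2_inj (x := x)); rewrite et ey.
- by case/eqP: yz; apply: (set2_inj (x := x)); rewrite ez ey.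
- by case/eqP: yz; apply: (set2_inj (x := x)); rewrite ez ey.
- by left; apply: (set2_inj (x := x)); rewrite et ey.
- by right; apply: (set2_inj (x := x)); rewrite et ez.
- by left; apply: (set2_inj (x := x)); rewrite et ey.
Qed.

Lemma edge_other x y : edge x y -> exists2 z, edge x z & z != y.
Proof.
move=> xy; have xS := edge_S xy; have /eqP/cards2P[e [f [ef Ge]]] := deg2 xS.
have ez e' : e' \in G -> x \in e' -> exists z, e' = [set x; z].
  move=> e'G xe'; have [a [b [_ _ _ e'e]]] := edgeG e'G.
  move: xe'; rewrite e'e !inE => /orP[] /eqP->; first by exists b.
  by exists a; rewrite setUC.
have [eG xe] : e \in G /\ x \in e.
  have : e \in [set e; f] by rewrite !inE eqxx.
  by rewrite -Ge inE => /andP[].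
have [fG xf] : f \in G /\ x \in f.
  have : f \in [set e; f] by rewrite !inE eqxx orbT.
  by rewrite -Ge inE => /andP[].
have [a ea] := ez e eG xe; have [b fb] := ez f fG xf.
case: (eqVneq a y) => [ay|ay]; last by exists a; rewrite -?ea.
exists b; first by rewrite -fb.
by apply: contraNneq ef => bay; rewrite ea fb ay bay.
Qed.

Section OneCycle.

Variable C : seq T.
Hypothesis cC : is_cycle G C.

Lemma cycle_uniq : uniq C.
Proof. by case/andP: cC => _ /andP[]. Qed.

Lemma next_edge x : x \in C -> edge x (next C x).
Proof. by case/andP: cC => _ /andP[cyc _] /(next_cycle cyc). Qed.

Lemma next2_neq x : x \in C -> next C (next C x) != x.
Proof.
case/rot_to=> i s rotC; have uC := cycle_uniq; have := rot_uniq i C.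
rewrite rotC uC -!(next_rot i uC) rotC; have /andP[sz _] := cC.
have : size (rot i C) = size C by rewrite size_rot.
rewrite rotC => szs; rewrite -szs in sz; case: s sz {rotC szs} => [|y [|z s]] //= _.
rewrite !inE !negb_or eqxx => /and3P[/and3P[xy xz _] _ _].
by rewrite !(eq_sym _ x) (negbTE xy) eqxx.
Qed.

Lemma next_unique x z : x \in C -> edge (next C x) z -> z != x -> z = next C (next C x).
Proof.
move=> xC nz zx; have nC : next C x \in C by rewrite mem_next.
have ex : edge (next C x) x by rewrite edge_sym next_edge.
have xn : x != next C (next C x) by rewrite eq_sym next2_neq.
by case: (edge_two ex (next_edge nC) nz xn) => // zx'; rewrite zx' eqxx in zx.
Qed.

Lemma cycle_edgesP e x : e \in G -> x \in C -> x \in e -> e \in cycle_edges C.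
Proof.
move=> eG xC xe; have uC := cycle_uniq.
have [y eE] : exists y, e = [set x; y].
  have [a [b [_ _ _ ee]]] := edgeG eG.
  by move: xe; rewrite ee !inE => /orP[] /eqP->; [exists b|exists a; rewrite setUC].
rewrite eE in eG *.
have pC : prev C x \in C by rewrite mem_prev.
have := next2_neq pC; rewrite (next_prev uC) => npn.
have ep : edge x (prev C x) by rewrite edge_sym -[X in [set _; X]](next_prev uC x) next_edge.
case: (edge_two ep (next_edge xC) eG); first by rewrite eq_sym.
  move=> ->; apply/imsetP; exists (prev C x); rewrite // (next_prev uC).
  exact: setUC.
by move=> ->; apply/imsetP; exists x.
Qed.

Lemma cycle_edges_sub e : e \in cycle_edges C -> e \in G.
Proof. by case/imsetP=> x xC ->; apply: next_edge. Qed.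

Lemma cycle_iter x : x \in C -> iter (size C) (next C) x = x.
Proof.
move=> xC; have cyc := cycle_next cycle_uniq.
by rewrite -(order_cycle cyc cycle_uniq xC) (iter_order_cycle cyc).
Qed.

Lemma cycle_ind (P : T -> Prop) x : x \in C -> P x ->
  (forall y, y \in C -> P y -> P (next C y)) -> forall y, y \in C -> P y.
Proof.
move=> xC Px step y; rewrite -(fconnect_cycle (cycle_next cycle_uniq) xC).
move/iter_findex <-.
suff : iter (findex (next C) x y) (next C) x \in C /\ P (iter (findex (next C) x y) (next C) x).
  by case.
elim: (findex _ _ _) => [|n [nC Pn]] //=; split; first by rewrite mem_next.
exact: step.
Qed.

End OneCycle.

Definition dart (p : T * T) := [set p.1; p.2] \in G.

Definition turn (p : T * T) :=
  (p.2, odflt p.2 [pick z | ([set p.2; z] \in G) && (z != p.1)]).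

(** The identity off the darts makes [walk] injective on all pairs, as the lemmas on orbits
    require. *)
Definition walk p := if dart p then turn p else p.

Lemma walk_dart p : dart p -> [/\ (walk p).1 = p.2, dart (walk p) & (walk p).2 != p.1].
Proof.
move=> dp; rewrite /walk dp /turn; case: pickP => /= [z /andP[]|none]; first by split.
have [|z zG zp] := @edge_other p.2 p.1; first by rewrite edge_sym.
by have := none z; rewrite zG zp.
Qed.

Lemma walk_dartE p : dart (walk p) = dart p.
Proof.
case: (boolP (dart p)) => dp; first by have [] := walk_dart dp.
by rewrite /walk (negbTE dp) (negbTE dp).
Qed.

Lemma walk_inj : injective walk.
Proof.
move=> p q pq; have := walk_dartE p; rewrite pq walk_dartE.
case: (boolP (dart p)) => dp dq; last first.
  by move: pq; rewrite /walk (negbTE dp) dq.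
have [p1 pd p2] := walk_dart dp; have [q1 qd q2] := walk_dart dq.
have e2 : p.2 = q.2 by rewrite -p1 -q1 pq.
have w1 : edge p.2 p.1 by rewrite edge_sym.
have w2 : edge p.2 q.1 by rewrite e2 edge_sym.
have w3 : edge p.2 (walk p).2 by rewrite -p1.
rewrite eq_sym in p2.
have e1 : p.1 = q.1.
  have [-> //|e] := edge_two w1 w3 w2 p2.
  by move: q2; rewrite -pq e eqxx.
by rewrite [p]surjective_pairing [q]surjective_pairing e1 e2.
Qed.

Definition reverse (p : T * T) := (p.2, p.1).

(** At [p.2] the only edge other than the one to [(walk p).2] leads back to [p.1]. *)
Lemma walk_reverse p : dart p -> walk (reverse (walk p)) = reverse p.
Proof.
move=> dp; have [p1 dw p2] := walk_dart dp.
have dr : dart (reverse (walk p)) by rewrite /dart /reverse /= edge_sym.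
have [r1 dwr r2] := walk_dart dr.
rewrite [LHS]surjective_pairing r1 [RHS]/reverse; congr (_, _); first exact: p1.
move: dwr; rewrite /dart r1 /= p1 => dwr.
have w1 : edge p.2 p.1 by rewrite edge_sym.
have w2 : edge p.2 (walk p).2 by rewrite -p1.
rewrite eq_sym in p2; case: (edge_two w1 w2 dwr p2) => [|e]; first exact.
by move: r2; rewrite e /reverse /= eqxx.
Qed.

(* Walking is injective and reversal conjugates it to its inverse, so an orbit
   cannot turn back on itself; hence orbits of darts project to cycles. *)
Lemma iter_walk_reverse n p : dart p -> iter n walk p != reverse p.
Proof.
suff both : (dart p -> iter n walk p != reverse p) /\
            (dart p -> iter n.+1 walk p != reverse p) by case: both.
elim: n p => [|n IH] p.
  split=> dp.
    apply: contraTneq dp => e; rewrite /dart.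
    have e1 : p.1 = p.2 by move: e; rewrite /= => /(congr1 fst).
    by apply/negP=> /edge_neq; rewrite e1 eqxx.
  have [_ _ p2] := walk_dart dp; apply: contraNneq p2 => /= ->.
  by rewrite /reverse.
split; first by case: (IH p).
move=> dp; have [IH1 _] := IH (walk p).
rewrite iterSr iterS -walk_reverse // (inj_eq walk_inj).
by apply: IH1; rewrite walk_dartE.
Qed.

(** The cycle consists of the tails along the orbit of the dart [(x, y)], so its direction is
    prescribed as well. *)
Lemma dart_cycle x y : edge x y -> exists C, [/\ is_cycle G C, x \in C & next C x = y].
Proof.
move=> xy; pose O := orbit walk (x, y).
have dO p : p \in O -> dart p.
  rewrite -fconnect_orbit => /iter_findex <-.
  by elim: (findex _ _ _) => [|n IH] //=; rewrite walk_dartE.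
have cyc : fcycle walk O := cycle_orbit walk_inj (x, y).
have dxy : dart (x, y) by [].
have xyO : (x, y) \in O := in_orbit _ _.
have wO p : p \in O -> walk p \in O.
  rewrite -!fconnect_orbit => pO; apply: connect_trans pO _; exact: fconnect1.
(* Two darts [p], [q] of the orbit with equal tails and different heads would satisfy
   [walk (reverse q) = p], so walking from [reverse q] would reach its own reverse [q]. *)
have uO : uniq [seq p.1 | p <- O].
  rewrite map_inj_in_uniq ?orbit_uniq // => p q pO qO e1.
  have [dp dq] := (dO p pO, dO q qO).
  rewrite [p]surjective_pairing [q]surjective_pairing e1; congr (_, _).
  apply/eqP; apply: contraT => n2.
  have dr : dart (reverse q) by rewrite /dart /= edge_sym.
  have wrq : walk (reverse q) = p.
    have [r1 dw r2] := walk_dart dr.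
    rewrite [LHS]surjective_pairing [RHS]surjective_pairing r1 /= e1.
    congr (_, _); move: dw; rewrite /dart r1 /= => dw.
    have w1 : edge q.1 q.2 by [].
    have w2 : edge q.1 p.2 by rewrite -e1.
    rewrite eq_sym in n2; case: (edge_two w1 w2 dw n2) => [e|//].
    by move: r2; rewrite e /= eqxx.
  have : fconnect walk p q.
    move: pO qO; rewrite -!fconnect_orbit (fconnect_sym walk_inj (x, y) p) => pO qO.
    exact: connect_trans pO qO.
  move/iter_findex; set n := findex _ _ _; rewrite -wrq -iterSr => e.
  by have := iter_walk_reverse n.+1 dr; rewrite e /reverse /= -surjective_pairing eqxx.
have [w1 dw w2] := walk_dart dxy.
have [w1' dw' w2'] := walk_dart dw.
have ne1 := edge_neq dxy; have ne2 := edge_neq dw; rewrite w1 /= in ne1 ne2.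
have sz : 2 < size O.
  rewrite -(size_map fst); apply: (@uniq_leq_size _ [:: x; y; (walk (x, y)).2]).
    by rewrite /= !inE negb_or ne1 ne2 eq_sym w2.
  move=> z; rewrite !inE => /or3P[] /eqP->.
  - by apply/mapP; exists (x, y).
  - by apply/mapP; exists (walk (x, y)); rewrite ?wO.
  - by apply/mapP; exists (walk (walk (x, y))); rewrite ?wO.
exists [seq p.1 | p <- O]; split.
- rewrite /is_cycle size_map sz /= /ucycleb uO andbT.
  apply: (homo_cycle_in (P := [pred p | dart p]) _ _ cyc); last by apply/allP=> p /dO.
  by move=> p q /= dp _ /eqP <-; have [-> _ _] := walk_dart dp.
- by apply/mapP; exists (x, y).
have : O = (x, y) :: walk (x, y) :: behead (behead O).
  move: sz; rewrite /O /orbit; case: (order _ _) => [|[|n]] //=.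
by move=> ->; rewrite /= eqxx w1.
Qed.

End Cycles.

(** * Latin squares with symbols z, a, b, c *)

Section Latin.

Variable k : nat.

Definition symb : finType := ('I_(k - 2) + 'I_3)%type.

Definition zz (s : symb) : vertex k :=
  match s with inl l => vz l | inr t => vabc k t end.

Definition triple i j (s : symb) : {set vertex k} := [set vx i; vy j; zz s].

Lemma zz_inj : injective zz.
Proof. by move=> [l|t] [l'|t'] //= [->]. Qed.

Lemma vertexP (u : vertex k) :
  [\/ exists i, u = vx i, exists j, u = vy j | exists s, u = zz s].
Proof.
case: u => [[[i|j]|l]|t]; [by apply: Or31; exists i|by apply: Or32; exists j| |].
  by apply: Or33; exists (inl l).
by apply: Or33; exists (inr t).
Qed.

Lemma eq_vxx i i' : (vx i == vx i' :> vertex k) = (i == i'). Proof. by []. Qed.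
Lemma eq_vyy i i' : (vy i == vy i' :> vertex k) = (i == i'). Proof. by []. Qed.
Lemma eq_vxy i i' : (vx i == vy i' :> vertex k) = false. Proof. by []. Qed.
Lemma eq_vyx i i' : (vy i == vx i' :> vertex k) = false. Proof. by []. Qed.
Lemma eq_vxz i s : (vx i == zz s) = false. Proof. by case: s. Qed.
Lemma eq_vyz i s : (vy i == zz s) = false. Proof. by case: s. Qed.
Lemma eq_vzx i s : (zz s == vx i) = false. Proof. by case: s. Qed.
Lemma eq_vzy i s : (zz s == vy i) = false. Proof. by case: s. Qed.
Lemma eq_vzz s s' : (zz s == zz s') = (s == s'). Proof. exact: inj_eq zz_inj _ _. Qed.

Definition eqv := (eq_vxx, eq_vyy, eq_vxy, eq_vyx, eq_vxz, eq_vyz, eq_vzx, eq_vzy, eq_vzz).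

Definition sa : symb := inr i0.
Definition sb : symb := inr i1.
Definition sc : symb := inr i2.

Lemma vaE : va k = zz sa. Proof. by []. Qed.
Lemma vbE : vb k = zz sb. Proof. by []. Qed.
Lemma vcE : vc k = zz sc. Proof. by []. Qed.

Lemma symbP (s : symb) : [\/ exists l, s = inl l, s = sa, s = sb | s = sc].
Proof.
case: s => [l|[[|[|[|m]]] lt]]; [by apply: Or41; exists l| | | |by []].
- by apply: Or42; congr (inr _); apply: val_inj.
- by apply: Or43; congr (inr _); apply: val_inj.
- by apply: Or44; congr (inr _); apply: val_inj.
Qed.

Variables (D : pred ('I_k * 'I_k)) (phi : 'I_k -> 'I_k -> symb).

Definition latin_hyp : {set {set vertex k}} :=
  [set triple ij.1 ij.2 (phi ij.1 ij.2) | ij in D].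

Definition has_row i s := [exists j, D (i, j) && (phi i j == s)].
Definition has_col j s := [exists i, D (i, j) && (phi i j == s)].

Definition latin :=
  (forall i j j', D (i, j) -> D (i, j') -> phi i j = phi i j' -> j = j') /\
  (forall i i' j, D (i, j) -> D (i', j) -> phi i j = phi i' j -> i = i').

Lemma latin_hypP e : reflect (exists i j, D (i, j) /\ e = triple i j (phi i j))
  (e \in latin_hyp).
Proof.
apply: (iffP imsetP) => [[[i j] Dij ->]|[i [j [Dij ->]]]]; first by exists i, j.
by exists (i, j).
Qed.

Lemma triple_share i j s i' j' s' x y : x != y -> x \in triple i j s ->
    y \in triple i j s -> x \in triple i' j' s' -> y \in triple i' j' s' ->
  [\/ i = i' /\ j = j', i = i' /\ s = s' | j = j' /\ s = s'].
Proof.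
move=> xy; rewrite !inE -!orbA => /or3P[] /eqP ex /or3P[] /eqP ey;
  rewrite ex ey ?eqxx // in xy *; rewrite !eqv ?orbF /=.
- by move=> /eqP -> /eqP ->; apply: Or31.
- by move=> /eqP -> /eqP ->; apply: Or32.
- by move=> /eqP -> /eqP ->; apply: Or31.
- by move=> /eqP -> /eqP ->; apply: Or33.
- by move=> /eqP -> /eqP ->; apply: Or32.
- by move=> /eqP -> /eqP ->; apply: Or33.
Qed.

Lemma triple_inj i j s i' j' s' : triple i j s = triple i' j' s' -> i = i' /\ j = j'.
Proof.
move=> /setP e; have := e (vx i); have := e (vy j); rewrite !inE !eqv !eqxx /= !orbF.
by move=> /esym/eqP -> /esym/eqP ->.
Qed.

Lemma card_latin : #|latin_hyp| = #|D|.
Proof.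
apply: card_imset => -[i j] [i' j'] /triple_inj[/= -> ->] //.
Qed.

Lemma card_triple i j s : #|triple i j s| = 3.
Proof. by apply: cards3; rewrite !eqv. Qed.

Lemma latin_lin e f x y : latin -> e \in latin_hyp -> f \in latin_hyp -> x != y ->
  x \in e -> y \in e -> x \in f -> y \in f -> e = f.
Proof.
case=> row col /latin_hypP[i [j [Dij ->]]] /latin_hypP[i' [j' [Dij' ->]]] xy xe ye xf yf.
case: (triple_share xy xe ye xf yf) => [[-> -> //]|[ii' ss']|[jj' ss']].
  by rewrite ii' in Dij ss' *; rewrite (row _ _ _ Dij Dij' ss').
by rewrite jj' in Dij ss' *; rewrite (col _ _ _ Dij Dij' ss').
Qed.

Lemma latin_adj_edge i j : D (i, j) -> triple i j (phi i j) \in latin_hyp.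
Proof. by move=> Dij; apply/latin_hypP; exists i, j. Qed.

End Latin.

Lemma sail_from_adj (V : finType) (H : {set {set V}}) :
    (forall e w, e \in H -> w \notin e -> (forall x, x \in e -> adj H w x) -> False) ->
  forall e w, e \in H -> w \notin e -> exists2 x, x \in e & x \in co H w.
Proof.
move=> none e w eH we; apply/exists_inP; apply: contraT => /exists_inPn allx.
case: (none e w eH we) => x xe; have := allx x xe; rewrite in_co negb_and !negbK.
by case/orP=> // /eqP wx; rewrite wx xe in we.
Qed.

(** * Arrays that give Construction 1 *)

Section Type1.

Variables (k : nat) (phi : 'I_k -> 'I_k -> symb k) (p0 q0 p1 q1 : 'I_k).

(* The construction's a', c', x', y' are [vx p0], [vy q0], [vx p1], [vy q1]; the
   edge a'c' gets no color, so its cell is removed from the array. *)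
Definition D1 (ij : 'I_k * 'I_k) := ~~ ((ij.1 == p0) && (ij.2 == q0)).

Definition hyp1 : {set {set vertex k}} :=
  latin_hyp D1 phi :|: [set [set vx p0; vb k; vc k]; [set vy q0; va k; vb k]].

(** These conditions retain from the coloured 2-factor what excludes sails: [b] occurs only at
    [x'y'], certain colours are absent at [a'], [c'], [x'], [y'], and the cells [a'y'] and [c'x'] do
    not carry [a] and [c] respectively. *)
Record type1 : Prop := Type1 {
  t1_proper : latin D1 phi;
  t1_b : forall i j, D1 (i, j) -> phi i j = sb k -> i = p1 /\ j = q1;
  t1_p : p1 != p0;
  t1_q : q1 != q0;
  t1_p0c : ~~ has_row D1 phi p0 (sc k);
  t1_q0a : ~~ has_col D1 phi q0 (sa k);
  t1_p1a : ~~ has_row D1 phi p1 (sa k);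
  t1_q1c : ~~ has_col D1 phi q1 (sc k);
  t1_p0q1 : phi p0 q1 != sa k;
  t1_p1q0 : phi p1 q0 != sc k
}.

Hypothesis t1 : type1.

Let s1 : {set vertex k} := [set vx p0; vb k; vc k].
Let s2 : {set vertex k} := [set vy q0; va k; vb k].

Lemma hyp1P e : e \in hyp1 -> [\/ exists i j, D1 (i, j) /\ e = triple i j (phi i j),
  e = s1 | e = s2].
Proof.
rewrite inE => /orP[/latin_hypP|]; first exact: Or31.
by rewrite !inE => /orP[] /eqP->; [apply: Or32|apply: Or33].
Qed.

Lemma adj1 u w : adj hyp1 u w ->
  match u, w with
  | inl (inl (inl i)), inl (inl (inl i')) => False
  | inl (inl (inr j)), inl (inl (inr j')) => False
  | inl (inl (inl i)), inl (inl (inr j)) => D1 (i, j)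
  | inl (inl (inr j)), inl (inl (inl i)) => D1 (i, j)
  | _, _ => True
  end.
Proof.
case/adjP=> uw [e [/hyp1P[[i [j [Dij ->]]]|->|->]]];
  rewrite !inE -!orbA => /or3P[] /eqP eu /or3P[] /eqP ew; rewrite eu ew in uw *;
  by rewrite ?eqxx // in uw *; case: (phi i j).
Qed.

Lemma adj1_xz i s : adj hyp1 (vx i) (zz s) ->
  has_row D1 phi i s \/ i = p0 /\ (s = sb k \/ s = sc k).
Proof.
case/adjP=> _ [e [/hyp1P[[i' [j [Dij ->]]]|->|->]]]; rewrite !inE ?(vaE, vbE, vcE) !eqv /= ?orbF //.
  by move=> /eqP -> /eqP ->; left; apply/existsP; exists j; rewrite Dij eqxx.
by move=> /eqP-> /orP[] /eqP->; right; split=> //; [left|right].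
Qed.

Lemma adj1_yz j s : adj hyp1 (vy j) (zz s) ->
  has_col D1 phi j s \/ j = q0 /\ (s = sa k \/ s = sb k).
Proof.
case/adjP=> _ [e [/hyp1P[[i [j' [Dij ->]]]|->|->]]]; rewrite !inE ?(vaE, vbE, vcE) !eqv /= ?orbF //.
  by move=> /eqP -> /eqP ->; left; apply/existsP; exists i; rewrite Dij eqxx.
by move=> /eqP-> /orP[] /eqP->; right; split=> //; [left|right].
Qed.

Lemma adj1_zz s s' : adj hyp1 (zz s) (zz s') -> [\/ s = sb k /\ (s' = sa k \/ s' = sc k),
  s = sa k /\ s' = sb k | s = sc k /\ s' = sb k].
Proof.
case/adjP=> ne [e [/hyp1P[[i [j' [Dij ->]]]|->|->]]]; rewrite !inE ?(vaE, vbE, vcE) !eqv /=.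
- by move=> /eqP es /eqP es'; rewrite es es' eqxx in ne.
- case/orP=> /eqP es /orP[] /eqP es'; rewrite es es' ?eqxx // in ne *.
    by apply: Or31; split=> //; right.
  by apply: Or33.
- case/orP=> /eqP es /orP[] /eqP es'; rewrite es es' ?eqxx // in ne *.
    by apply: Or32.
  by apply: Or31; split=> //; left.
Qed.

Lemma row_b i : has_row D1 phi i (sb k) -> i = p1.
Proof. by case/existsP=> j /andP[Dij /eqP/(t1_b t1 Dij)[]]. Qed.

Lemma col_b j : has_col D1 phi j (sb k) -> j = q1.
Proof. by case/existsP=> i /andP[Dij /eqP/(t1_b t1 Dij)[]]. Qed.

Lemma type1_card : #|hyp1| = k ^ 2 + 1.
Proof.
have s12 : s1 != s2.
  by apply/eqP=> /setP/(_ (vx p0)); rewrite !inE ?(vaE, vbE) !eqv eqxx.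
have dis : latin_hyp D1 phi :&: [set s1; s2] = set0.
  apply/setP=> e; rewrite in_setI in_set0; apply/negP=> /andP[/latin_hypP[i [j [Dij ->]]]].
  rewrite !inE => /orP[] /eqP /setP e'.
    by have := e' (vy j); rewrite !inE ?(vbE, vcE) !eqv eqxx.
  by have := e' (vx i); rewrite !inE ?(vaE, vbE) !eqv eqxx.
rewrite /hyp1 cardsU dis cards0 subn0 cards2 s12 card_latin.
have := cardC1 (p0, q0); rewrite card_prod !card_ord => c1.
have -> : #|D1| = #|predC1 (p0, q0)|.
  by apply: eq_card => -[i j]; rewrite !inE /in_mem /= /D1 xpair_eqE.
rewrite c1; have : 0 < k by case: (p0) => m; lia.
by nia.
Qed.

(** A vertex that sees a whole edge of the array is one of [a], [b], [c], since the sides are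
    independent; among these, adjacencies come only from [a'bc] and [c'ab], hence involve [b]. The
    conditions of [type1] exclude the few cells that remain. *)
Lemma type1_sail_free : sail_free hyp1.
Proof.
have [row col] := t1_proper t1.
have nrow_b : ~~ has_row D1 phi p0 (sb k).
  by apply/negP=> /row_b e; have := t1_p t1; rewrite e eqxx.
have ncol_b : ~~ has_col D1 phi q0 (sb k).
  by apply/negP=> /col_b e; have := t1_q t1; rewrite e eqxx.
have lin1 i j x y : D1 (i, j) -> x != y -> x \in triple i j (phi i j) ->
    y \in triple i j (phi i j) -> x \in s1 -> y \in s1 -> False.
  move=> Dij xy; rewrite !inE -!orbA ?(vbE, vcE) => xe ye /or3P[] /eqP ex /or3P[] /eqP ey;
    rewrite ex ey ?eqxx // in xy; move: xe ye; rewrite ex ey !eqv /= ?orbF => /eqP e1 /eqP e2;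
    try (by have := etrans e1 (esym e2)).
  - by case/negP: nrow_b; apply/existsP; exists j; rewrite e1 Dij e2 eqxx.
  - by case/negP: (t1_p0c t1); apply/existsP; exists j; rewrite e1 Dij e2 eqxx.
  - by case/negP: nrow_b; apply/existsP; exists j; rewrite e2 Dij e1 eqxx.
  - by case/negP: (t1_p0c t1); apply/existsP; exists j; rewrite e2 Dij e1 eqxx.
have lin2 i j x y : D1 (i, j) -> x != y -> x \in triple i j (phi i j) ->
    y \in triple i j (phi i j) -> x \in s2 -> y \in s2 -> False.
  move=> Dij xy; rewrite !inE -!orbA ?(vaE, vbE) => xe ye /or3P[] /eqP ex /or3P[] /eqP ey;
    rewrite ex ey ?eqxx // in xy; move: xe ye; rewrite ex ey !eqv /= ?orbF => /eqP e1 /eqP e2;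
    try (by have := etrans e1 (esym e2)).
  - by case/negP: (t1_q0a t1); apply/existsP; exists i; rewrite e1 Dij e2 eqxx.
  - by case/negP: ncol_b; apply/existsP; exists i; rewrite e1 Dij e2 eqxx.
  - by case/negP: (t1_q0a t1); apply/existsP; exists i; rewrite e2 Dij e1 eqxx.
  - by case/negP: ncol_b; apply/existsP; exists i; rewrite e2 Dij e1 eqxx.
have lin12 x y : x != y -> x \in s1 -> y \in s1 -> x \in s2 -> y \in s2 -> False.
  move=> xy; rewrite !inE -!orbA ?(vaE, vbE, vcE) => /or3P[] /eqP ex /or3P[] /eqP ey;
    by rewrite ex ey ?eqxx // in xy *; rewrite !eqv.
split.
- by move=> e /hyp1P[[i [j [_ ->]]]|->|->]; [apply: card_triple|apply: cards3|apply: cards3].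
- move=> e f x y eH fH xy xe ye xf yf; case: (hyp1P eH) (hyp1P fH).
  + move=> [i [j [Dij ee]]] [[i' [j' [Dij' fe]]]|fe|fe].
    * by apply: (latin_lin (t1_proper t1) _ _ xy xe ye xf yf); rewrite ?ee ?fe latin_adj_edge.
    * by case: (lin1 i j x y); rewrite -?ee -?fe.
    * by case: (lin2 i j x y); rewrite -?ee -?fe.
  + move=> ee [[i' [j' [Dij' fe]]]|fe|fe]; last 2 first.
    * by rewrite ee fe.
    * by case: (lin12 x y); rewrite -?ee -?fe.
    * by case: (lin1 i' j' x y); rewrite -?ee -?fe.
  + move=> ee [[i' [j' [Dij' fe]]]|fe|fe]; last 2 first.
    * by case: (lin12 x y); rewrite -?ee -?fe.
    * by rewrite ee fe.
    * by case: (lin2 i' j' x y); rewrite -?ee -?fe.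
apply: sail_from_adj => e w /hyp1P[[i [j [Dij ee]]]|ee|ee] we all_adj.
- have ax : adj hyp1 w (vx i) by apply: all_adj; rewrite ee !inE eqxx.
  have ay : adj hyp1 w (vy j) by apply: all_adj; rewrite ee !inE eqxx orbT.
  have az : adj hyp1 w (zz (phi i j)) by apply: all_adj; rewrite ee !inE eqxx !orbT.
  case: (vertexP w) => [[i' we']|[j' we']|[s we']]; rewrite we' in ax ay az.
  + exact: (adj1 ax).
  + exact: (adj1 ay).
  rewrite adj_sym in ax; rewrite adj_sym in ay.
  have := adj1_xz ax; have := adj1_yz ay; have := adj1_zz az.
  case=> [[es [ez|ez]]|[es ez]|[es ez]].
  + rewrite es => -[/col_b jq1|[jq0 _]] [/row_b ip1|[ip0 _]].
    * case/negP: (t1_p1a t1); apply/existsP; exists j.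
      by rewrite -ip1 Dij ez eqxx.
    * by have := t1_p0q1 t1; rewrite -ip0 -jq1 ez eqxx.
    * case/negP: (t1_p1a t1); apply/existsP; exists j.
      by rewrite -ip1 Dij ez eqxx.
    * by move: Dij; rewrite /D1 ip0 jq0 /= !eqxx.
  + rewrite es => -[/col_b jq1|[jq0 _]] [/row_b ip1|[ip0 _]].
    * case/negP: (t1_q1c t1); apply/existsP; exists i.
      by rewrite -jq1 Dij ez eqxx.
    * case/negP: (t1_q1c t1); apply/existsP; exists i.
      by rewrite -jq1 Dij ez eqxx.
    * by have := t1_p1q0 t1; rewrite -ip1 -jq0 ez eqxx.
    * by move: Dij; rewrite /D1 ip0 jq0 /= !eqxx.
  + have [ip1 jq1] := t1_b t1 Dij ez.
    rewrite es => _ [|[ip0 _]]; first by rewrite ip1 (negbTE (t1_p1a t1)).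
    by have := t1_p t1; rewrite -ip1 ip0 eqxx.
  + have [ip1 jq1] := t1_b t1 Dij ez.
    rewrite es => -[|[jq0 _]]; first by rewrite jq1 (negbTE (t1_q1c t1)).
    by have := t1_q t1; rewrite -jq1 jq0 eqxx.
- have ax : adj hyp1 w (vx p0) by apply: all_adj; rewrite ee !inE eqxx.
  have ab : adj hyp1 w (zz (sb k)) by apply: all_adj; rewrite ee !inE eqxx orbT.
  have ac : adj hyp1 w (zz (sc k)) by apply: all_adj; rewrite ee !inE eqxx !orbT.
  case: (vertexP w) => [[i' we']|[j' we']|[s we']]; rewrite we' in ax ab ac we.
  + exact: (adj1 ax).
  + have := adj1 ax; have := adj1_yz ab; have := adj1_yz ac.
    move=> [cc|[_ [//|//]]] [/col_b jq1|[-> _]]; last by rewrite /= /D1 !eqxx.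
    by move: cc; rewrite jq1 (negbTE (t1_q1c t1)).
  + have := adj1_zz ab; have := adj1_zz ac.
    case=> [[-> _]|[_ //]|[_ //]]; by case=> [[_ [//|//]]|[//]|[//]].
- have ay : adj hyp1 w (vy q0) by apply: all_adj; rewrite ee !inE eqxx.
  have aa : adj hyp1 w (zz (sa k)) by apply: all_adj; rewrite ee !inE eqxx orbT.
  have ab : adj hyp1 w (zz (sb k)) by apply: all_adj; rewrite ee !inE eqxx !orbT.
  case: (vertexP w) => [[i' we']|[j' we']|[s we']]; rewrite we' in ay aa ab we.
  + have := adj1 ay; have := adj1_xz ab; have := adj1_xz aa.
    move=> [cc|[_ [//|//]]] [/row_b ip1|[-> _]]; last by rewrite /= /D1 !eqxx.
    by move: cc; rewrite ip1 (negbTE (t1_p1a t1)).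
  + exact: (adj1 ay).
  + have := adj1_zz ab; have := adj1_zz aa.
    case=> [[-> _]|[_ //]|[_ //]]; by case=> [[_ [//|//]]|[//]|[//]].
Qed.

End Type1.

(** * Arrays that give Construction 2 *)

Section Type2.

Variables (k : nat) (phi : 'I_k -> 'I_k -> symb k).

Definition D2 (ij : 'I_k * 'I_k) := true.

Definition hyp2 : {set {set vertex k}} :=
  latin_hyp D2 phi :|: [set [set va k; vb k; vc k]].

(** [t2_rainbow] keeps a colour vertex [t'], adjacent to [t] through [abc], from seeing both ends of
    a cell of colour [t]; [t2_row] and [t2_col] keep vertices of [X] and [Y] from seeing all of
    [abc]. *)
Record type2 : Prop := Type2 {
  t2_proper : latin D2 phi;
  t2_rainbow : forall i j t t', phi i j = inr t -> t != t' ->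
    has_row D2 phi i (inr t') -> ~~ has_col D2 phi j (inr t');
  t2_row : forall i, exists t, ~~ has_row D2 phi i (inr t);
  t2_col : forall j, exists t, ~~ has_col D2 phi j (inr t)
}.

Hypothesis t2 : type2.

Let s1 : {set vertex k} := [set va k; vb k; vc k].

Lemma mem_s1 (u : vertex k) : (u \in s1) = if u is inr _ then true else false.
Proof.
rewrite !inE -!orbA; case: u => [[[i|j]|l]|t] //.
by case: t => -[|[|[|m]]] lt.
Qed.

Lemma hyp2P e : e \in hyp2 -> (exists i j, e = triple i j (phi i j)) \/ e = s1.
Proof.
rewrite inE => /orP[/latin_hypP[i [j [_ ->]]]|/set1P ->]; last by right.
by left; exists i, j.
Qed.

Lemma type2_card : #|hyp2| = k ^ 2 + 1.
Proof.
have dis : latin_hyp D2 phi :&: [set s1] = set0.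
  apply/setP=> e; rewrite in_setI in_set0; apply/negP=> /andP[/latin_hypP[i [j [Dij ->]]]].
  by move=> /set1P /setP/(_ (vx i)); rewrite mem_s1 !inE eqxx.
rewrite /hyp2 cardsU dis cards0 subn0 cards1 card_latin.
suff -> : #|D2| = k * k by rewrite mulnn.
have -> : #|D2| = #|{: 'I_k * 'I_k}| by apply: eq_card.
by rewrite card_prod !card_ord.
Qed.

Lemma adj2_xx i i' : adj hyp2 (vx i) (vx i') = false.
Proof.
apply/negP=> /adjP[ne [e [/hyp2P[[i1 [j1 ->]]|->]]]]; last by rewrite mem_s1.
by rewrite !inE !eqv !orbF => /eqP ei /eqP ei'; rewrite ei ei' eqxx in ne.
Qed.

Lemma adj2_yy i i' : adj hyp2 (vy i) (vy i') = false.
Proof.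
apply/negP=> /adjP[ne [e [/hyp2P[[i1 [j1 ->]]|->]]]]; last by rewrite mem_s1.
by rewrite !inE !eqv !orbF => /eqP ei /eqP ei'; rewrite ei ei' eqxx in ne.
Qed.

Lemma adj2_xz i s : adj hyp2 (vx i) (zz s) -> has_row D2 phi i s.
Proof.
case/adjP=> _ [e [/hyp2P[[i1 [j1 ->]]|->]]]; last by rewrite mem_s1.
rewrite !inE !eqv !orbF => /eqP-> /eqP->.
by apply/existsP; exists j1; rewrite eqxx.
Qed.

Lemma adj2_yz j s : adj hyp2 (vy j) (zz s) -> has_col D2 phi j s.
Proof.
case/adjP=> _ [e [/hyp2P[[i1 [j1 ->]]|->]]]; last by rewrite mem_s1.
rewrite !inE !eqv !orbF => /eqP-> /eqP->.
by apply/existsP; exists i1; rewrite eqxx.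
Qed.

Lemma adj2_zz s s' : adj hyp2 (zz s) (zz s') -> exists t t', [/\ t != t', s = inr t & s' = inr t'].
Proof.
case/adjP=> ne [e [/hyp2P[[i1 [j1 ->]]|->]]].
  by rewrite !inE !eqv => /eqP es /eqP es'; rewrite es es' eqxx in ne.
rewrite !mem_s1; case: s ne => // t; case: s' => // t' ne _ _.
by exists t, t'; split=> //; apply: contraNneq ne => ->.
Qed.

Lemma type2_sail_free : sail_free hyp2.
Proof.
have lin1 i j x y : x != y -> x \in triple i j (phi i j) ->
    y \in triple i j (phi i j) -> x \in s1 -> y \in s1 -> False.
  move=> xy; rewrite !mem_s1 !inE -!orbA.
  case: x xy => [//|t] xy; case: y xy => [//|t'] xy xe ye _ _.
  by case/negP: xy; rewrite (eqP xe) (eqP ye).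
split.
- by move=> e /hyp2P[[i [j ->]]|->]; [apply: card_triple|apply: cards3].
- move=> e f x y eH fH xy xe ye xf yf; case: (hyp2P eH) (hyp2P fH).
  + move=> [i [j ee]] [[i' [j' fe]]|fe].
      by apply: (latin_lin (t2_proper t2) _ _ xy xe ye xf yf); rewrite ?ee ?fe latin_adj_edge.
    by case: (lin1 i j x y); rewrite -?ee -?fe.
  + move=> ee [[i' [j' fe]]|fe]; last by rewrite ee fe.
    by case: (lin1 i' j' x y); rewrite -?ee -?fe.
apply: sail_from_adj => e w /hyp2P[[i [j ee]]|ee] we all_adj.
- have ax : adj hyp2 w (vx i) by apply: all_adj; rewrite ee !inE eqxx.
  have ay : adj hyp2 w (vy j) by apply: all_adj; rewrite ee !inE eqxx orbT.
  have az : adj hyp2 w (zz (phi i j)) by apply: all_adj; rewrite ee !inE eqxx !orbT.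
  case: (vertexP w) => [[i' we']|[j' we']|[s we']]; rewrite we' in ax ay az.
  + by rewrite adj2_xx in ax.
  + by rewrite adj2_yy in ay.
  have [t [t' [tt' es ez]]] := adj2_zz az; rewrite es in ax ay.
  rewrite adj_sym in ax; rewrite adj_sym in ay.
  have t't : t' != t by rewrite eq_sym.
  by have := t2_rainbow t2 ez t't (adj2_xz ax); rewrite (adj2_yz ay).
- have as1 t : adj hyp2 w (zz (inr t)) by apply: all_adj; rewrite ee mem_s1.
  case: (vertexP w) => [[i' we']|[j' we']|[s we']]; rewrite we' in as1 we.
  + have [t nt] := t2_row t2 i'; case/negP: nt; exact: adj2_xz (as1 t).
  + have [t nt] := t2_col t2 j'; case/negP: nt; exact: adj2_yz (as1 t).
  + have [t [t' [_ es _]]] := adj2_zz (as1 i0).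
    by case/negP: we; rewrite ee mem_s1 es.
Qed.

End Type2.

(** * The 2-factors of Constructions 1 and 2 *)

Section Bip.

Variable k : nat.

Definition bedge (i j : 'I_k) : {set vertex k} := [set vx i; vy j].

Lemma bipP e : reflect (exists i j, e = bedge i j) (e \in bip k).
Proof.
apply: (iffP imset2P) => [[_ _ /imsetP[i _ ->] /imsetP[j _ ->] ->]|[i [j ->]]].
  by exists i, j.
by exists (vx i) (vy j); rewrite ?imset_f.
Qed.

Lemma mem_bip i j : bedge i j \in bip k.
Proof. by apply/bipP; exists i, j. Qed.

Lemma vx_bedge i i' j : (vx i \in bedge i' j) = (i == i').
Proof. by rewrite !inE !eqv orbF. Qed.

Lemma vy_bedge j i j' : (vy j \in bedge i j') = (j == j').
Proof. by rewrite !inE !eqv. Qed.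

Lemma bedge_inj i j i' j' : bedge i j = bedge i' j' -> i = i' /\ j = j'.
Proof.
move=> /setP e; have := e (vx i); have := e (vy j).
by rewrite !vx_bedge !vy_bedge !eqxx => /esym/eqP-> /esym/eqP->.
Qed.

Lemma bedge_eq i j i' j' : (bedge i j == bedge i' j') = (i == i') && (j == j').
Proof.
by apply/eqP/andP => [/bedge_inj[-> ->]|[/eqP-> /eqP->]].
Qed.

Lemma triple_bedge i j s : triple i j s = zz s |: bedge i j.
Proof. by rewrite /triple setUC. Qed.

Lemma in_XY (u : vertex k) : u \in X k :|: Y k -> (exists i, u = vx i) \/ exists j, u = vy j.
Proof. by rewrite inE => /orP[] /imsetP[i _ ->]; [left|right]; exists i. Qed.

Lemma vx_XY i : vx i \in X k :|: Y k.
Proof. by rewrite inE imset_f. Qed.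

Lemma vy_XY i : vy i \in X k :|: Y k.
Proof. by rewrite inE imset_f ?orbT. Qed.

Variable B0 : {set {set vertex k}}.
Hypothesis tf : two_factor (X k :|: Y k) (bip k) B0.

Lemma tf_edge e : e \in B0 -> exists i j, e = bedge i j.
Proof. by case/andP: tf => /subsetP sub _ /sub/bipP. Qed.

Lemma tf_edgeG e : e \in B0 -> exists x y,
  [/\ x \in X k :|: Y k, y \in X k :|: Y k, x != y & e = [set x; y]].
Proof.
by case/tf_edge=> i [j ->]; exists (vx i), (vy j); rewrite vx_XY vy_XY.
Qed.

Lemma tf_deg2 x : x \in X k :|: Y k -> #|[set e in B0 | x \in e]| = 2.
Proof. by case/andP: tf => _ /forall_inP H /H/eqP. Qed.

Lemma tf_row i : exists j j', [/\ j != j', bedge i j \in B0, bedge i j' \in B0 &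
  forall l, bedge i l \in B0 -> l = j \/ l = j'].
Proof.
have /eqP/cards2P[e [f [ef Be]]] := tf_deg2 (vx_XY i).
have mem g : (g \in B0) && (vx i \in g) = (g \in [set e; f]) by rewrite -Be inE.
have get g : g \in [set e; f] -> exists j, g = bedge i j.
  rewrite -mem => /andP[/tf_edge[i' [j ->]]]; rewrite vx_bedge => /eqP->.
  by exists j.
have [|j ej] := get e; first by rewrite !inE eqxx.
have [|j' fj'] := get f; first by rewrite !inE eqxx orbT.
have := mem e; have := mem f; rewrite !inE !eqxx orbT /= => /andP[fB _] /andP[eB _].
exists j, j'; rewrite -ej -fj'; split=> //.
  by apply: contraNneq ef => jj'; rewrite ej fj' jj'.
move=> l lB; have := mem (bedge i l); rewrite lB vx_bedge eqxx /= => /esym.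
by rewrite !inE ej fj' !bedge_eq eqxx /= => /orP[] /eqP; [left|right].
Qed.

Lemma tf_col j : exists i i', [/\ i != i', bedge i j \in B0, bedge i' j \in B0 &
  forall l, bedge l j \in B0 -> l = i \/ l = i'].
Proof.
have /eqP/cards2P[e [f [ef Be]]] := tf_deg2 (vy_XY j).
have mem g : (g \in B0) && (vy j \in g) = (g \in [set e; f]) by rewrite -Be inE.
have get g : g \in [set e; f] -> exists i, g = bedge i j.
  rewrite -mem => /andP[/tf_edge[i [j' ->]]]; rewrite vy_bedge => /eqP->.
  by exists i.
have [|i ei] := get e; first by rewrite !inE eqxx.
have [|i' fi'] := get f; first by rewrite !inE eqxx orbT.
have := mem e; have := mem f; rewrite !inE !eqxx orbT /= => /andP[fB _] /andP[eB _].
exists i, i'; rewrite -ei -fi'; split=> //.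
  by apply: contraNneq ef => ii'; rewrite ei fi' ii'.
move=> l lB; have := mem (bedge l j); rewrite lB vy_bedge eqxx /= => /esym.
by rewrite !inE ei fi' !bedge_eq eqxx !andbT => /orP[] /eqP; [left|right].
Qed.

Variables (col : {set vertex k} -> vertex k) (M : 'I_(k - 2) -> {set {set vertex k}}).
Hypothesis decM : decomposition (bip k :\: B0) M.
Hypothesis perM : forall l, perfect_matching (X k :|: Y k) (M l).

(** In Construction 1 the colour of the removed edge [a'c'] is arbitrary, so a cell of the 2-factor
    is constrained only when its colour is [a], [b] or [c]. *)
Definition symbol_of (phi : 'I_k -> 'I_k -> symb k) :=
  (forall i j, bedge i j \notin B0 -> exists2 l, phi i j = inl l & bedge i j \in M l) /\
  (forall i j, bedge i j \in B0 -> col (bedge i j) \in [set va k; vb k; vc k] ->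
     zz (phi i j) = col (bedge i j)).

Lemma symbol_ex : exists phi, symbol_of phi.
Proof.
have ex (ij : 'I_k * 'I_k) : exists s : symb k,
    (bedge ij.1 ij.2 \notin B0 -> exists2 l, s = inl l & bedge ij.1 ij.2 \in M l) /\
    (bedge ij.1 ij.2 \in B0 -> col (bedge ij.1 ij.2) \in [set va k; vb k; vc k] ->
       zz s = col (bedge ij.1 ij.2)).
  case: (boolP (bedge ij.1 ij.2 \in B0)) => eB; last first.
    have : bedge ij.1 ij.2 \in bip k :\: B0 by rewrite inE eB mem_bip.
    by case: decM => <- _ /bigcupP[l _ eM]; exists (inl l); split=> // _; exists l.
  case: (boolP (col (bedge ij.1 ij.2) \in [set va k; vb k; vc k])) => [|_]; last first.
    by exists (sa k).
  rewrite !inE -orbA => /or3P[] /eqP->; [by exists (sa k)|by exists (sb k)|by exists (sc k)].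
have [f fP] := fin_all_exists ex.
exists (fun i j => f (i, j)); split=> i j.
  by have [H _] := fP (i, j).
by have [_ H] := fP (i, j).
Qed.

Lemma M_uniq l e f x : e \in M l -> f \in M l -> x \in e -> x \in f -> e = f.
Proof.
have /andP[/trivIsetP H _] := perM l => eM fM xe xf; apply/eqP; apply: contraT => ef.
by have /pred0P/(_ x) := H e f eM fM ef; rewrite /= xe xf.
Qed.

Lemma M_notB0 l e : e \in M l -> (e \in bip k) && (e \notin B0).
Proof.
move=> eM; have : e \in bip k :\: B0 by case: decM => <- _; apply/bigcupP; exists l.
by rewrite inE andbC.
Qed.

Lemma M_disj l l' e : e \in M l -> e \in M l' -> l = l'.
Proof.
case: decM => _ dis el el'; apply/eqP; apply: contraT => /dis/pred0P/(_ e).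
by rewrite /= el el'.
Qed.

Variable phi : 'I_k -> 'I_k -> symb k.
Hypothesis sphi : symbol_of phi.

Lemma phi_inl i j l : bedge i j \in M l -> phi i j = inl l.
Proof.
move=> eM; have /andP[_ nB] := M_notB0 eM; case: sphi => /(_ i j nB)[l' -> e'M] _.
by rewrite (M_disj eM e'M).
Qed.

Lemma phi_inr i j t : phi i j = inr t -> bedge i j \in B0.
Proof.
by move=> e; apply: contraT => nB; case: sphi => /(_ i j nB)[l]; rewrite e.
Qed.

Lemma phi_inl_M i j l : bedge i j \notin B0 -> phi i j = inl l -> bedge i j \in M l.
Proof. by move=> nB e; case: sphi => /(_ i j nB)[l']; rewrite e => -[->]. Qed.

Lemma col_eq i j t : col (bedge i j) = vabc k t -> bedge i j \in B0 -> phi i j = inr t.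
Proof.
move=> ce eB; apply: zz_inj; case: sphi => _ ->; rewrite // ce !inE.
by case: t {ce} => -[|[|[|m]]] lt.
Qed.

(** [B1] is the coloured part of the 2-factor, all of it or all but [a'c'], and [D] is the matching
    domain of the array. *)
Lemma colored_latin (D : pred ('I_k * 'I_k)) (B1 : {set {set vertex k}}) :
    (forall i j, ~~ D (i, j) -> bedge i j \in B0) -> B1 \subset B0 ->
    (forall i j, (bedge i j \in B1) = (bedge i j \in B0) && D (i, j)) ->
    (forall i j, bedge i j \in B1 -> zz (phi i j) = col (bedge i j)) ->
  colored_edges col B1 :|: matching_edges M = latin_hyp D phi.
Proof.
move=> DB sub inB1 colB1; apply/setP=> e; rewrite inE; apply/orP/latin_hypP.
  case=> [/imsetP[f fB1 ->]|/bigcupP[l _ /imsetP[f fM ->]]].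
    have [i [j fe]] := tf_edge (subsetP sub f fB1); rewrite fe in fB1 *.
    exists i, j; rewrite triple_bedge colB1 //; split=> //.
    by move: fB1; rewrite inB1 => /andP[].
  have /andP[/bipP[i [j fe]] fB] := M_notB0 fM; rewrite fe in fM fB *.
  exists i, j; split; last by rewrite triple_bedge (phi_inl fM).
  by apply: contraT => /DB; rewrite (negbTE fB).
case=> i [j [Dij ->]]; rewrite triple_bedge; case: (boolP (bedge i j \in B0)) => eB.
  have eB1 : bedge i j \in B1 by rewrite inB1 eB.
  by left; apply/imsetP; exists (bedge i j); rewrite ?colB1.
right; case: (sphi) => /(_ i j eB)[l -> eM] _.
by apply/bigcupP; exists l => //; apply/imsetP; exists (bedge i j).
Qed.

End Bip.

Lemma construction1_type1 k (H : {set {set vertex k}}) : construction1 H ->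
  exists phi p0 q0 p1 q1, type1 phi p0 q0 p1 q1 /\ H = hyp1 phi p0 q0.
Proof.
case=> B0 Cl a' c' x' y' col M R tf cC _ /imsetP[p0 _ ea] /imsetP[p1 _ ex] /imsetP[q0 _ ec].
case/imsetP=> q1 _ ey; subst a' c' x' y' => acC xyC dis aynC cxnC colR colRd colRa colRc colxy decM perM.
have [phi sphi] := symbol_ex col decM.
have edgeG := tf_edgeG tf; have deg2 := tf_deg2 tf.
have acB : bedge p0 q0 \in B0 := cycle_edges_sub cC acC.
have xyB : bedge p1 q1 \in B0 := cycle_edges_sub cC xyC.
have neq e x y : e \in cycle_edges Cl -> e = [set x; y] -> x \in Cl /\ y \in Cl.
  case/imsetP=> u uC eu e'; have sub z : z \in e -> z \in Cl.
    by rewrite eu !inE => /orP[] /eqP->; rewrite ?mem_next.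
  by split; apply: sub; rewrite e' !inE eqxx ?orbT.
have [aC c'C] := neq _ _ _ acC erefl.
have p10 : p1 != p0.
  apply/eqP=> e; move/pred0P/(_ (vx p0)): dis.
  by rewrite /= !inE e !eqxx.
have q10 : q1 != q0.
  apply/eqP=> e; move/pred0P/(_ (vy q0)): dis.
  by rewrite /= !inE e !eqxx !orbT.
(* An edge of the 2-factor at a vertex of [Cl] belongs to [Cl], so absence from the cycle means
   absence from [B0]. *)
have ay : bedge p0 q1 \notin B0.
  apply: contraNN aynC => e; apply: (cycle_edgesP edgeG deg2 cC e aC).
  by rewrite vx_bedge.
have cx : bedge p1 q0 \notin B0.
  apply: contraNN cxnC => e; rewrite setUC.
  by apply: (cycle_edgesP edgeG deg2 cC e c'C); rewrite vy_bedge.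
have inR i j : (bedge i j \in R) = [&& bedge i j \in B0, ~~ ((i == p0) && (j == q0)) &
    ~~ ((i == p1) && (j == q1))].
  by rewrite /R !inE -/(bedge p0 q0) -/(bedge p1 q1) !bedge_eq negb_or andbC.
have bedgeB i j : bedge i j \in B0 -> D1 p0 q0 (i, j) ->
    (i = p1 /\ j = q1 /\ phi i j = sb k) \/
    (bedge i j \in R /\ (phi i j = sa k \/ phi i j = sc k)).
  move=> eB Dij; case: (boolP (bedge i j \in R)) => eR.
    right; split=> //; have := colR _ eR; rewrite !inE => /orP[] /eqP ce.
      by left; apply: (col_eq sphi).
    by right; apply: (col_eq sphi).
  left; move: eR; rewrite inR eB (Dij : ~~ ((i == p0) && (j == q0))) /= negbK => /andP[/eqP ei /eqP ej].
  by split=> //; split=> //; rewrite ei ej; apply: (col_eq sphi).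
have phiR i j : bedge i j \in R -> zz (phi i j) = col (bedge i j).
  move=> eR; have : bedge i j \in B0 by move: eR; rewrite inR => /andP[].
  case: sphi => _ H' /H'; apply; have := colR _ eR; rewrite !inE.
  by case/orP=> ->; rewrite ?orbT.
have diffR i j i' j' : bedge i j \in R -> bedge i' j' \in R ->
    (i == i') || (j == j') -> (i, j) != (i', j') -> phi i j != phi i' j'.
  move=> eR fR share ne; rewrite -(eqv k) !phiR //; apply: colRd => //.
    by rewrite bedge_eq -xpair_eqE.
  apply/negP=> /pred0P dd; case/orP: share => /eqP e.
    by have := dd (vx i); rewrite /= !vx_bedge e eqxx.
  by have := dd (vy j); rewrite /= !vy_bedge e eqxx.
have prop : latin (D1 p0 q0) phi.
  have aux i j i' j' : D1 p0 q0 (i, j) -> D1 p0 q0 (i', j') -> phi i j = phi i' j' ->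
      (i == i') || (j == j') -> (i, j) = (i', j').
    move=> Dij Dij' e share; apply/eqP; apply: contraT => ne.
    have ne' : bedge i j != bedge i' j' by rewrite bedge_eq -xpair_eqE.
    case: (boolP (bedge i j \in B0)) => eB.
      have [t et] : exists t, phi i j = inr t.
        by case: (bedgeB i j eB Dij) => [[_ [_ ->]]|[_ [] ->]]; eexists.
      have fB : bedge i' j' \in B0 by apply: (phi_inr sphi (t := t)); rewrite -e.
      case: (bedgeB i j eB Dij) => [[ei [ej es]]|[eR es]];
        case: (bedgeB i' j' fB Dij') => [[ei' [ej' es']]|[fR es']].
      - by rewrite ei ej ei' ej' eqxx in ne.
      - by move: e; rewrite es; case: es' => ->.
      - by move: e; rewrite es'; case: es => ->.
      - by have := diffR _ _ _ _ eR fR share ne; rewrite e eqxx.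
    case: (sphi) => /(_ i j eB)[l el eM] _.
    have fB : bedge i' j' \notin B0.
      apply/negP=> fB; case: (bedgeB i' j' fB Dij') => [[_ [_]]|[_ []]]; rewrite -e el //.
    have fM : bedge i' j' \in M l by apply: (phi_inl_M sphi) => //; rewrite -e.
    case/eqP: ne'; case/orP: share => /eqP es.
      by apply: (M_uniq perM eM fM (x := vx i)); rewrite vx_bedge es.
    by apply: (M_uniq perM eM fM (x := vy j)); rewrite vy_bedge es.
  split=> [i j j' Dij Dij' e|i i' j Dij Dij' e].
    have sh : (i == i) || (j == j') by rewrite eqxx.
    by case: (aux _ _ _ _ Dij Dij' e sh).
  have sh : (i == i') || (j == j) by rewrite eqxx orbT.
  by case: (aux _ _ _ _ Dij Dij' e sh).
have [prow pcol] := prop.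
have p0c : ~~ has_row (D1 p0 q0) phi p0 (sc k).
  apply/negP=> /existsP[j /andP[Dj /eqP e]]; have eB := phi_inr sphi e.
  case: (bedgeB _ _ eB Dj) => [[ei]|[eR _]]; first by rewrite ei eqxx in p10.
  by have := phiR _ _ eR; rewrite e colRa ?vx_bedge.
have q0a : ~~ has_col (D1 p0 q0) phi q0 (sa k).
  apply/negP=> /existsP[j /andP[Dj /eqP e]]; have eB := phi_inr sphi e.
  case: (bedgeB _ _ eB Dj) => [[_ [ej]]|[eR _]]; first by rewrite ej eqxx in q10.
  by have := phiR _ _ eR; rewrite e colRc ?vy_bedge.
have p0a : has_row (D1 p0 q0) phi p0 (sa k).
  have [j [j' [jj' jB j'B _]]] := tf_row tf p0.
  have [l [lB lq]] : exists l, bedge p0 l \in B0 /\ l != q0.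
    case: (eqVneq j q0) => [jq|]; last by exists j.
    by exists j'; rewrite -jq eq_sym.
  have Dl : D1 p0 q0 (p0, l) by rewrite /D1 /= eqxx.
  apply/existsP; exists l; rewrite Dl /=.
  case: (bedgeB _ _ lB Dl) => [[ei]|[eR _]]; first by rewrite ei eqxx in p10.
  by rewrite -(eqv k) phiR // colRa // vx_bedge.
have q0c : has_col (D1 p0 q0) phi q0 (sc k).
  have [j [j' [jj' jB j'B _]]] := tf_col tf q0.
  have [l [lB lq]] : exists l, bedge l q0 \in B0 /\ l != p0.
    case: (eqVneq j p0) => [jq|]; last by exists j.
    by exists j'; rewrite -jq eq_sym.
  have Dl : D1 p0 q0 (l, q0) by rewrite /D1 /= eqxx andbT.
  apply/existsP; exists l; rewrite Dl /=.
  case: (bedgeB _ _ lB Dl) => [[_ [ej]]|[eR _]]; first by rewrite ej eqxx in q10.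
  by rewrite -(eqv k) phiR // colRc // vy_bedge.
(* If row [p1] had an [a], every row would; the cells with [a] would then form a permutation and
   reach column [q0]. *)
have p1a : ~~ has_row (D1 p0 q0) phi p1 (sa k).
  apply/negP=> p1a; have all i : exists j, D1 p0 q0 (i, j) && (phi i j == sa k).
    apply/existsP; case: (eqVneq i p1) => [->//|ip1].
    case: (eqVneq i p0) => [->//|ip0].
    have [j [j' [jj' jB j'B _]]] := tf_row tf i.
    have jR : bedge i j \in R by rewrite inR jB (negbTE ip0) (negbTE ip1).
    have j'R : bedge i j' \in R by rewrite inR j'B (negbTE ip0) (negbTE ip1).
    have Dj l : D1 p0 q0 (i, l) by rewrite /D1 /= (negbTE ip0).
    have := diffR _ _ _ _ jR j'R; rewrite eqxx xpair_eqE eqxx jj' => /(_ isT isT).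
    case: (bedgeB _ _ jB (Dj j)) => [[ei]|[_ [ej|ej]]]; first by rewrite ei eqxx in ip1.
      by move=> _; apply/existsP; exists j; rewrite Dj ej eqxx.
    case: (bedgeB _ _ j'B (Dj j')) => [[ei]|[_ [ej'|ej']]]; first by rewrite ei eqxx in ip1.
      by move=> _; apply/existsP; exists j'; rewrite Dj ej' eqxx.
    by rewrite ej ej' eqxx.
  have [f fP] := fin_all_exists all.
  have finj : injective f.
    move=> i i' e; have /andP[Di /eqP ei] := fP i; have /andP[Di' /eqP ei'] := fP i'.
    by apply: (pcol i i' (f i)) => //; rewrite ?ei e ?ei'.
  have [g _ gK] := injF_bij finj.
  case/negP: q0a; apply/existsP; exists (g q0).
  by have := fP (g q0); rewrite gK.
(* Dually, [c] would occur in every column, hence in row [p0]. *)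
have q1c : ~~ has_col (D1 p0 q0) phi q1 (sc k).
  apply/negP=> q1c; have all j : exists i, D1 p0 q0 (i, j) && (phi i j == sc k).
    apply/existsP; case: (eqVneq j q1) => [->//|jq1].
    case: (eqVneq j q0) => [->//|jq0].
    have [i [i' [ii' iB i'B _]]] := tf_col tf j.
    have iR : bedge i j \in R by rewrite inR iB (negbTE jq0) (negbTE jq1) !andbF.
    have i'R : bedge i' j \in R by rewrite inR i'B (negbTE jq0) (negbTE jq1) !andbF.
    have Di l : D1 p0 q0 (l, j) by rewrite /D1 /= (negbTE jq0) andbF.
    have := diffR _ _ _ _ iR i'R; rewrite eqxx orbT xpair_eqE eqxx andbT ii' => /(_ isT isT).
    case: (bedgeB _ _ iB (Di i)) => [[_ [ej]]|[_ [ei|ei]]]; first by rewrite ej eqxx in jq1.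
      case: (bedgeB _ _ i'B (Di i')) => [[_ [ej]]|[_ [ei'|ei']]]; first by rewrite ej eqxx in jq1.
        by rewrite ei ei' eqxx.
      by move=> _; apply/existsP; exists i'; rewrite Di ei' eqxx.
    by move=> _; apply/existsP; exists i; rewrite Di ei eqxx.
  have [f fP] := fin_all_exists all.
  have finj : injective f.
    move=> j j' e; have /andP[Dj /eqP ej] := fP j; have /andP[Dj' /eqP ej'] := fP j'.
    by apply: (prow (f j)) => //; rewrite ?ej e ?ej'.
  have [g _ gK] := injF_bij finj.
  case/negP: p0c; apply/existsP; exists (g p0).
  by have := fP (g p0); rewrite gK.
exists phi, p0, q0, p1, q1; split.
  split=> //.
  - move=> i j Dij e; have eB := phi_inr sphi e.
    by case: (bedgeB _ _ eB Dij) => [[-> [-> _]]|[_ []]] //; rewrite e.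
  - by apply/eqP=> /(phi_inr sphi); rewrite (negbTE ay).
  - by apply/eqP=> /(phi_inr sphi); rewrite (negbTE cx).
rewrite /hyp1; congr (_ :|: _); apply: (colored_latin tf decM sphi).
- by move=> i j; rewrite /D1 /= negbK => /andP[/eqP-> /eqP->].
- exact: subD1set.
- by move=> i j; rewrite in_setD1 bedge_eq andbC.
move=> i j; rewrite in_setD1 bedge_eq => /andP[Dij eB].
by case: (bedgeB _ _ eB Dij) => [[-> [-> ->]]|[eR _]]; [rewrite colxy|rewrite phiR].
Qed.

Lemma construction2_type2 k (H : {set {set vertex k}}) : construction2 H ->
  exists phi, type2 phi /\ H = hyp2 phi.
Proof.
case=> B0 col M _ tf _ colB rainbow decM perM.
have [phi sphi] := symbol_ex col decM.
have edgeG := tf_edgeG tf; have deg2 := tf_deg2 tf.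
have phiB i j : bedge i j \in B0 -> zz (phi i j) = col (bedge i j).
  by move=> eB; case: sphi => _ H'; apply: H' => //; apply: colB.
(* A path of three edges of the 2-factor lies on a cycle that traverses it in the same direction, so
   the condition on cycles applies to it. *)
have path3 u v w z : [set u; v] \in B0 -> [set v; w] \in B0 -> [set w; z] \in B0 ->
    w != u -> z != v -> uniq [:: col [set u; v]; col [set v; w]; col [set w; z]].
  move=> uv vw wz wu zv; have [C [cC uC nu]] := dart_cycle edgeG deg2 uv.
  have vC : v \in C by rewrite -nu mem_next.
  have nv : w = next C v.
    by rewrite -nu; apply: (next_unique edgeG deg2 cC uC); rewrite ?nu.
  have nw : z = next C w.
    by rewrite nv; apply: (next_unique edgeG deg2 cC vC); rewrite -?nv.
  by have := rainbow C u cC uC; rewrite /= nu -nv -nw.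
have diff u v w : [set u; v] \in B0 -> [set v; w] \in B0 -> w != u ->
    col [set u; v] != col [set v; w].
  move=> uv vw wu; have wv : [set w; v] \in B0 by rewrite setUC.
  have [z wz zv] := edge_other edgeG deg2 wv.
  have := path3 u v w z uv vw wz wu zv.
  by rewrite /= !inE negb_or => /and3P[/andP[]].
have rowd i j j' : bedge i j \in B0 -> bedge i j' \in B0 -> j != j' -> phi i j != phi i j'.
  move=> eB fB jj'; rewrite -(eqv k) !phiB // [bedge i j]setUC; apply: diff => //.
    by rewrite setUC.
  by rewrite eqv eq_sym.
have cold i i' j : bedge i j \in B0 -> bedge i' j \in B0 -> i != i' -> phi i j != phi i' j.
  move=> eB fB ii'; rewrite -(eqv k) !phiB // [bedge i' j]setUC; apply: diff => //.
    by rewrite setUC.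
  by rewrite eqv eq_sym.
have isr i j : bedge i j \in B0 -> exists t, phi i j = inr t.
  move=> eB; have : zz (phi i j) \in [set va k; vb k; vc k] by rewrite phiB ?colB.
  by case: (phi i j) => [l|t]; [rewrite !inE|exists t].
have prop : latin (@D2 k) phi.
  have aux i j i' j' : phi i j = phi i' j' -> (bedge i j \in B0) = (bedge i' j' \in B0).
    move=> e; apply/idP/idP=> [/isr|/isr] [t et]; apply: (phi_inr sphi (t := t)).
      by rewrite -e.
    by rewrite e.
  have auxM i j i' j' : phi i j = phi i' j' -> bedge i j \notin B0 ->
      (i == i') || (j == j') -> bedge i j = bedge i' j'.
    move=> e eB sh; have fB : bedge i' j' \notin B0 by rewrite -(aux _ _ _ _ e).
    case: (sphi) => /(_ i j eB)[l el eM] _.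
    have fM : bedge i' j' \in M l by apply: (phi_inl_M sphi) => //; rewrite -e.
    case/orP: sh => /eqP es.
      by apply: (M_uniq perM eM fM (x := vx i)); rewrite vx_bedge es.
    by apply: (M_uniq perM eM fM (x := vy j)); rewrite vy_bedge es.
  split=> [i j j' _ _ e|i i' j _ _ e].
    case: (boolP (bedge i j \in B0)) => eB.
      have fB : bedge i j' \in B0 by rewrite -(aux _ _ _ _ e).
      by apply/eqP; apply: contraT => ne; have := rowd i j j' eB fB ne; rewrite e eqxx.
    have sh : (i == i) || (j == j') by rewrite eqxx.
    by case: (bedge_inj (auxM _ _ _ _ e eB sh)).
  case: (boolP (bedge i j \in B0)) => eB.
    have fB : bedge i' j \in B0 by rewrite -(aux _ _ _ _ e).
    by apply/eqP; apply: contraT => ne; have := cold i i' j eB fB ne; rewrite e eqxx.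
  have sh : (i == i') || (j == j) by rewrite eqxx orbT.
  by case: (bedge_inj (auxM _ _ _ _ e eB sh)).
exists phi; split.
  split=> //.
  - move=> i j t t' e tt' /existsP[j' /= /eqP ej']; apply/negP=> /existsP[i' /= /eqP ei'].
    have eB := phi_inr sphi e; have jB := phi_inr sphi ej'; have iB := phi_inr sphi ei'.
    have jj' : j != j' by apply: contraNneq tt' => jj'; move: e; rewrite jj' ej' => -[->].
    have ii' : i != i' by apply: contraNneq tt' => ii'; move: e; rewrite ii' ei' => -[->].
    (* The cells with [t'] in row [i] and in column [j] are the end edges of a path whose middle
       edge is the cell [(i, j)]. *)
    have := path3 (vy j') (vx i) (vy j) (vx i').
    rewrite [[set vy j'; _]]setUC [[set vy j; _]]setUC -!/(bedge _ _) jB eB iB !eqv.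
    rewrite jj' eq_sym ii' => /(_ isT isT isT isT isT).
    by rewrite -!phiB // ej' ei' /= !inE eqxx orbT.
  - move=> i; have [j [j' [jj' jB j'B only]]] := tf_row tf i.
    have [t et] := isr _ _ jB; have [t' et'] := isr _ _ j'B.
    have /card_gt0P[s] : 0 < #|~: [set t; t']|.
      by rewrite cardsCs setCK card_ord cards2; case: (_ != _).
    rewrite !inE negb_or => /andP[st st']; exists s.
    apply/negP=> /existsP[l /= /eqP es]; have lB := phi_inr sphi es.
    case: (only l lB) => e; move: es; rewrite e ?et ?et' => -[ts].
      by rewrite ts eqxx in st.
    by rewrite ts eqxx in st'.
  - move=> j; have [i [i' [ii' iB i'B only]]] := tf_col tf j.
    have [t et] := isr _ _ iB; have [t' et'] := isr _ _ i'B.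
    have /card_gt0P[s] : 0 < #|~: [set t; t']|.
      by rewrite cardsCs setCK card_ord cards2; case: (_ != _).
    rewrite !inE negb_or => /andP[st st']; exists s.
    apply/negP=> /existsP[l /= /eqP es]; have lB := phi_inr sphi es.
    case: (only l lB) => e; move: es; rewrite e ?et ?et' => -[ts].
      by rewrite ts eqxx in st.
    by rewrite ts eqxx in st'.
rewrite /hyp2; congr (_ :|: _); apply: (colored_latin tf decM sphi) => // i j.
by rewrite andbT.
Qed.

Lemma card_symb k : 2 <= k -> #|{: symb k}| = k + 1.
Proof. by move=> k2; rewrite card_sum !card_ord; lia. Qed.

(** * The 2-factor and the matchings of a partial Latin square *)

Section Factor.

Variables (k : nat) (D : pred ('I_k * 'I_k)) (phi : 'I_k -> 'I_k -> symb k).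
Hypothesis k2 : 2 <= k.
Hypothesis lat : latin D phi.
Hypothesis rowl : forall i l, has_row D phi i (inl l).
Hypothesis coll : forall j l, has_col D phi j (inl l).

Definition fM (l : 'I_(k - 2)) : {set {set vertex k}} :=
  [set bedge ij.1 ij.2 | ij in [pred ij : 'I_k * 'I_k | D ij && (phi ij.1 ij.2 == inl l)]].

(** As a complement of the matchings, it also contains the cells outside [D], so that [a'c'] belongs
    to the 2-factor. *)
Definition fB0 : {set {set vertex k}} := bip k :\: \bigcup_l fM l.

Definition fcol (e : {set vertex k}) : vertex k :=
  odflt (va k) (omap (fun ij => zz (phi ij.1 ij.2))
    [pick ij : 'I_k * 'I_k | e == bedge ij.1 ij.2]).

Lemma fcolE i j : fcol (bedge i j) = zz (phi i j).
Proof.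
rewrite /fcol; case: pickP => [[i' j'] /= /eqP/bedge_inj[-> ->] //|/(_ (i, j))].
by rewrite /= eqxx.
Qed.

Lemma fMP i j l : (bedge i j \in fM l) = D (i, j) && (phi i j == inl l).
Proof.
apply/imsetP/idP => [[[i' j'] /= H /bedge_inj[-> ->]] //|H].
by exists (i, j).
Qed.

Lemma fB0P i j : (bedge i j \in fB0) = ~~ [exists l, D (i, j) && (phi i j == inl l)].
Proof.
rewrite inE mem_bip andbT; congr (~~ _); apply/bigcupP/existsP => [[l _]|[l H]].
  by rewrite fMP; exists l.
by exists l; rewrite ?fMP.
Qed.

Lemma fB0_D i j : bedge i j \in fB0 -> D (i, j) -> exists t, phi i j = inr t.
Proof.
rewrite fB0P => /existsPn none Dij; case e: (phi i j) => [l|t]; last by exists t.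
by have := none l; rewrite Dij e eqxx.
Qed.

Lemma fB0_ND i j : ~~ D (i, j) -> bedge i j \in fB0.
Proof. by move=> nD; rewrite fB0P; apply/existsPn=> l; rewrite (negbTE nD). Qed.

Lemma fM_bip l e : e \in fM l -> exists i j, [/\ e = bedge i j, D (i, j) & phi i j = inl l].
Proof. by case/imsetP=> -[i j] /andP[/= Dij /eqP p] ->; exists i, j. Qed.

Lemma fdecomposition : decomposition (bip k :\: fB0) fM.
Proof.
split.
  rewrite /fB0 setDDr setDv set0U; apply/esym/setIidPr/bigcupsP=> l _.
  by apply/subsetP=> e /fM_bip[i [j [-> _ _]]]; apply: mem_bip.
move=> l l' ll'; apply/pred0P=> e /=; apply/negP=> /andP[/fM_bip[i [j [-> Dij p]]]].
rewrite fMP Dij p /= => /eqP[e']; by rewrite e' eqxx in ll'.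
Qed.

Lemma fperfect l : perfect_matching (X k :|: Y k) (fM l).
Proof.
have [lrow lcol] := lat; apply/andP; split.
  apply/trivIsetP=> e f /fM_bip[i [j [-> Dij p]]] /fM_bip[i' [j' [-> Dij' p']]] ne.
  apply/pred0P=> u /=; apply/negP=> /andP[]; rewrite !inE.
  case/orP=> /eqP->; rewrite !eqv ?orbF => /eqP e'.
    case/eqP: ne; rewrite e' in Dij p *; congr (bedge _ _).
    by apply: (lrow i') => //; rewrite p p'.
  case/eqP: ne; rewrite e' in Dij p *; congr (bedge _ _).
  by apply: (lcol i i' j') => //; rewrite p p'.
apply/eqP/setP=> u; apply/bigcupP/idP => [[e /fM_bip[i [j [-> _ _]]]]|].
  by rewrite !inE => /orP[] /eqP->; rewrite imset_f ?orbT.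
case/in_XY=> [[i ->]|[j ->]].
  have /existsP[j H] := rowl i l; exists (bedge i j); first by rewrite fMP.
  by rewrite vx_bedge.
have /existsP[i H] := coll j l; exists (bedge i j); first by rewrite fMP.
by rewrite vy_bedge.
Qed.

(** In each line the [k - 2] symbols [z_l] occupy [k - 2] of the [k] cells, which leaves two. *)
Lemma ftwo_factor : two_factor (X k :|: Y k) (bip k) fB0.
Proof.
have [lrow lcol] := lat; apply/andP; split; first exact: subsetDl.
apply/forall_inP=> u /in_XY[[i ->]|[j ->]].
  have /fin_all_exists[g gP] l : exists j, D (i, j) && (phi i j == inl l).
    exact/existsP/rowl.
  have ginj : injective g.
    move=> l l' e; have /andP[_ /eqP p] := gP l; have /andP[_ /eqP p'] := gP l'.
    by move: p'; rewrite -e p => -[].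
  have -> : [set e in fB0 | vx i \in e] = bedge i @: ~: (g @: setT).
    apply/setP=> e; rewrite inE; apply/andP/imsetP => [[eB ie]|[j jg ->]].
      have /bipP[i' [j ee]] : e \in bip k by move: eB; rewrite inE => /andP[].
      move: ie; rewrite ee vx_bedge => /eqP ii'; exists j; rewrite ?ii' //.
      rewrite inE; apply/negP=> /imsetP[l _ jl]; move: eB.
      by rewrite ee fB0P -ii' => /existsPn/(_ l); rewrite jl gP.
    rewrite vx_bedge eqxx fB0P; split=> //; apply/existsPn=> l; apply/negP=> /andP[Dij /eqP p].
    have /andP[Dg /eqP pg] := gP l.
    have jl : j = g l by apply: (lrow i) => //; rewrite p pg.
    by move: jg; rewrite inE jl imset_f.
  rewrite card_imset; last by move=> a b /bedge_inj[].
  by rewrite cardsCs setCK card_imset // cardsT !card_ord; apply/eqP; lia.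
have /fin_all_exists[g gP] l : exists i, D (i, j) && (phi i j == inl l).
  exact/existsP/coll.
have ginj : injective g.
  move=> l l' e; have /andP[_ /eqP p] := gP l; have /andP[_ /eqP p'] := gP l'.
  by move: p'; rewrite -e p => -[].
have -> : [set e in fB0 | vy j \in e] = (fun i => bedge i j) @: ~: (g @: setT).
  apply/setP=> e; rewrite inE; apply/andP/imsetP => [[eB je]|[i ig ->]].
    have /bipP[i [j' ee]] : e \in bip k by move: eB; rewrite inE => /andP[].
    move: je; rewrite ee vy_bedge => /eqP jj'; exists i; rewrite ?jj' //.
    rewrite inE; apply/negP=> /imsetP[l _ il]; move: eB.
    by rewrite ee fB0P -jj' => /existsPn/(_ l); rewrite il gP.
  rewrite vy_bedge eqxx fB0P; split=> //; apply/existsPn=> l; apply/negP=> /andP[Dij /eqP p].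
  have /andP[Dg /eqP pg] := gP l.
  have il : i = g l by apply: (lcol i (g l) j) => //; rewrite p pg.
  by move: ig; rewrite inE il imset_f.
rewrite card_imset; last by move=> a b /bedge_inj[].
by rewrite cardsCs setCK card_imset // cardsT !card_ord; apply/eqP; lia.
Qed.

Lemma fsymbol : symbol_of fB0 fcol fM phi.
Proof.
split=> i j; last by rewrite fcolE.
rewrite fB0P negbK => /existsP[l /andP[Dij /eqP p]]; exists l => //.
by rewrite fMP Dij p /=.
Qed.

End Factor.

Lemma partite_third k (H : {set {set vertex k}}) i j : partite H ->
  adj H (vx i) (vy j) -> exists s, triple i j s \in H.
Proof.
move=> par /adjP[ne [f [fH xf yf]]].
have [z [zx zy fe]] := card3P (sf_card (par_sf par) fH) ne xf yf.
have zf : z \in f by rewrite fe !inE eqxx !orbT.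
case: (vertexP z) => [[i' e]|[j' e]|[s e]]; last by exists s; rewrite /triple -e -fe.
- by have := par_X par i' i; rewrite -e (adj_edge fH).
- by have := par_Y par j' j; rewrite -e (adj_edge fH).
Qed.

Lemma miss_one k (f : 'I_k -> symb k) : 2 <= k -> injective f ->
    (forall l, exists i, f i = inl l) ->
  exists t, (forall i, f i != inr t) /\ forall t', t' != t -> exists i, f i = inr t'.
Proof.
move=> k2 finj fl.
have c1 : #|~: (f @: setT)| = 1.
  by rewrite cardsCs setCK card_imset // cardsT card_ord card_symb // addKn.
have /cards1P[s es] : #|~: (f @: setT)| == 1 by rewrite c1.
have : s \in ~: (f @: setT) by rewrite es set11.
case: s es => [l|t] es; rewrite inE => /imsetP ns.
  by have [i fi] := fl l; case: ns; exists i.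
exists t; split=> [i|t' tt']; first by apply/eqP=> e; case: ns; exists i.
have : inr t' \notin ~: (f @: setT) by rewrite es inE; apply: contraNneq tt' => -[->].
by rewrite inE negbK => /imsetP[i _ ->]; exists i.
Qed.

Section Incidence.

Variables (k : nat) (H : {set {set vertex k}}).

Lemma has_row_adj phi D i s : latin_hyp D phi \subset H -> has_row D phi i s ->
  adj H (vx i) (zz s).
Proof.
move=> sub /existsP[j /andP[Dij /eqP <-]].
apply: (adj_edge (e := triple i j (phi i j))); rewrite ?inE ?eqxx ?orbT ?eqv //.
exact/(subsetP sub)/latin_adj_edge.
Qed.

Lemma has_col_adj phi D j s : latin_hyp D phi \subset H -> has_col D phi j s ->
  adj H (vy j) (zz s).
Proof.
move=> sub /existsP[i /andP[Dij /eqP <-]].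
apply: (adj_edge (e := triple i j (phi i j))); rewrite ?inE ?eqxx ?orbT ?eqv //.
exact/(subsetP sub)/latin_adj_edge.
Qed.

Lemma sail_triple i j s w : sail_free H -> triple i j s \in H -> w \notin triple i j s ->
  adj H w (vx i) -> adj H w (vy j) -> adj H w (zz s) -> False.
Proof.
move=> sfH eH we ax ay az; have [u] := sf_sail sfH eH we.
rewrite in_co !inE -orbA => /or3P[] /eqP-> /andP[_].
- by rewrite ax.
- by rewrite ay.
- by rewrite az.
Qed.

End Incidence.

(** * From the tripartition to Construction 2 *)

Section Forward2.

Variables (k : nat) (H : {set {set vertex k}}).
Hypotheses (k3 : 3 <= k) (par : partite H).
Hypothesis XY : forall i j, adj H (vx i) (vy j).
Hypothesis abcH : [set va k; vb k; vc k] \in H.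

Let sfH := par_sf par.
Let k2 : 2 <= k. Proof. exact: ltnW. Qed.

Lemma forward2_phi : exists phi, [/\ H = hyp2 phi, latin (@D2 k) phi,
  forall i l, has_row (@D2 k) phi i (inl l) & forall j l, has_col (@D2 k) phi j (inl l)].
Proof.
have ex (ij : 'I_k * 'I_k) : exists s, triple ij.1 ij.2 s \in H.
  exact: partite_third.
have [f fP] := fin_all_exists ex; pose phi i j := f (i, j).
have HE : H = hyp2 phi.
  apply/esym/eqP; rewrite eqEcard type2_card (par_card par) leqnn andbT.
  apply/subsetP=> e /hyp2P[[i [j ->]]|-> //]; exact: (fP (i, j)).
have phiH i j : triple i j (phi i j) \in H by apply: (fP (i, j)).
exists phi; split=> //.
- split=> [i j j' _ _ e|i i' j _ _ e].
    have ne : vx i != zz (phi i j) by rewrite eqv.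
    have := sf_lin sfH (phiH i j) (phiH i j') ne; rewrite -e !inE !eqxx ?orbT.
    by move/(_ isT isT isT isT)/triple_inj => [].
  have ne : vy j != zz (phi i j) by rewrite eqv.
  have := sf_lin sfH (phiH i j) (phiH i' j) ne; rewrite -e !inE !eqxx ?orbT.
  by move/(_ isT isT isT isT)/triple_inj => [].
- by move=> i l; apply: adj2_xz; rewrite -HE adj_sym; apply: (par_ZX par).
- by move=> j l; apply: adj2_yz; rewrite -HE adj_sym; apply: (par_ZY par).
Qed.

Lemma adj_abc t t' : t != t' -> adj H (vabc k t) (vabc k t').
Proof.
by move=> tt'; apply: (adj_edge abcH); rewrite ?mem_s1.
Qed.

Lemma forward2 : construction2 H.
Proof.
have [phi [HE lat rowl coll]] := forward2_phi.
have [lrow lcol] := lat.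
have sub : latin_hyp (@D2 k) phi \subset H by rewrite HE subsetUl.
have phiH i j : triple i j (phi i j) \in H by apply/(subsetP sub)/latin_adj_edge.
have missr i : exists t, (forall j, phi i j != inr t) /\
    forall t', t' != t -> exists j, phi i j = inr t'.
  apply: miss_one => // [j j' e|l]; first exact: (lrow i).
  by have /existsP[j /= /eqP] := rowl i l; exists j.
have missc j : exists t, (forall i, phi i j != inr t) /\
    forall t', t' != t -> exists i, phi i j = inr t'.
  apply: miss_one => // [i i' e|l]; first exact: (lcol i i' j).
  by have /existsP[i /= /eqP] := coll j l; exists i.
have [mr mrP] := fin_all_exists missr; have [mc mcP] := fin_all_exists missc.
(* If neither row [i] nor column [j] missed [u], the vertex [u] would see the whole edge of the cell
   [(i, j)], its symbol [t] being adjacent to [u] through [abc]. *)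
have clash i j t u : phi i j = inr t -> t != u -> mr i != u -> mc j = u.
  move=> e tu mu; apply/eqP; apply: contraT => cu.
  rewrite eq_sym in mu; rewrite eq_sym in cu.
  have [j' ej'] := (mrP i).2 u mu; have [i' ei'] := (mcP j).2 u cu.
  case: (@sail_triple _ H i j (inr t) (zz (inr u)) sfH).
  - by rewrite -e.
  - by rewrite !inE !eqv /=; apply: contraNneq tu => -[->].
  - rewrite adj_sym; apply: (has_row_adj sub); apply/existsP.
    by exists j'; rewrite ej' /=.
  - rewrite adj_sym; apply: (has_col_adj sub); apply/existsP.
    by exists i'; rewrite ei' /=.
  - by apply: adj_abc; rewrite eq_sym.
pose A s := [set i | mr i == s]; pose B s := [set j | mc j == s].
(* By [clash], following the symbol other than [s] and [u] injects the rows that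
   miss [s] into the columns that miss [u]. *)
have leAB s u : s != u -> #|A s| <= #|B u|.
  move=> su; have /card_gt0P[t] : 0 < #|~: [set s; u]|.
    by rewrite cardsCs setCK card_ord cards2 su.
  rewrite !inE negb_or => /andP[ts tu].
  have ex i : exists j, i \in A s -> phi i j = inr t.
    case: (boolP (i \in A s)) => [|_]; last by exists i.
    rewrite inE => /eqP ms; have [|j ej] := (mrP i).2 t; first by rewrite ms.
    by exists j.
  have [g gP] := fin_all_exists ex.
  rewrite -(card_in_imset (f := g) (D := A s)).
    apply: subset_leq_card; apply/subsetP=> _ /imsetP[i iA ->].
    move: (iA); rewrite !inE => /eqP ms; apply/eqP.
    by apply: (clash i _ t) => //; [apply: gP|rewrite ms].
  move=> i i' iA i'A e; apply: (lcol i i' (g i)) => //.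
  by rewrite gP // e gP.
have sumA : \sum_s #|A s| = k.
  rewrite -[RHS]card_ord -[RHS]sum1_card (partition_big mr xpredT) //=.
  by apply: eq_bigr => s _; rewrite sum1dep_card; apply: eq_card => i; rewrite !inE.
have sumB : \sum_s #|B s| = k.
  rewrite -[RHS]card_ord -[RHS]sum1_card (partition_big mc xpredT) //=.
  by apply: eq_bigr => s _; rewrite sum1dep_card; apply: eq_card => i; rewrite !inE.
(* Since both families sum to [k], all inequalities of [leAB] are equalities, and the three classes
   of rows have the same size. *)
have dvd3 : 3 %| k.
  move: sumA sumB; rewrite !big_ord_recl !big_ord0.
  set s0 : 'I_3 := ord0; set s1 : 'I_3 := lift _ _; set s2 : 'I_3 := lift _ _.
  have := leAB s0 s1 isT; have := leAB s0 s2 isT; have := leAB s1 s0 isT.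
  have := leAB s1 s2 isT; have := leAB s2 s0 isT; have := leAB s2 s1 isT.
  move=> h1 h2 h3 h4 h5 h6 hA hB; have : k = 3 * #|A s0| by nlia.
  by move=> ->; apply: dvdn_mulr.
have tf := ftwo_factor k2 lat rowl coll.
have edgeG := tf_edgeG tf; have deg2 := tf_deg2 tf.
set B0 := fB0 (@D2 k) phi in tf edgeG deg2; pose col := fcol phi.
have colB e : e \in B0 -> exists t, col e = vabc k t /\ vabc k t |: e \in H.
  move=> eB; have [i [j ee]] := tf_edge tf eB; rewrite ee in eB *.
  have [t et] := fB0_D eB isT.
  exists t; rewrite /col fcolE et; split=> //.
  by have := phiH i j; rewrite triple_bedge et.
have colX e : e \in B0 -> col e \in [set va k; vb k; vc k].
  by case/colB=> t [-> _]; rewrite mem_s1.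
have nabc e t : e \in B0 -> vabc k t \notin e.
  by case/(tf_edge tf)=> i [j ->]; rewrite !inE.
have colne e f u : e \in B0 -> f \in B0 -> u \in e -> u \in f -> e != f -> col e != col f.
  move=> eB fB ue uf ef; have [t [ce eH]] := colB e eB; have [t' [cf fH]] := colB f fB.
  apply: contraNneq ef; rewrite ce cf => tt'; rewrite -tt' in fH.
  have ut : u != vabc k t by apply: contraTneq ue => ->; apply: nabc.
  have := sf_lin sfH eH fH ut; rewrite !inE ue uf eqxx !orbT => /(_ isT isT isT isT) E.
  by rewrite -(setU1K (nabc e t eB)) E setU1K // nabc.
(* If the outer two of three consecutive edges had the same colour [t], then [t] would see both ends
   of the middle edge and, through [abc], its colour. *)
have rainbow C v0 : is_cycle B0 C -> v0 \in C ->
    let v1 := next C v0 in let v2 := next C v1 in let v3 := next C v2 in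
    uniq [:: col [set v0; v1]; col [set v1; v2]; col [set v2; v3]].
  move=> cC v0C /=; set v1 := next C v0; set v2 := next C v1; set v3 := next C v2.
  have v1C : v1 \in C by rewrite mem_next. have v2C : v2 \in C by rewrite mem_next.
  have e0 := next_edge cC v0C; have e1 := next_edge cC v1C; have e2 := next_edge cC v2C.
  rewrite -/v1 -/v2 -/v3 in e0 e1 e2.
  have n02 : v2 != v0 := next2_neq cC v0C. have n13 : v3 != v1 := next2_neq cC v1C.
  have c01 : col [set v0; v1] != col [set v1; v2].
    apply: (colne _ _ v1) => //; rewrite ?inE ?eqxx ?orbT //.
    by apply/eqP; rewrite setUC => /set2_inj e; rewrite e eqxx in n02.
  have c12 : col [set v1; v2] != col [set v2; v3].
    apply: (colne _ _ v2) => //; rewrite ?inE ?eqxx ?orbT //.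
    by apply/eqP; rewrite setUC => /set2_inj e; rewrite e eqxx in n13.
  rewrite !inE negb_or c01 c12 /= andbT; apply/eqP=> c02.
  have [t [ct tH]] := colB _ e0; have [s [cs sH]] := colB _ e1.
  have [t' [ct' t'H]] := colB _ e2; rewrite c02 ct' in ct; case: ct => tt'.
  rewrite tt' in ct' t'H.
  have ts : t != s by apply: contraNneq c01 => ts; rewrite c02 ct' cs ts.
  have ns : vabc k t \notin vabc k s |: [set v1; v2].
    by rewrite in_setU1 negb_or (nabc _ t e1) andbT; apply: contraNneq ts => -[->].
  have [u] := sf_sail sfH sH ns; rewrite in_co !inE => /or3P[] /eqP -> /andP[nu] /negP[].
  - exact: adj_abc.
  - by apply: (adj_edge tH) => //; rewrite !inE eqxx ?orbT.
  - by apply: (adj_edge t'H) => //; rewrite !inE eqxx ?orbT.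
(* Along the cycle three consecutive colours differ, so the colours have period 3, and the sides
   alternate; hence 3 and 2 divide the length. *)
have six C : is_cycle B0 C -> 6 %| size C.
  move=> cC; have [u uC] : exists u, u \in C.
    by case: C cC => [|u C] //; exists u; rewrite inE eqxx.
  pose n := next C; pose c u := col [set u; n u].
  have nC w : w \in C -> n w \in C by rewrite mem_next.
  have iC m w : w \in C -> iter m n w \in C.
    by move=> wC; elim: m => //= m; apply: nC.
  have rb w : w \in C -> uniq [:: c w; c (n w); c (n (n w))] by apply: rainbow.
  have c3 w : w \in C -> c (n (n (n w))) = c w.
    move=> wC; have := rb w wC; have := rb (n w) (nC w wC).
    have inabc z : z \in C -> c z \in [set va k; vb k; vc k].
      by move=> zC; apply: colX; exact: (next_edge cC zC).
    have := inabc _ wC; have := inabc _ (nC _ wC); have := inabc _ (nC _ (nC _ wC)).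
    have := inabc _ (nC _ (nC _ (nC _ wC))); rewrite !inE -!orbA.
    by do 4 (move=> /or3P[] /eqP->).
  have c3q q w : w \in C -> c (iter (q * 3) n w) = c w.
    move=> wC; elim: q => [//|q IH]; rewrite mulSn.
    by rewrite (iterD 3) c3 ?IH // iC.
  have iterm : iter (size C) n u = u := cycle_iter cC uC.
  have d3 : 3 %| size C.
    rewrite /dvdn; have := divn_eq (size C) 3; have := ltn_mod (size C) 3.
    case er: (size C %% 3) => [|[|[|r]]] //= _ e; rewrite e addnC iterD in iterm.
      have := rb _ (iC (size C %/ 3 * 3) u uC); rewrite /= !inE negb_or.
      by rewrite [n _]iterm c3q // eqxx.
    have := rb _ (iC (size C %/ 3 * 3) u uC); rewrite /= !inE negb_or.
    by rewrite [n (n _)]iterm c3q // eqxx andbF.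
  have side w : w \in C -> (n w \in X k) = (w \notin X k).
    move=> wC; have := next_edge cC wC; case/(tf_edge tf)=> i [j e].
    have := edge_neq edgeG (next_edge cC wC); rewrite -/(n w).
    have : w \in bedge i j by rewrite -e !inE eqxx.
    have : n w \in bedge i j by rewrite -e !inE eqxx orbT.
    have yX : vy j \notin X k by apply/imsetP=> -[].
    have xX : vx i \in X k by apply: imset_f.
    by rewrite !inE => /orP[] /eqP -> /orP[] /eqP ->; rewrite ?eqxx ?xX ?(negbTE yX).
  have sideq m w : w \in C -> (iter m n w \in X k) = odd m (+) (w \in X k).
    move=> wC; elim: m => //= m IH; rewrite side ?iC // IH.
    by case: odd; case: (w \in X k).
  have d2 : 2 %| size C.
    rewrite dvdn2; have := sideq (size C) u uC; rewrite iterm.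
    by case: odd; case: (u \in X k).
  by rewrite (@Gauss_dvd 2 3) // d2.
have fsym := fsymbol (@D2 k) phi.
rewrite HE /hyp2 -(colored_latin tf (fdecomposition (@D2 k) phi) fsym (D := @D2 k) (B1 := B0)) //.
- apply: Construction2 => //.
  + exact: fdecomposition.
  + exact: fperfect.
- by move=> i j; rewrite andbT.
- by move=> i j _; rewrite fcolE.
Qed.

End Forward2.

Lemma mem_X k i : vx i \in X k. Proof. exact: imset_f. Qed.
Lemma mem_Y k j : vy j \in Y k. Proof. exact: imset_f. Qed.

Lemma card_ordC1 k (i : 'I_k) : #|[set~ i]| = k - 1.
Proof. by have := cardsC1 i; rewrite card_ord subn1. Qed.

Lemma uniq_map_xy k (s t : seq 'I_k) :
  uniq s -> uniq t -> uniq ([seq vx i | i <- s] ++ [seq vy j | j <- t]).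
Proof.
move=> us ut; rewrite cat_uniq !map_inj_uniq ?us ?ut //; try by move=> ? ? [].
rewrite /= andbT; apply/hasPn=> _ /mapP[j _ ->] /=; apply/mapP=> -[i _].
by [].
Qed.

(** * From an array to Construction 1 *)

Section Type1.

Variables (k : nat) (phi : 'I_k -> 'I_k -> symb k) (p0 q0 p1 q1 : 'I_k).
Hypotheses (k2 : 2 <= k) (t1 : type1 phi p0 q0 p1 q1) (eb : phi p1 q1 = sb k).
Local Notation D := (D1 p0 q0).
Hypothesis rowl : forall i l, has_row D phi i (inl l).
Hypothesis coll : forall j l, has_col D phi j (inl l).

Local Notation B0 := (fB0 D phi).
Let lrow := (t1_proper t1).1.
Let lcol := (t1_proper t1).2.
Let tf : two_factor (X k :|: Y k) (bip k) B0.
Proof. exact: ftwo_factor (t1_proper t1) rowl coll. Qed.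
Let edgeG := tf_edgeG tf.
Let deg2 := tf_deg2 tf.
Let p1p0 := t1_p t1.
Let q1q0 := t1_q t1.

Let Dp i j : i != p0 -> D (i, j). Proof. by move=> ip; rewrite /D1 /= (negbTE ip). Qed.

Let Dq i j : j != q0 -> D (i, j).
Proof. by move=> jq; rewrite /D1 /= (negbTE jq) andbF. Qed.

Let phiB i j : bedge i j \in B0 -> D (i, j) -> (i, j) != (p1, q1) ->
  phi i j = sa k \/ phi i j = sc k.
Proof.
move=> eB Dij ne; have [t et] := fB0_D eB Dij.
case: (symbP (phi i j)) => [[l]|->|/(t1_b t1 Dij)|->]; [by rewrite et|by left| |by right].
by case=> e1 e2; rewrite e1 e2 eqxx in ne.
Qed.

Let NB01 : bedge p0 q1 \notin B0.
Proof.
apply/negP=> eB; have Dpq := Dq p0 q1q0.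
case: (phiB eB Dpq) => [|e|e]; first by rewrite xpair_eqE eq_sym (negbTE p1p0).
  by have := t1_p0q1 t1; rewrite e eqxx.
by case/negP: (t1_p0c t1); apply/existsP; exists q1; rewrite Dpq e eqxx.
Qed.

Let NB10 : bedge p1 q0 \notin B0.
Proof.
apply/negP=> eB; have Dpq := Dp q0 p1p0.
case: (phiB eB Dpq) => [|e|e]; first by rewrite xpair_eqE eqxx eq_sym (negbTE q1q0).
  by case/negP: (t1_q0a t1); apply/existsP; exists p1; rewrite Dpq e eqxx.
by have := t1_p1q0 t1; rewrite e eqxx.
Qed.

Section Cycle.

Variable C : seq (vertex k).
Hypotheses (cC : is_cycle B0 C) (p0C : vx p0 \in C) (np0 : next C (vx p0) = vy q0).

Let q0C : vy q0 \in C. Proof. by rewrite -np0 mem_next. Qed.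

Let nexty j : vy j \in C -> exists2 i, next C (vy j) = vx i & bedge i j \in B0.
Proof.
move=> jC; have := next_edge cC jC; move: (next C (vy j)) => z zB.
have [i [j' e]] := tf_edge tf zB; have := zB; rewrite e => zB'.
have : vy j \in bedge i j' by rewrite -e !inE eqxx.
have : vx i \in [set vy j; z] by rewrite e !inE eqxx.
by rewrite vy_bedge !inE /= => /eqP<- /eqP->; exists i.
Qed.

Let nextx i : vx i \in C -> exists2 j, next C (vx i) = vy j & bedge i j \in B0.
Proof.
move=> iC; have := next_edge cC iC; move: (next C (vx i)) => z zB.
have [i' [j e]] := tf_edge tf zB; have := zB; rewrite e => zB'.
have : vx i \in bedge i' j by rewrite -e !inE eqxx.
have : vy j \in [set vx i; z] by rewrite e !inE eqxx orbT.
by rewrite vx_bedge !inE /= => /eqP<- /eqP->; exists j.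
Qed.

(* From c' on, the colors alternate c, a, c, ... until the edge x'y' is passed,
   while a' has no edge of color c: so the cycle cannot close up before x'y'. *)
Lemma type1_cycle : bedge p1 q1 \in cycle_edges C.
Proof.
apply: contraT => nB; have p0nc := t1_p0c t1; have q0na := t1_q0a t1.
pose P u := (exists i j, [/\ u = vy j, next C u = vx i, D (i, j) & phi i j = sc k]) \/
  (exists i j, [/\ u = vx i, next C u = vy j, i != p0 & phi i j = sa k]).
have noty i j : vx i \in C -> next C (vx i) = vy j -> (i, j) != (p1, q1).
  move=> iC e; apply: contraNneq nB => -[<- <-].
  by apply/imsetP; exists (vx i); rewrite // e.
have notx i j : vy j \in C -> next C (vy j) = vx i -> (i, j) != (p1, q1).
  move=> jC e; apply: contraNneq nB => -[<- <-].
  by apply/imsetP; exists (vy j); rewrite // e /bedge setUC.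
have startP : P (vy q0).
  have [i e eB] := nexty q0C; left; exists i, q0.
  have ip : i != p0.
    by have := next2_neq cC p0C; rewrite np0 e; apply: contraNneq => ->.
  have Di := Dp q0 ip; split=> //.
  case: (phiB eB Di (notx _ _ q0C e)) => // es.
  by case/negP: q0na; apply/existsP; exists i; rewrite Di es eqxx.
have step u : u \in C -> P u -> P (next C u).
  move=> uC [[i [j [eu nu Dij es]]]|[i [j [eu nu ip es]]]].
    have iC : vx i \in C by rewrite -nu mem_next.
    have ip : i != p0.
      by apply: contraNneq p0nc => ei; rewrite ei in Dij es; apply/existsP; exists j; rewrite Dij es eqxx.
    right; have [j' e eB] := nextx iC; exists i, j'; rewrite nu; split=> //.
    case: (phiB eB (Dp _ ip) (noty _ _ iC e)) => // es'.
    have := next2_neq cC uC; rewrite nu e eu eqv; case/eqP.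
    by apply: (@lrow i) => //; [apply: Dp|rewrite es es'].
  have jC : vy j \in C by rewrite -nu mem_next.
  have jq : j != q0.
    apply: contraNneq q0na => ej; rewrite ej in es; apply/existsP; exists i.
    by rewrite (Dp _ ip) es eqxx.
  left; have [i' e eB] := nexty jC; exists i', j; rewrite nu; split=> //; first exact: Dq.
  case: (phiB eB (Dq _ jq) (notx _ _ jC e)) => // es'.
  have := next2_neq cC uC; rewrite nu e eu eqv; case/eqP.
  by apply: (@lcol i' i j); [apply: Dq|apply: Dq|rewrite es es'].
by case: (cycle_ind cC q0C startP step p0C) => -[i [j []]] // [<-]; rewrite eqxx.
Qed.

(** Six distinct vertices are the ends of [a'c'] and [x'y'], the successor of [c'] and the
    predecessor of [a']; the last two differ from [x'] and [y'] because [c'x'] and [a'y'] are not in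
    the 2-factor. *)
Lemma type1_cycle_size : 6 <= size C.
Proof.
have in_cyc u : u \in bedge p1 q1 -> u \in C.
  case/imsetP: type1_cycle => v vC ->; rewrite !inE => /orP[] /eqP-> //.
  by rewrite mem_next.
have p1C : vx p1 \in C by apply: in_cyc; rewrite vx_bedge.
have q1C : vy q1 \in C by apply: in_cyc; rewrite vy_bedge.
have nC : next C (vy q0) \in C by rewrite mem_next.
have pC : prev C (vx p0) \in C by rewrite mem_prev.
have := next_edge cC q0C; have := next_edge cC pC; rewrite (next_prev (cycle_uniq cC)).
have := next2_neq cC p0C; have := next2_neq cC pC.
rewrite (next_prev (cycle_uniq cC)) np0.
move: (next C (vy q0)) (prev C (vx p0)) nC pC => u v uC vC vq up vB uB.
have [j vj] : exists j, v = vy j.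
  have [i [j e]] := tf_edge tf vB; exists j.
  have : vy j \in [set v; vx p0] by rewrite e vy_bedge.
  by rewrite !inE orbF => /eqP.
have [i ui] : exists i, u = vx i.
  have [i [j' e]] := tf_edge tf uB; exists i.
  have : vx i \in [set vy q0; u] by rewrite e vx_bedge.
  by rewrite !inE => /eqP.
rewrite vj in vB vC vq; rewrite ui in uB uC up.
have ip1 : i != p1 by apply: contraNneq NB10 => <-; rewrite /bedge setUC.
have jq1 : j != q1 by apply: contraNneq NB01 => <-; rewrite /bedge setUC.
apply: (@uniq_leq_size _ [:: vx p0; vx p1; vx i; vy q0; vy q1; vy j]).
  apply: (@uniq_map_xy k [:: p0; p1; i] [:: q0; q1; j]); rewrite /= !inE negb_or andbT.
    by rewrite -(eq_sym p1) p1p0 (eq_sym p1) ip1 eq_sym -eq_vxx up.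
  by rewrite -(eq_sym q1) q1q0 (eq_sym q1) jq1 -eq_vyy vq.
by move=> w; rewrite !inE; do 5 (case/orP=> [/eqP-> //|]); move/eqP->.
Qed.

End Cycle.

Lemma type1_construction1 : construction1 (hyp1 phi p0 q0).
Proof.
have fsym := fsymbol D phi.
rewrite /hyp1 -(colored_latin tf (fdecomposition D phi) fsym (D := D)
  (B1 := B0 :\ bedge p0 q0)); last first.
- by move=> i j _; rewrite fcolE.
- by move=> i j; rewrite in_setD1 bedge_eq andbC.
- exact: subD1set.
- by move=> i j; apply: fB0_ND.
have B00 : bedge p0 q0 \in B0 by apply: fB0_ND; rewrite /D1 /= !eqxx.
have [C [cC p0C np0]] := dart_cycle edgeG deg2 B00.
have p0nc := t1_p0c t1; have q0na := t1_q0a t1.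
have RP e : e \in B0 :\: [set bedge p0 q0; bedge p1 q1] ->
    exists i j, [/\ e = bedge i j, D (i, j) & phi i j = sa k \/ phi i j = sc k].
  rewrite in_setD in_set2 negb_or => /andP[/andP[e0 e1] eB]; have [i [j ee]] := tf_edge tf eB.
  exists i, j; rewrite ee in eB; rewrite ee bedge_eq in e0; rewrite ee bedge_eq in e1.
  by split=> //; apply: phiB; rewrite // xpair_eqE.
apply: (@Construction1 k B0 C (vx p0) (vy q0) (vx p1) (vy q1) (fcol phi) (fM D phi)) => //.
- exact: type1_cycle_size cC p0C np0.
- exact: mem_X.
- exact: mem_X.
- exact: mem_Y.
- exact: mem_Y.
- by apply/imsetP; exists (vx p0); rewrite // np0.
- exact: type1_cycle cC p0C np0.
- rewrite disjoint_sym; apply/pred0P=> u; rewrite /= !inE.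
  by apply/negP=> /andP[/orP[] /eqP->]; rewrite !eqv ?(negbTE p1p0) ?(negbTE q1q0).
- by apply: contra NB01; apply: cycle_edges_sub cC _.
- by rewrite setUC; apply: contra NB10; apply: cycle_edges_sub cC _.
- move=> e /RP[i [j [-> _ es]]]; rewrite fcolE !inE !(vaE, vcE) !eqv.
  by case: es => ->; rewrite eqxx ?orbT.
- move=> e f /RP[i [j [-> Dij _]]] /RP[i' [j' [-> Dij' _]]] ne /pred0Pn[u /= /andP[]].
  rewrite !fcolE eqv; rewrite !inE => /orP[] /eqP->; rewrite !eqv ?orbF => /eqP ij.
    apply: contraNneq ne => es; rewrite -ij in Dij' es *.
    by rewrite (lrow Dij Dij' es).
  apply: contraNneq ne => es; rewrite -ij in Dij' es *.
  by rewrite (lcol Dij Dij' es).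
- move=> e /RP[i [j [-> Dij es]]]; rewrite vx_bedge fcolE => /eqP ei.
  case: es => es; rewrite es //; case/negP: p0nc; rewrite -{}ei in Dij es.
  by apply/existsP; exists j; rewrite Dij es eqxx.
- move=> e /RP[i [j [-> Dij es]]]; rewrite vy_bedge fcolE => /eqP ej.
  case: es => es; rewrite es //; case/negP: q0na; rewrite -ej in Dij es.
  by apply/existsP; exists i; rewrite Dij es eqxx.
- by rewrite fcolE eb.
- exact: fdecomposition.
- exact: fperfect.
Qed.

End Type1.

(** * From the tripartition to an array for Construction 1 *)

Section Forward1.

Variables (k : nat) (H : {set {set vertex k}}) (p0 q0 : 'I_k).
Hypotheses (k3 : 3 <= k) (par : partite H).
Hypothesis XY : forall i j, adj H (vx i) (vy j) = ~~ ((i == p0) && (j == q0)).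
Hypothesis s1H : [set vx p0; vb k; vc k] \in H.
Hypothesis s2H : [set vy q0; va k; vb k] \in H.

Let sfH := par_sf par.
Let k2 : 2 <= k. Proof. exact: ltnW. Qed.
Local Notation D := (D1 p0 q0).

Lemma forward1_phi : exists phi, [/\ H = hyp1 phi p0 q0, latin D phi,
  forall i l, has_row D phi i (inl l) & forall j l, has_col D phi j (inl l)].
Proof.
have ex (ij : 'I_k * 'I_k) : exists s, D ij -> triple ij.1 ij.2 s \in H.
  case: (boolP (D ij)) => [Dij|_]; last by exists (sa k).
  by have [|s sH] := @partite_third k H ij.1 ij.2 par; [rewrite XY|exists s].
have [f fP] := fin_all_exists ex; pose phi i j := f (i, j).
have HE : H = hyp1 phi p0 q0.
  apply/esym/eqP; rewrite eqEcard type1_card (par_card par) leqnn andbT.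
  apply/subsetP=> e /hyp1P[[i [j [Dij ->]]]|-> //|-> //]; exact: (fP (i, j) Dij).
have phiH i j : D (i, j) -> triple i j (phi i j) \in H by apply: (fP (i, j)).
exists phi; split=> //.
- split=> [i j j' Dij Dij' e|i i' j Dij Dij' e].
    have ne : vx i != zz (phi i j) by rewrite eqv.
    have := sf_lin sfH (phiH i j Dij) (phiH i j' Dij') ne; rewrite -e !inE !eqxx ?orbT.
    by move/(_ isT isT isT isT)/triple_inj => [].
  have ne : vy j != zz (phi i j) by rewrite eqv.
  have := sf_lin sfH (phiH i j Dij) (phiH i' j Dij') ne; rewrite -e !inE !eqxx ?orbT.
  by move/(_ isT isT isT isT)/triple_inj => [].
- move=> i l; have : adj (hyp1 phi p0 q0) (vx i) (zz (inl l)).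
    by rewrite -HE adj_sym; apply: (par_ZX par).
  by case/adj1_xz=> // -[_ []].
- move=> j l; have : adj (hyp1 phi p0 q0) (vy j) (zz (inl l)).
    by rewrite -HE adj_sym; apply: (par_ZY par).
  by case/adj1_yz=> // -[_ []].
Qed.

Lemma forward1_type1 : exists phi p1 q1, [/\ H = hyp1 phi p0 q0, type1 phi p0 q0 p1 q1,
    phi p1 q1 = sb k, forall i l, has_row D phi i (inl l)
  & forall j l, has_col D phi j (inl l)].
Proof.
have [phi [HE lat rowl coll]] := forward1_phi.
have [lrow lcol] := lat.
have sub : latin_hyp D phi \subset H by rewrite HE subsetUl.
have phiH i j : D (i, j) -> triple i j (phi i j) \in H.
  by move=> Dij; apply/(subsetP sub)/latin_adj_edge.
have Dp i j : i != p0 -> D (i, j) by move=> ip; rewrite /D1 /= (negbTE ip).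
have Dq i j : j != q0 -> D (i, j) by move=> jq; rewrite /D1 /= (negbTE jq) andbF.
have in_s1 s : (s = sb k) \/ (s = sc k) -> zz s \in [set vx p0; vb k; vc k].
  by case=> ->; rewrite !inE eqxx ?orbT.
have in_s2 s : (s = sa k) \/ (s = sb k) -> zz s \in [set vy q0; va k; vb k].
  by case=> ->; rewrite !inE eqxx ?orbT.
have row0 s : s = sb k \/ s = sc k -> ~~ has_row D phi p0 s.
  move=> hs; apply/negP=> /existsP[j /andP[Dj /eqP e]].
  have ne : vx p0 != zz s by rewrite eqv.
  have := sf_lin sfH (phiH _ _ Dj) s1H ne; rewrite in_s1 // e !inE !eqxx ?orbT.
  by move/(_ isT isT isT isT)/setP/(_ (vy j)); rewrite !inE !eqxx.
have col0 s : s = sa k \/ s = sb k -> ~~ has_col D phi q0 s.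
  move=> hs; apply/negP=> /existsP[i /andP[Di /eqP e]].
  have ne : vy q0 != zz s by rewrite eqv.
  have := sf_lin sfH (phiH _ _ Di) s2H ne; rewrite in_s2 // e !inE !eqxx ?orbT.
  by move/(_ isT isT isT isT)/setP/(_ (vx i)); rewrite !inE !eqxx.
have ac_abc : adj H (zz (sa k)) (zz (sb k)) /\ adj H (zz (sb k)) (zz (sc k)).
  split; first by apply: (adj_edge s2H); rewrite ?in_s2 //; [left|right].
  by apply: (adj_edge s1H); rewrite ?in_s1 //; [left|right].
have [adjab adjbc] := ac_abc.
have p0b : adj H (vx p0) (zz (sb k)).
  by apply: (adj_edge s1H); rewrite ?in_s1 ?eqv //; [rewrite !inE eqxx|left].
have q0b : adj H (vy q0) (zz (sb k)).
  by apply: (adj_edge s2H); rewrite ?in_s2 ?eqv //; [rewrite !inE eqxx|right].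
(* If row [i] missed [c], the vertex [vx i] would see [a], [b] and [c'], that is the whole edge
   [c'ab]. *)
have missr i : i != p0 -> exists t, [/\ (t = i0) \/ (t = i1), ~~ has_row D phi i (inr t)
    & forall t', t' != t -> has_row D phi i (inr t')].
  move=> ip; have Di j : D (i, j) := Dp i j ip.
  have [||t [nt all]] := @miss_one k (phi i) k2.
  - by move=> j j'; apply: (lrow i).
  - by move=> l; have /existsP[j /andP[_ /eqP]] := rowl i l; exists j.
  have nrow : ~~ has_row D phi i (inr t).
    by apply/existsPn=> j; rewrite negb_and (nt j) orbT.
  exists t; split=> // [|t' tt']; last first.
    by have [j e] := all t' tt'; apply/existsP; exists j; rewrite Di e eqxx.
  case: (eqVneq t i0) => [|ta]; [by left|]; case: (eqVneq t i1) => [|tb]; [by right|].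
  have ni : vx i \notin [set vy q0; va k; vb k] by rewrite !inE ?(vaE, vbE) !eqv.
  have [u] := sf_sail sfH s2H ni; rewrite !inE -orbA => /or3P[] /eqP-> /andP[_ /negP[]].
  - by rewrite XY (negbTE ip).
  - apply: (has_row_adj (s := sa k) sub); have [|j e] := all i0; first by rewrite eq_sym.
    by apply/existsP; exists j; rewrite Di e eqxx.
  - apply: (has_row_adj (s := sb k) sub); have [|j e] := all i1; first by rewrite eq_sym.
    by apply/existsP; exists j; rewrite Di e eqxx.
(* Dually, if column [j] missed [a], the vertex [vy j] would see the whole edge [a'bc]. *)
have missc j : j != q0 -> exists t, [/\ (t = i1) \/ (t = i2), ~~ has_col D phi j (inr t)
    & forall t', t' != t -> has_col D phi j (inr t')].
  move=> jq; have Dj i : D (i, j) := Dq i j jq.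
  have [||t [nt all]] := @miss_one k (fun i => phi i j) k2.
  - by move=> i i'; apply: lcol.
  - by move=> l; have /existsP[i /andP[_ /eqP]] := coll j l; exists i.
  have ncol : ~~ has_col D phi j (inr t).
    by apply/existsPn=> i; rewrite negb_and (nt i) orbT.
  exists t; split=> // [|t' tt']; last first.
    by have [i e] := all t' tt'; apply/existsP; exists i; rewrite Dj e eqxx.
  case: (eqVneq t i1) => [|tb]; [by left|]; case: (eqVneq t i2) => [|tc]; [by right|].
  have nj : vy j \notin [set vx p0; vb k; vc k] by rewrite !inE ?(vcE, vbE) !eqv.
  have [u] := sf_sail sfH s1H nj; rewrite !inE -orbA => /or3P[] /eqP-> /andP[_ /negP[]].
  - by rewrite adj_sym XY (negbTE jq) andbF.
  - apply: (has_col_adj (s := sb k) sub); have [|i e] := all i1; first by rewrite eq_sym.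
    by apply/existsP; exists i; rewrite Dj e eqxx.
  - apply: (has_col_adj (s := sc k) sub); have [|i e] := all i2; first by rewrite eq_sym.
    by apply/existsP; exists i; rewrite Dj e eqxx.
have col_a j : j != q0 -> has_col D phi j (sa k).
  by case/missc=> t [[]-> _ all]; apply: all.
have row_c i : i != p0 -> has_row D phi i (sc k).
  by case/missr=> t [[]-> _ all]; apply: all.
have rowab i : i != p0 -> has_row D phi i (sb k) = ~~ has_row D phi i (sa k).
  case/missr=> t [[]-> nt all]; first by rewrite nt all.
  by rewrite (negbTE nt) all.
have colbc j : j != q0 -> has_col D phi j (sb k) = ~~ has_col D phi j (sc k).
  case/missc=> t [[]-> nt all]; last by rewrite nt all.
  by rewrite (negbTE nt) all.
have symm_inj (s : symb k) (g : 'I_k -> 'I_k) (S : {set 'I_k}) :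
    (forall i, i \in S -> D (i, g i) /\ phi i (g i) = s) -> {in S &, injective g}.
  move=> gP i i' iS i'S e; have [Di ei] := gP i iS; have [Di' ei'] := gP i' i'S.
  by rewrite -e in Di' ei'; apply: (lcol i i' (g i)); rewrite ?ei.
have symm_inj' (s : symb k) (g : 'I_k -> 'I_k) (S : {set 'I_k}) :
    (forall j, j \in S -> D (g j, j) /\ phi (g j) j = s) -> {in S &, injective g}.
  move=> gP j j' jS j'S e; have [Dj ej] := gP j jS; have [Dj' ej'] := gP j' j'S.
  by rewrite -e in Dj' ej'; apply: (lrow (g j)); rewrite ?ej.
(* Both numbers are the number of cells with symbol [s]. *)
have count (s : symb k) : #|[set i | has_row D phi i s]| = #|[set j | has_col D phi j s]|.
  have exr i : exists j, has_row D phi i s -> D (i, j) && (phi i j == s).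
    by case: (boolP (has_row D phi i s)) => [/existsP[j]|_]; [exists j|exists q0].
  have exc j : exists i, has_col D phi j s -> D (i, j) && (phi i j == s).
    by case: (boolP (has_col D phi j s)) => [/existsP[i]|_]; [exists i|exists p0].
  have [g gP] := fin_all_exists exr; have [g' g'P] := fin_all_exists exc.
  apply/eqP; rewrite eqn_leq; apply/andP; split.
    rewrite -(card_in_imset (f := g) (D := [set i | has_row D phi i s])).
      apply/subset_leq_card/subsetP=> u /imsetP[i iS ->]; rewrite !inE in iS *.
      by apply/existsP; exists i; apply: gP.
    by apply: (symm_inj s) => i; rewrite inE => /gP/andP[-> /eqP].
  rewrite -(card_in_imset (f := g') (D := [set j | has_col D phi j s])).
    apply/subset_leq_card/subsetP=> u /imsetP[j jS ->]; rewrite !inE in jS *.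
    by apply/existsP; exists j; apply: g'P.
  by apply: (symm_inj' s) => j; rewrite inE => /g'P/andP[-> /eqP].
have q0na : ~~ has_col D phi q0 (sa k) by apply: col0; left.
have p0nc : ~~ has_row D phi p0 (sc k) by apply: row0; right.
(* Exactly the column [q0] lacks [a], so by [count] exactly one row lacks it; that row will be [x'].
   In the same way the only column without [c] will be [y']. *)
have rowa1 : #|[set i | ~~ has_row D phi i (sa k)]| = 1.
  have : #|[set j | has_col D phi j (sa k)]| = k - 1.
    have -> : [set j | has_col D phi j (sa k)] = [set~ q0].
      by apply/setP=> j; rewrite !inE; apply/idP/idP=> [|/col_a//]; apply: contraTneq => ->.
    exact: card_ordC1.
  rewrite -count; have := cardsC [set i | has_row D phi i (sa k)]; rewrite card_ord.
  have -> : ~: [set i | has_row D phi i (sa k)] = [set i | ~~ has_row D phi i (sa k)].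
    by apply/setP=> i; rewrite !inE.
  by have := k3; nlia.
have colc1 : #|[set j | ~~ has_col D phi j (sc k)]| = 1.
  have : #|[set i | has_row D phi i (sc k)]| = k - 1.
    have -> : [set i | has_row D phi i (sc k)] = [set~ p0].
      by apply/setP=> i; rewrite !inE; apply/idP/idP=> [|/row_c//]; apply: contraTneq => ->.
    exact: card_ordC1.
  rewrite count; have := cardsC [set i | has_col D phi i (sc k)]; rewrite card_ord.
  have -> : ~: [set i | has_col D phi i (sc k)] = [set i | ~~ has_col D phi i (sc k)].
    by apply/setP=> i; rewrite !inE.
  by have := k3; nlia.
have /cards1P[p1 p1P] : #|[set i | ~~ has_row D phi i (sa k)]| == 1 by rewrite rowa1.
have /cards1P[q1 q1P] : #|[set j | ~~ has_col D phi j (sc k)]| == 1 by rewrite colc1.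
have rowa i : has_row D phi i (sa k) = (i != p1).
  by move/setP/(_ i): p1P; rewrite !inE => <-; rewrite negbK.
have colc j : has_col D phi j (sc k) = (j != q1).
  by move/setP/(_ j): q1P; rewrite !inE => <-; rewrite negbK.
have bE i j : D (i, j) -> phi i j = sb k -> i = p1 /\ j = q1.
  move=> Dij e; have hr : has_row D phi i (sb k) by apply/existsP; exists j; rewrite Dij e eqxx.
  have hc : has_col D phi j (sb k) by apply/existsP; exists i; rewrite Dij e eqxx.
  have ip : i != p0 by apply: contraTneq hr => ->; apply: row0; left.
  have jq : j != q0 by apply: contraTneq hc => ->; apply: col0; right.
  by move: hr hc; rewrite rowab // colbc // rowa colc !negbK => /eqP-> /eqP->.
have k20 : 0 < k - 2 by rewrite subn_gt0.
have k21 : k - 2 < k - 1 by clear -k3; lia.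
have no_inl (I : finType) (S : {set I}) (f : I -> symb k) : #|S| = k - 1 ->
    {in S &, injective f} -> ~ (forall i, i \in S -> exists l, f i = inl l).
  move=> cS finj fl; have ex i : exists l, i \in S -> f i = inl l.
    case: (boolP (i \in S)) => [/fl[l e]|_]; [by exists l|].
    by exists (Ordinal (n := k - 2) (m := 0) k20).
  have [g gP] := fin_all_exists ex.
  have ginj : {in S &, injective g}.
    by move=> i i' iS i'S e; apply: finj => //; rewrite !gP // e.
  have := max_card [set g i | i in S]; by rewrite card_in_imset // cS card_ord leqNgt k21.
(* Otherwise the [k - 1] cells of row [p0] would carry only the [k - 2] symbols [z_l]. *)
have p1p0 : p1 != p0.
  apply/eqP=> e; apply: (@no_inl _ [set~ q0] (phi p0)).
  - exact: card_ordC1.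
  - by move=> j j'; rewrite !inE => jq jq'; apply: lrow; apply: Dq.
  move=> j; rewrite !inE => jq; have Dj := Dq p0 j jq.
  have hr : has_row D phi p0 (phi p0 j) by apply/existsP; exists j; rewrite Dj eqxx.
  case: (symbP (phi p0 j)) => // es; rewrite es in hr.
  - by rewrite rowa e eqxx in hr.
  - by rewrite (negbTE (row0 _ (or_introl erefl))) in hr.
  - by rewrite (negbTE p0nc) in hr.
have q1q0 : q1 != q0.
  apply/eqP=> e; apply: (@no_inl _ [set~ p0] (fun i => phi i q0)).
  - exact: card_ordC1.
  - by move=> i i'; rewrite !inE => ip ip'; apply: lcol; apply: Dp.
  move=> i; rewrite !inE => ip; have Di := Dp i q0 ip.
  have hc : has_col D phi q0 (phi i q0) by apply/existsP; exists i; rewrite Di eqxx.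
  case: (symbP (phi i q0)) => // es; rewrite es in hc.
  - by rewrite (negbTE q0na) in hc.
  - by rewrite (negbTE (col0 _ (or_intror erefl))) in hc.
  - by rewrite colc e eqxx in hc.
have eb : phi p1 q1 = sb k.
  have /existsP[j /andP[Dj /eqP e]] : has_row D phi p1 (sb k) by rewrite rowab // rowa eqxx.
  by have [_ <-] := bE _ _ Dj e.
have Dp0q1 := Dq p0 q1 q1q0; have Dp1q0 := Dp p1 q0 p1p0.
have col_q1b : has_col D phi q1 (sb k) by rewrite colbc // colc eqxx.
have row_p1b : has_row D phi p1 (sb k) by rewrite rowab // rowa eqxx.
exists phi, p1, q1; split=> //; split=> //.
- by rewrite rowa eqxx.
- by rewrite colc eqxx.
(* With [a] in the cell [a'y'], the vertex [b] would see [a'] and [a] on the two special edges and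
   [y'] on the edge of [x'y']. *)
- apply/eqP=> es; case: (@sail_triple _ H p0 q1 (sa k) (zz (sb k)) sfH); rewrite ?inE ?eqv //.
  + by rewrite -es; apply: phiH.
  + by rewrite adj_sym.
  + by rewrite adj_sym; apply: has_col_adj sub _.
  + by rewrite adj_sym.
- apply/eqP=> es; case: (@sail_triple _ H p1 q0 (sc k) (zz (sb k)) sfH); rewrite ?inE ?eqv //.
  + by rewrite -es; apply: phiH.
  + by rewrite adj_sym; apply: has_row_adj sub _.
  + by rewrite adj_sym.
Qed.

End Forward1.

(** * The lower bound *)

Section Example.

Variable k : nat.
Hypothesis k3 : 3 <= k.

Definition diff i j := if i <= j then j - i else j + k - i.

(* Codes 0, 1, 2 stand for a, b, c and [l + 3] for [vz l]: the cyclic square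
   j - i with its diagonals j = i and j = i + 1 recolored. *)
Definition cyclic_code i j :=
  if diff i j == 0 then if i == 1 then 2 else 0
  else if diff i j == 1 then if i == 0 then 0 else if i == 1 then 1 else 2
  else (diff i j).+1.

Ltac case_code := rewrite /cyclic_code /diff; repeat case: ifP; lia.

Lemma code_row i j j' : i < k -> j < k -> j' < k -> ~~ ((i == 0) && (j == 0)) ->
  ~~ ((i == 0) && (j' == 0)) -> cyclic_code i j = cyclic_code i j' -> j = j'.
Proof. clear -k3; case_code. Qed.

Lemma code_col i i' j : i < k -> i' < k -> j < k -> ~~ ((i == 0) && (j == 0)) ->
  ~~ ((i' == 0) && (j == 0)) -> cyclic_code i j = cyclic_code i' j -> i = i'.
Proof. clear -k3; case_code. Qed.

Lemma code_lt i j : i < k -> j < k -> cyclic_code i j < k.+1.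
Proof. clear -k3; case_code. Qed.

Definition symb_code (s : symb k) : nat :=
  match s with inl l => l + 3 | inr t => t end.

Lemma code_symb n : n < k.+1 -> exists s, symb_code s = n.
Proof.
move=> nk; case: (ltnP n 3) => n3; first by exists (inr (Ordinal n3)).
have lt : n - 3 < k - 2 by lia.
by exists (inl (Ordinal lt)); rewrite /= subnK.
Qed.

Let ord_of m (lt : m < 3) : 'I_k := Ordinal (leq_trans lt k3).

(** The two recoloured diagonals form a single cycle of length [2k], on which [a'c'] is the cell
    [(0, 0)] and [x'y'] the cell [(1, 2)]. *)
Lemma type1_exists : exists phi, type1 phi (@ord_of 0 isT) (@ord_of 0 isT)
  (@ord_of 1 isT) (@ord_of 2 isT).
Proof.
have ex (ij : 'I_k * 'I_k) : exists s, symb_code s = cyclic_code ij.1 ij.2.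
  by apply: code_symb; apply: code_lt.
have [f fP] := fin_all_exists ex; pose phi i j := f (i, j).
have phiE i j : symb_code (phi i j) = cyclic_code i j := fP (i, j).
have DE i j : D1 (@ord_of 0 isT) (@ord_of 0 isT) (i, j) = ~~ ((i == 0 :> nat) && (j == 0 :> nat)).
  by [].
have ph s i j : phi i j = s -> cyclic_code i j = symb_code s by move=> <-; rewrite phiE.
exists phi; split; rewrite /has_row /has_col //.
- split=> [i j j'|i i' j]; rewrite !DE => Dij Dij' /(congr1 symb_code); rewrite !phiE => e.
    by apply/val_inj/(code_row _ _ _ Dij Dij' e).
  by apply/val_inj/(code_col _ _ _ Dij Dij' e).
- move=> i j _ /ph /= e; have := ltn_ord i; have := ltn_ord j.
  have [e1 e2] : i = 1 :> nat /\ j = 2 :> nat.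
    by move: e (ltn_ord i) (ltn_ord j); clear -k3; case_code.
  by split; apply: val_inj.
- apply/existsPn=> j; rewrite DE; apply/negP=> /andP[/= nj /eqP/ph/=].
  by move: nj (ltn_ord j); clear -k3; case_code.
- apply/existsPn=> i; rewrite DE; apply/negP=> /andP[/= ni /eqP/ph/=].
  by move: ni (ltn_ord i); clear -k3; case_code.
- apply/existsPn=> j; rewrite DE; apply/negP=> /andP[/= nj /eqP/ph/=].
  by move: nj (ltn_ord j); clear -k3; case_code.
- apply/existsPn=> i; rewrite DE; apply/negP=> /andP[/= ni /eqP/ph/=].
  by move: ni (ltn_ord i); clear -k3; case_code.
- by apply/eqP=> /ph.
- apply/eqP=> /ph; rewrite /cyclic_code /diff /= add0n subn1; clear -k3.
  by case: ifP => [|_]; [lia|case: ifP; lia].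
Qed.

Lemma construction_sharp : exists H : {set {set vertex k}}, sail_free H /\ #|H| = k ^ 2 + 1.
Proof.
have [phi t1] := type1_exists; exists (hyp1 phi (@ord_of 0 isT) (@ord_of 0 isT)); split.
  exact: type1_sail_free t1.
exact: type1_card.
Qed.

End Example.

(** * The sporadic hypergraphs for k = 3 *)

Section Lists.

Variable V : finType.
Implicit Types (L : seq (seq V)) (W : seq V).

Definition hyp_of L : {set {set V}} := [set:: [seq [set:: t] | t <- L]].

Definition list_joined L x y := has (fun t : seq V => (x \in t) && (y \in t)) L.

(* [W] must enumerate all the vertices. *)
Definition list_check L W :=
  [&& uniq L, all (fun t : seq V => uniq t && (size t == 3)) L,
      all (fun t : seq V => all (fun t' : seq V => (t == t') || (size [seq x <- t | x \in t'] <= 1)) L) L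
    & all (fun t : seq V => all (fun w => (w \in t) || has (fun x => ~~ list_joined L w x) t) W) L].

Lemma hyp_ofP L e : reflect (exists2 t, t \in L & e = [set:: t]) (e \in hyp_of L).
Proof. by rewrite inE; apply: mapP. Qed.

Lemma list_check_sail_free L W : (forall w, w \in W) -> list_check L W ->
  sail_free (hyp_of L) /\ #|hyp_of L| = size L.
Proof.
move=> allW /and4P[uL /allP s3 /allP lin /allP sail].
have card3 t : t \in L -> #|[set:: t]| = 3.
  by move=> tL; have /andP[ut /eqP <-] := s3 t tL; rewrite cardsE (card_uniqP _).
have linL t t' x y : t \in L -> t' \in L -> x != y -> x \in t -> y \in t ->
    x \in t' -> y \in t' -> t = t'.
  move=> tL t'L xy xt yt xt' yt'; have /allP/(_ t' t'L) := lin t tL.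
  case/orP=> [/eqP //|]; rewrite leqNgt => /negP[].
  have : uniq [:: x; y] by rewrite /= inE xy.
  by move/uniq_leq_size; apply=> z; rewrite !inE mem_filter => /orP[] /eqP->;
    rewrite ?xt ?yt ?xt' ?yt'.
split; last first.
  rewrite cardsE (card_uniqP _) ?size_map // map_inj_in_uniq // => t t' tL t'L e.
  have /card_gt1P[x [y []]] : 1 < #|[set:: t]| by rewrite card3.
  rewrite inE => xt; rewrite inE => yt xy; apply: (linL t t' x y) => //.
    by have := xt; rewrite -[x \in t](inE) e inE.
  by have := yt; rewrite -[y \in t](inE) e inE.
split.
- by move=> e /hyp_ofP[t tL ->]; apply: card3.
- move=> e f x y /hyp_ofP[t tL ->] /hyp_ofP[t' t'L ->] xy; rewrite !inE => xt yt xt' yt'.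
  by rewrite (linL t t' x y).
move=> e w /hyp_ofP[t tL ->]; rewrite inE => wt.
have /allP/(_ w (allW w)) := sail t tL; rewrite (negbTE wt) /=.
case/hasP=> x xt nj; exists x; first by rewrite inE.
rewrite in_co.
have wx : w != x by apply: contraNneq wt => ->.
rewrite wx; apply: contra nj => /adjP[_ [f [/hyp_ofP[t' t'L ->]]]].
by rewrite !inE => wt' xt'; apply/hasP; exists t'; rewrite ?wt'.
Qed.

End Lists.

Definition sporadic_vertices : seq (vertex 3) :=
  [:: vx i0; vx i1; vx i2; vy i0; vy i1; vy i2; va 3; vb 3; vc 3; vv].

Lemma ord3P (i : 'I_3) : [\/ i = i0, i = i1 | i = i2].
Proof.
case: i => -[|[|[|m]]] lt //; [apply: Or31|apply: Or32|apply: Or33]; exact: val_inj.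
Qed.

Lemma mem_sporadic w : w \in sporadic_vertices.
Proof.
case: w => [[[i|i]|l]|i]; try by case: (ord3P i) => ->.
by case: l => -[|m].
Qed.

(** [s] and [t] list the colours of the edges of the two triangles in cyclic order. *)
Definition prism_list (s t : 'I_3 * 'I_3 * 'I_3) : seq (seq (vertex 3)) :=
  [:: [:: vv; vx i0; vy i0]; [:: vv; vx i1; vy i1]; [:: vv; vx i2; vy i2];
      [:: vabc 3 s.1.1; vx i0; vx i1]; [:: vabc 3 s.1.2; vx i1; vx i2];
      [:: vabc 3 s.2; vx i2; vx i0];
      [:: vabc 3 t.1.1; vy i0; vy i1]; [:: vabc 3 t.1.2; vy i1; vy i2];
      [:: vabc 3 t.2; vy i2; vy i0]; [:: va 3; vb 3; vc 3]].

Definition uniq3 (s : 'I_3 * 'I_3 * 'I_3) := uniq [:: s.1.1; s.1.2; s.2].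

(** The colourings of the two triangles are independent of each other, so all pairs are checked by
    computation. *)
Lemma prism_list_check s t : uniq3 s -> uniq3 t -> list_check (prism_list s t) sporadic_vertices.
Proof.
move: s t => [[s0 s1] s2] [[t0 t1] t2].
have : all (fun s => all (fun t => (uniq3 s && uniq3 t) ==>
    list_check (prism_list s t) sporadic_vertices)
  [seq (p, c) | p <- [seq (a, b) | a <- [:: i0; i1; i2], b <- [:: i0; i1; i2]], c <- [:: i0; i1; i2]])
  [seq (p, c) | p <- [seq (a, b) | a <- [:: i0; i1; i2], b <- [:: i0; i1; i2]], c <- [:: i0; i1; i2]].
  by vm_compute.
have mem3 (a : 'I_3) : a \in [:: i0; i1; i2] by case: (ord3P a) => ->.
have mem (a b c : 'I_3) : (a, b, c) \in
    [seq (p, c) | p <- [seq (a, b) | a <- [:: i0; i1; i2], b <- [:: i0; i1; i2]], c <- [:: i0; i1; i2]].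
  by apply: allpairs_f => //; apply: allpairs_f.
move/allP/(_ _ (mem s0 s1 s2))/allP/(_ _ (mem t0 t1 t2))/implyP => H us ut.
by apply: H; rewrite us.
Qed.

Section ListScheme.

Variables (U V : eqType) (g : U -> V).

(** The type is a parameter so that one list describes both the hypergraph on [vertex 3] and its
    image under a labelling. *)
Definition scheme4 (T : Type) (a b c v x0 x1 x2 y0 y1 y2 m0 m1 m2 : T) : seq (seq T) :=
  [:: [:: a; y0; y1]; [:: a; x0; x1]; [:: b; x1; x2]; [:: c; y0; y2]; [:: c; x0; x2];
      [:: v; x0; m0]; [:: v; x1; m1]; [:: v; x2; m2]; [:: a; b; y2]; [:: b; c; y1]].

Lemma map_scheme4 a b c v x0 x1 x2 y0 y1 y2 m0 m1 m2 :
  map (map g) (scheme4 a b c v x0 x1 x2 y0 y1 y2 m0 m1 m2) =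
  scheme4 (g a) (g b) (g c) (g v) (g x0) (g x1) (g x2) (g y0) (g y1) (g y2) (g m0) (g m1) (g m2).
Proof. by []. Qed.

End ListScheme.

Definition list4 (m0 m1 m2 : 'I_3) : seq (seq (vertex 3)) :=
  scheme4 (va 3) (vb 3) (vc 3) vv (vx i0) (vx i1) (vx i2) (vy i0) (vy i1) (vy i2)
    (vy m0) (vy m1) (vy m2).

Lemma list4_check : [&& list_check (list4 i0 i1 i2) sporadic_vertices,
  list_check (list4 i1 i0 i2) sporadic_vertices &
  list_check (list4 i2 i1 i0) sporadic_vertices].
Proof. by vm_compute. Qed.

Lemma extend1 (V : finType) (w : V) (e : {set V}) : extend w [set e] = [set w |: e].
Proof. exact: imset_set1. Qed.

Lemma extendU (V : finType) (w : V) (M N : {set {set V}}) :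
  extend w (M :|: N) = extend w M :|: extend w N.
Proof. exact: imsetU. Qed.

Lemma set_ord3 (T : finType) (f : 'I_3 -> T) : [set f i | i : 'I_3] = [set f i0; f i1; f i2].
Proof.
apply/setP=> u; rewrite !inE -orbA; apply/imsetP/or3P => [[i _ ->]|[] /eqP->].
- by case: (ord3P i) => ->; rewrite eqxx; [apply: Or31|apply: Or32|apply: Or33].
- by exists i0.
- by exists i1.
- by exists i2.
Qed.

Lemma setU1_pair (V : finType) (w x y : V) : w |: [set x; y] = [set:: [:: w; x; y]].
Proof. by apply/setP=> u; rewrite !inE. Qed.

Lemma set3_seq (V : finType) (w x y : V) : [set w; x; y] = [set:: [:: w; x; y]].
Proof. by apply/setP=> u; rewrite !inE orbA. Qed.

Lemma hyp_of_cons (V : finType) (t : seq V) L : hyp_of (t :: L) = [set:: t] |: hyp_of L.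
Proof. by apply/setP=> e; rewrite in_setU1 !in_set. Qed.

Lemma hyp_of_nil (V : finType) : hyp_of (Nil (seq V)) = set0.
Proof. by apply/setP=> e; rewrite !inE. Qed.

Definition hyp_ofE := (hyp_of_cons, hyp_of_nil, setU0).

Lemma pairs_hyp_of (V : finType) (a b c v x0 x1 x2 y0 y1 y2 m0 m1 m2 : V) :
  extend a [set [set y0; y1]; [set x0; x1]] :|: extend b [set [set x1; x2]]
    :|: extend c [set [set y0; y2]; [set x0; x2]]
    :|: extend v [set [set x0; m0]; [set x1; m1]; [set x2; m2]]
    :|: [set [set a; b; y2]; [set b; c; y1]]
  = hyp_of (scheme4 a b c v x0 x1 x2 y0 y1 y2 m0 m1 m2).
Proof. by rewrite !extendU !extend1 !(@setU1_pair V) !(@set3_seq V) !hyp_ofE !setUA. Qed.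

Lemma construction4E H : construction4 H <->
  [\/ H = hyp_of (list4 i0 i1 i2), H = hyp_of (list4 i1 i0 i2) | H = hyp_of (list4 i2 i1 i0)].
Proof.
have E m0 m1 m2 : extend (va 3) [set [set vy i0; vy i1]; [set vx i0; vx i1]]
    :|: extend (vb 3) [set [set vx i1; vx i2]]
    :|: extend (vc 3) [set [set vy i0; vy i2]; [set vx i0; vx i2]]
    :|: extend vv [set [set vx i0; vy m0]; [set vx i1; vy m1]; [set vx i2; vy m2]]
    :|: [set [set va 3; vb 3; vy i2]; [set vb 3; vc 3; vy i1]] = hyp_of (list4 m0 m1 m2).
  exact: pairs_hyp_of.
have E' : [set [set vx i0; vy i2]; [set vx i2; vy i0]; [set vx i1; vy i1]] =
    [set [set vx i0; vy i2]; [set vx i1; vy i1]; [set vx i2; vy i0]] :> {set {set vertex 3}}.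
  by rewrite setUAC.
split=> [[Mv [] ->]|].
- by apply: Or31; apply: E.
- by apply: Or32; apply: E.
- by apply: Or33; rewrite E'; apply: E.
case=> ->; rewrite -E; apply: Construction4; [apply: Or31|apply: Or32|apply: Or33] => //.
Qed.

Section Triangles.

Variable f : 'I_3 -> vertex 3.
Hypothesis f_inj : injective f.

Definition tri_edge i : {set vertex 3} := [set f i; f (ordS i)].

Lemma ordS_neq (i : 'I_3) : ordS i != i.
Proof. by case: (ord3P i) => ->. Qed.

Lemma mem_tri i j : (f j \in tri_edge i) = (j == i) || (j == ordS i).
Proof. by rewrite !inE !(inj_eq f_inj). Qed.

Lemma tri_edge_inj : injective tri_edge.
Proof.
move=> i j /setP e; have := e (f i); have := e (f j); rewrite !mem_tri !eqxx /=.
by case: (ord3P i) => ->; case: (ord3P j) => ->.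
Qed.

Lemma tri_edge_meet i j : exists u, u \in tri_edge i /\ u \in tri_edge j.
Proof.
case: (ord3P i) => ->; case: (ord3P j) => ->;
by first [ exists (f i0); rewrite !mem_tri; split; done
         | exists (f i1); rewrite !mem_tri; split; done
         | exists (f i2); rewrite !mem_tri; split; done].
Qed.

End Triangles.

Local Notation xe := (tri_edge (@vx 3)).
Local Notation ye := (tri_edge (@vy 3)).

Lemma vx_inj k : injective (@vx k). Proof. by move=> i j []. Qed.
Lemma vy_inj k : injective (@vy k). Proof. by move=> i j []. Qed.

Lemma xe_ye_disjoint i j : [disjoint xe i & ye j].
Proof.
apply/pred0P=> u; apply/negP=> /andP[]; rewrite /= !inE.
by case/orP=> /eqP->.
Qed.

Lemma xe_neq_ye i j : xe i != ye j.
Proof.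
apply/eqP=> e; have := xe_ye_disjoint i j; rewrite e => /pred0P/(_ (vy j)).
by rewrite /= !inE eqxx.
Qed.

Lemma prism_diff : prism :\: prism_matching = [set xe i | i : 'I_3] :|: [set ye i | i : 'I_3].
Proof.
have S0 : ordS i0 = i1 by apply: val_inj.
have S1 : ordS i1 = i2 by apply: val_inj.
have S2 : ordS i2 = i0 by apply: val_inj.
have -> : prism = [set xe i | i : 'I_3] :|: [set ye i | i : 'I_3] :|: prism_matching.
  by rewrite (set_ord3 (tri_edge _)) (set_ord3 (tri_edge _)) /tri_edge S0 S1 S2 !setUA.
rewrite setDUl setDv setU0; apply/setDidPl/pred0P=> e; apply/negP=> /andP[/= eT].
case/imsetP=> j _ ej; move: eT; rewrite inE => /orP[] /imsetP[i _ ei]; rewrite ei in ej.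
  by have : vy j \in xe i by [rewrite ej !inE eqxx orbT]; rewrite !inE.
by have : vx j \in ye i by [rewrite ej !inE eqxx]; rewrite !inE.
Qed.

Lemma prism_list_gen (V : finType) (v a b c s0 s1 s2 t0 t1 t2 x0 x1 x2 y0 y1 y2 : V) :
  extend v [set [set x0; y0]; [set x1; y1]; [set x2; y2]]
    :|: ([set s0 |: [set x0; x1]; s1 |: [set x1; x2]; s2 |: [set x2; x0]]
    :|: [set t0 |: [set y0; y1]; t1 |: [set y1; y2]; t2 |: [set y2; y0]])
    :|: [set [set a; b; c]] =
  hyp_of [:: [:: v; x0; y0]; [:: v; x1; y1]; [:: v; x2; y2];
      [:: s0; x0; x1]; [:: s1; x1; x2]; [:: s2; x2; x0];
      [:: t0; y0; y1]; [:: t1; y1; y2]; [:: t2; y2; y0]; [:: a; b; c]].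
Proof. by rewrite !extendU !extend1 !(@setU1_pair V) !(@set3_seq V) !hyp_ofE !setUA. Qed.

Lemma prism_listE (s t : 'I_3 -> 'I_3) :
  extend vv prism_matching
    :|: ([set vabc 3 (s i) |: xe i | i : 'I_3] :|: [set vabc 3 (t i) |: ye i | i : 'I_3])
    :|: [set [set va 3; vb 3; vc 3]]
  = hyp_of (prism_list (s i0, s i1, s i2) (t i0, t i1, t i2)).
Proof.
have S0 : ordS i0 = i1 by apply: val_inj.
have S1 : ordS i1 = i2 by apply: val_inj.
have S2 : ordS i2 = i0 by apply: val_inj.
rewrite /prism_matching !set_ord3 /tri_edge S0 S1 S2.
exact: prism_list_gen.
Qed.

Lemma colored_prism (M : 'I_3 -> {set {set vertex 3}}) (s t : 'I_3 -> 'I_3) :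
    (forall c e, reflect (exists i, (e = xe i /\ s i = c) \/ (e = ye i /\ t i = c)) (e \in M c)) ->
  extend vv prism_matching :|: \bigcup_i extend (vabc 3 i) (M i)
    :|: [set [set va 3; vb 3; vc 3]]
  = hyp_of (prism_list (s i0, s i1, s i2) (t i0, t i1, t i2)).
Proof.
move=> MP; rewrite -prism_listE; congr (_ :|: _ :|: _).
apply/setP=> e; rewrite inE; apply/bigcupP/orP => [[c _ /imsetP[f /MP fM ->]]|].
  by case: fM => i [[-> <-]|[-> <-]]; [left|right]; apply: imset_f.
case=> /imsetP[i _ ->]; [exists (s i)|exists (t i)] => //; apply: imset_f; apply/MP;
  by exists i; first [by left | by right].
Qed.

Lemma uniq3_inj (s : 'I_3 -> 'I_3) : injective s -> uniq3 (s i0, s i1, s i2).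
Proof. by move=> sI; rewrite /uniq3 /= !inE !(inj_eq sI). Qed.

Lemma construction3_list H : construction3 H ->
  exists s t, [/\ uniq3 s, uniq3 t & H = hyp_of (prism_list s t)].
Proof.
case=> M [MU Mdis] Mm.
(* Edges of a triangle pairwise meet, so no two of them lie in the same matching; the colouring [s]
   of the triangle is therefore injective. *)
have colored f : injective f -> (forall i, tri_edge f i \in prism :\: prism_matching) ->
    exists2 s, injective s & forall i c, (tri_edge f i \in M c) = (s i == c).
  move=> fI fP; have ex i : exists c, tri_edge f i \in M c.
    by have := fP i; rewrite -MU => /bigcupP[c _]; exists c.
  have [s sP] := fin_all_exists ex; exists s => [i j e|i c].
    apply/eqP; apply: contraT => ij; have [/trivIsetP tr _] := Mm (s i).
    have [u [ui uj]] := tri_edge_meet fI i j.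
    have := tr _ _ (sP i); rewrite e => /(_ _ (sP j)); rewrite (inj_eq (tri_edge_inj fI)) ij.
    by move/(_ isT)/pred0P/(_ u); rewrite /= ui uj.
  apply/idP/eqP=> [ic|<- //]; apply/eqP; apply: contraT => /Mdis/pred0P/(_ (tri_edge f i)).
  by rewrite /= sP ic.
have [||s sI sP] := colored (@vx 3); first exact: vx_inj.
  by move=> i; rewrite prism_diff inE imset_f.
have [||t tI tP] := colored (@vy 3); first exact: vy_inj.
  by move=> i; rewrite prism_diff inE imset_f ?orbT.
exists (s i0, s i1, s i2), (t i0, t i1, t i2); split; try exact: uniq3_inj.
apply: colored_prism => c e; apply: (iffP idP) => [eM|].
  have : e \in \bigcup_i M i by apply/bigcupP; exists c.
  rewrite MU prism_diff inE => /orP[] /imsetP[i _ ei]; exists i; [left|right]; split=> //.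
    by apply/eqP; rewrite -sP -ei.
  by apply/eqP; rewrite -tP -ei.
by case=> i [[-> <-]|[-> <-]]; rewrite ?sP ?tP.
Qed.

Lemma list_construction3 (s t : 'I_3 -> 'I_3) : injective s -> injective t ->
  construction3 (hyp_of (prism_list (s i0, s i1, s i2) (t i0, t i1, t i2))).
Proof.
move=> sI tI; have [s' sK s'K] := injF_bij sI; have [t' tK t'K] := injF_bij tI.
pose M c : {set {set vertex 3}} := [set xe (s' c); ye (t' c)].
have MP c e : reflect (exists i, (e = xe i /\ s i = c) \/ (e = ye i /\ t i = c)) (e \in M c).
  rewrite !inE; apply: (iffP orP) => [[/eqP->|/eqP->]|[i [[-> <-]|[-> <-]]]].
  - by exists (s' c); left.
  - by exists (t' c); right.
  - by left; rewrite sK.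
  - by right; rewrite tK.
rewrite -(colored_prism MP); apply: Construction3; first split.
- rewrite prism_diff; apply/setP=> e; rewrite inE; apply/bigcupP/orP => [[c _ /MP]|].
    by case=> i [[-> _]|[-> _]]; [left|right]; apply: imset_f.
  case=> /imsetP[i _ ->]; [exists (s i)|exists (t i)] => //; apply/MP;
    by exists i; first [by left | by right].
- move=> c d cd; apply/pred0P=> e; apply/negP=> /andP[/= /MP[i ei] /MP[j ej]].
  case: ei => -[ei si]; case: ej => -[ej sj]; rewrite ei in ej.
  + by rewrite -si -sj (tri_edge_inj (@vx_inj 3) ej) eqxx in cd.
  + by have := xe_neq_ye i j; rewrite ej eqxx.
  + by have := xe_neq_ye j i; rewrite ej eqxx.
  + by rewrite -si -sj (tri_edge_inj (@vy_inj 3) ej) eqxx in cd.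
move=> c; split; last by rewrite cards2 xe_neq_ye.
apply/trivIsetP=> e f; rewrite !inE => /orP[] /eqP-> /orP[] /eqP->; rewrite ?eqxx // => _.
  exact: xe_ye_disjoint.
by rewrite disjoint_sym xe_ye_disjoint.
Qed.

Lemma hyp_of_eq (V : finType) (L : seq (seq V)) (H : {set {set V}}) :
  all (fun t : seq V => [set:: t] \in H) L -> #|hyp_of L| = #|H| -> H = hyp_of L.
Proof.
move/allP=> LH cLH; apply/esym/eqP; rewrite eqEcard cLH leqnn andbT.
by apply/subsetP=> e /hyp_ofP[t tL ->]; apply: LH.
Qed.

Lemma hyp_of_pull (U V : finType) (L : seq (seq U)) (H : {set {set U}}) (E : {set {set V}})
    (g : U -> V) : (forall t, ([set:: t] \in H) = ([set:: map g t] \in E)) ->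
  all (fun t : seq V => [set:: t] \in E) (map (map g) L) -> #|hyp_of L| = #|H| ->
  H = hyp_of L.
Proof.
move=> memH LE; apply: hyp_of_eq; apply: etrans LE; rewrite all_map.
by apply: eq_all => t; rewrite /= memH.
Qed.

Lemma pull_list (V : finType) (E : {set {set V}}) (l : seq V) :
    #|V| = 10 -> uniq l -> size l = 10 ->
  exists (H : {set {set vertex 3}}) g, [/\ isomorphic H E, sail_free E -> sail_free H,
    #|H| = #|E|, map g sporadic_vertices = l
  & (forall t, ([set:: t] \in H) = ([set:: map g t] \in E)) /\
    forall x y, adj H x y = adj E (g x) (g y)].
Proof.
case: l => // v0 l V10 ul sl; pose g u := nth v0 (v0 :: l) (index u sporadic_vertices).
have lt u : index u sporadic_vertices < size (v0 :: l).
  by rewrite sl (_ : 10 = size sporadic_vertices) // index_mem mem_sporadic.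
have gI : injective g.
  move=> u u' /eqP; rewrite nth_uniq // => /eqP e.
  by rewrite -(nth_index vv (mem_sporadic u)) e nth_index // mem_sporadic.
have [|H [iso sfH cH memH adjH]] := @pullback V (vertex 3) g E.
  by apply: inj_card_bij; rewrite // card_vertex // V10.
exists H, g; split=> //; last first.
  split=> // t; rewrite memH; congr (_ \in E); apply/setP=> u; rewrite inE.
  by apply/imsetP/mapP => -[w]; rewrite ?inE => wt ->; exists w; rewrite ?inE.
apply: (@eq_from_nth _ v0) => [|i]; rewrite size_map ?sl // => i10.
by rewrite (nth_map vv) // /g index_uniq.
Qed.

Lemma list4_card : [/\ #|hyp_of (list4 i0 i1 i2)| = 10, #|hyp_of (list4 i1 i0 i2)| = 10
  & #|hyp_of (list4 i2 i1 i0)| = 10].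
Proof.
have /and3P[c1 c2 c3] := list4_check.
have [_ e1] := list_check_sail_free mem_sporadic c1.
have [_ e2] := list_check_sail_free mem_sporadic c2.
have [_ e3] := list_check_sail_free mem_sporadic c3.
by split; [exact: e1|exact: e2|exact: e3].
Qed.

Lemma forward4 (V : finType) (E : {set {set V}}) : large E 3 -> outcome4 E ->
  exists2 H, construction4 H & isomorphic H E.
Proof.
move=> lE [x0 [x1 [x2 [y0 [y1 [y2 [a [b [c [v [ul [abE bcE] [ayE cyE] [axE bxE cxE] mates]]]]]]]]]]].
have [H [g [iso _ cH [gx0 gx1 gx2 gy0 gy1 gy2 ga gb gc gv] [memH _]]]] :=
  pull_list E (large_V lE) ul erefl.
exists H => //; apply/construction4E.
have H10 : #|H| = 10 by rewrite cH (card_extremal lE).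
have [c1 c2 c3] := list4_card.
case: mates => -[m1 m2 m3].
- apply: Or31; apply: (hyp_of_pull memH _ (etrans c1 (esym H10))).
  rewrite map_scheme4 ga gb gc gv gx0 gx1 gx2 gy0 gy1 gy2 /= -!set3_seq.
  by rewrite ayE axE bxE cyE cxE m1 m2 m3 abE bcE.
- apply: Or32; apply: (hyp_of_pull memH _ (etrans c2 (esym H10))).
  rewrite map_scheme4 ga gb gc gv gx0 gx1 gx2 gy0 gy1 gy2 /= -!set3_seq.
  by rewrite ayE axE bxE cyE cxE m1 m2 m3 abE bcE.
- apply: Or33; apply: (hyp_of_pull memH _ (etrans c3 (esym H10))).
  rewrite map_scheme4 ga gb gc gv gx0 gx1 gx2 gy0 gy1 gy2 /= -!set3_seq.
  by rewrite ayE axE bxE cyE cxE m1 m2 m3 abE bcE.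
Qed.

(** Take the edge through two vertices of a triangle. Its third vertex is not [v], whose edges there
    are known, and not a vertex of the prism, for [v] would then see the whole edge; so it is [a],
    [b] or [c]. By linearity the three edges of a triangle get distinct colours, and the ten known
    edges exhaust [H]. *)
Lemma prism_forward (H : {set {set vertex 3}}) : sail_free H -> #|H| = 10 ->
    (forall i, [set vv; vx i; vy i] \in H) -> [set va 3; vb 3; vc 3] \in H ->
    (forall i j, i != j -> adj H (vx i) (vx j)) ->
    (forall i j, i != j -> adj H (vy i) (vy j)) ->
  construction3 H.
Proof.
move=> sfH H10 vH abcH xx yy.
have adjv i : adj H vv (vx i) /\ adj H vv (vy i).
  by split; apply: (adj_edge (vH i)); rewrite // !inE eqxx ?orbT.
have colored (f : 'I_3 -> vertex 3) : injective f ->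
    (forall i t, f i != vabc 3 t) -> (forall i, [/\ adj H vv (f i), f i != vv & exists2 u, u != f i & [set vv; f i; u] \in H /\
      forall j, u != f j]) ->
    (forall i j, i != j -> adj H (f i) (f j)) ->
    (forall u, u != vv -> (forall t, u != vabc 3 t) -> adj H vv u) ->
  exists2 s : 'I_3 -> 'I_3, injective s & forall i, vabc 3 (s i) |: tri_edge f i \in H.
  move=> fI fabc vf ff vu.
  have ex i : exists t, vabc 3 t |: tri_edge f i \in H.
    have /adjP[ne [e [eH ie je]]] : adj H (f i) (f (ordS i)).
      by apply: ff; rewrite eq_sym ordS_neq.
    have [z [zi zj ee]] := card3P (sf_card sfH eH) ne ie je.
    have ze : z \in e by rewrite ee !inE eqxx !orbT.
    have [vi ivv [u ui [uH uf]]] := vf i; have [vj jvv _] := vf (ordS i).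
    have zv : z != vv.
      apply: contraTneq uH => ez; apply/negP=> uH.
      have : [set vv; f i; u] = e.
        apply: (sf_lin sfH uH eH (x := vv) (y := f i)); rewrite ?inE ?eqxx ?orbT -?ez //.
      move/setP/(_ (f (ordS i))); rewrite je !inE (negbTE jvv) (inj_eq fI).
      by rewrite (negbTE (ordS_neq i)) eq_sym (negbTE (uf _)).
    case: (boolP [exists t, z == vabc 3 t]) => [/existsP[t /eqP zt]|/existsPn nz].
      by exists t; rewrite -zt setUC /tri_edge -ee.
    have ve : vv \notin e.
      by rewrite ee !inE !negb_or !(eq_sym vv) ivv jvv zv.
    have [w we] := sf_sail sfH eH ve; rewrite in_co => /andP[_ /negP[]].
    move: we; rewrite ee !inE -orbA => /or3P[] /eqP-> //.
    exact: vu.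
  have [s sP] := fin_all_exists ex; exists s => // i j e.
  have [u [ui uj]] := tri_edge_meet fI i j.
  have nf t i' : vabc 3 t \notin tri_edge f i'.
    by rewrite !inE negb_or !(eq_sym (vabc 3 t)) !fabc.
  have us : u != vabc 3 (s i) by apply: contraTneq ui => ->; apply: nf.
  have := sf_lin sfH (sP i) (sP j) us (setU1r _ ui) (setU11 _ _) (setU1r _ uj).
  rewrite e => /(_ (setU11 _ _)) E; apply: (tri_edge_inj fI).
  by rewrite -(setU1K (nf (s j) i)) E setU1K.
have vu u : u != vv -> (forall t, u != vabc 3 t) -> adj H vv u.
  case: u => [[[i|i]|l]|t] uv ut; [exact: (adjv i).1|exact: (adjv i).2| |].
    by case/eqP: uv; case: l {ut} => -[|m] lt //; congr (inl (inr _)); apply: val_inj.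
  by have := ut t; rewrite eqxx.
have [|i|s sI sP] := colored (@vx 3) (@vx_inj 3) _ _ xx vu.
- by [].
- by split=> //; [exact: (adjv i).1|exists (vy i)].
have [|i|t tI tP] := colored (@vy 3) (@vy_inj 3) _ _ yy vu.
- by [].
- by split=> //; [exact: (adjv i).2|exists (vx i); rewrite // setUAC].
have check := prism_list_check (uniq3_inj sI) (uniq3_inj tI).
have [_ c10] := list_check_sail_free mem_sporadic check.
rewrite (_ : H = hyp_of (prism_list (s i0, s i1, s i2) (t i0, t i1, t i2))).
  exact: list_construction3.
apply/esym/eqP; rewrite eqEcard c10 H10 leqnn andbT -prism_listE.
apply/subsetP=> e; rewrite !in_setU -!orbA in_set1.
case/or4P=> [/imsetP[_ /imsetP[i _ ->] ->]|/imsetP[i _ ->]|/imsetP[i _ ->]|/eqP-> //].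
- by rewrite setUA.
- exact: sP.
- exact: tP.
Qed.

Lemma forward3 (V : finType) (E : {set {set V}}) : large E 3 -> outcome3 E ->
  exists2 H, construction3 H & isomorphic H E.
Proof.
move=> lE [x0 [x1 [x2 [y0 [y1 [y2 [a [b [c [v [ul [m0 m1 m2] abcE [x01 x02 x12] [y01 y02 y12]]]]]]]]]]]].
have [H [g [iso sfH cH [gx0 gx1 gx2 gy0 gy1 gy2 ga gb gc gv] [memH adjH]]]] :=
  pull_list E (large_V lE) ul erefl.
exists H => //; apply: prism_forward.
- exact: sfH (large_sf lE).
- by rewrite cH (card_extremal lE).
- by move=> i; rewrite set3_seq memH /= gv; case: (ord3P i) => ->;
    rewrite ?(gx0, gy0, gx1, gy1, gx2, gy2) -set3_seq.
- by rewrite set3_seq memH /= ga gb gc -set3_seq.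
- by move=> i j; rewrite adjH; case: (ord3P i) => ->; case: (ord3P j) => -> // _;
    rewrite ?(gx0, gx1, gx2) // adj_sym.
by move=> i j; rewrite adjH; case: (ord3P i) => ->; case: (ord3P j) => -> // _;
  rewrite ?(gy0, gy1, gy2) // adj_sym.
Qed.

(** * The theorem *)

Lemma construction1_sound k (H : {set {set vertex k}}) : construction1 H ->
  sail_free H /\ #|H| = k ^ 2 + 1.
Proof.
case/construction1_type1=> phi [p0 [q0 [p1 [q1 [t1 ->]]]]].
by split; [apply: type1_sail_free t1|apply: type1_card].
Qed.

Lemma construction2_sound k (H : {set {set vertex k}}) : construction2 H ->
  sail_free H /\ #|H| = k ^ 2 + 1.
Proof.
case/construction2_type2=> phi [t2 ->].
by split; [apply: type2_sail_free t2|apply: type2_card].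
Qed.

Lemma construction3_sound H : construction3 H -> sail_free H /\ #|H| = 3 ^ 2 + 1.
Proof.
case/construction3_list=> s [t [us ut ->]].
exact: list_check_sail_free mem_sporadic (prism_list_check us ut).
Qed.

Lemma construction4_sound H : construction4 H -> sail_free H /\ #|H| = 3 ^ 2 + 1.
Proof.
have /and3P[c1 c2 c3] := list4_check; case/construction4E=> ->.
- exact: list_check_sail_free mem_sporadic c1.
- exact: list_check_sail_free mem_sporadic c2.
- exact: list_check_sail_free mem_sporadic c3.
Qed.

(** A hypergraph with more edges would still be [large], and [card_extremal] fixes the number of
    edges of those. *)
Lemma sail_free_bound (V : finType) (E : {set {set V}}) k : 3 <= k -> #|V| = 3 * k + 1 ->
  sail_free E -> #|E| <= k ^ 2 + 1.
Proof.
move=> k3 Vk sfE; rewrite leqNgt; apply/negP=> E_large.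
by move: (E_large); rewrite (card_extremal (Large sfE k3 Vk (ltnW E_large))) ltnn.
Qed.

Lemma ex_lin_sail k : 3 <= k -> ex_lin (3 * k + 1) sail = k ^ 2 + 1.
Proof.
move=> k3; apply/eqP; rewrite eqn_leq; apply/andP; split.
  apply/bigmax_leqP=> E /sail_freeP sfE.
  by apply: sail_free_bound => //; rewrite card_ord.
have [H [sfH cH]] := construction_sharp k3.
have cV : #|vertex k| = 3 * k + 1 by apply: card_vertex; apply: ltnW.
pose g (u : vertex k) := cast_ord cV (enum_rank u).
have gI : injective g by move=> u v /cast_ord_inj/enum_rank_inj.
have gB : bijective g by apply: inj_card_bij; rewrite // card_ord cV.
have [|sfE cE] := @isomorphic_sail_free _ _ H (image_hyp g H) _ sfH.
  by exists g.
by rewrite -cH -cE; apply: (leq_bigmax_cond (F := fun E : {set {set 'I_(3 * k + 1)}} => #|E|)); apply/sail_freeP.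
Qed.

Theorem theorem1 (k : nat) (hk : 3 <= k) :
  ex_lin (3 * k + 1) sail = k ^ 2 + 1 /\
  (forall (V : finType) (E : {set {set V}}), #|V| = 3 * k + 1 ->
     (extremal sail E <->
      [\/ exists2 H, @construction1 k H & isomorphic H E,
          exists2 H, @construction2 k H & isomorphic H E,
          k = 3 /\ (exists2 H, construction3 H & isomorphic H E)
        | k = 3 /\ (exists2 H, construction4 H & isomorphic H E)])).
Proof.
split=> [|V E Vk]; first exact: ex_lin_sail.
have extremalP : extremal sail E <-> sail_free E /\ #|E| = k ^ 2 + 1.
  rewrite /extremal Vk ex_lin_sail //; split.
    by case/and4P=> u l c /eqP cE; split=> //; apply/sail_freeP; rewrite u l.
  by case=> /sail_freeP/and3P[-> -> ->] ->; rewrite eqxx.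
have sound (W : finType) (H : {set {set W}}) : sail_free H /\ #|H| = k ^ 2 + 1 ->
    isomorphic H E -> extremal sail E.
  move=> [sfH cH] iso; apply/extremalP.
  by have [sfE ->] := isomorphic_sail_free iso sfH.
split=> [/extremalP[sfE cE]|].
  have lE : large E k by split; rewrite ?cE.
  case: (structure_cases lE) => [o1|o2|[k3 o3]|[k3 o4]].
  - have [H [p0 [q0 [iso par XY [s1H s2H]]]]] := pull_outcome1 lE o1.
    have [phi [p1 [q1 [HE t1 eb rowl coll]]]] := forward1_type1 hk par XY s1H s2H.
    apply: Or41; exists H; rewrite // HE; exact: type1_construction1 (ltnW hk) t1 eb rowl coll.
  - have [H [iso par XY abcH]] := pull_outcome2 lE o2.
    by apply: Or42; exists H; first exact: forward2 hk par XY abcH.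
  - by apply: Or43; split=> //; apply: forward3; rewrite -?k3.
  - by apply: Or44; split=> //; apply: forward4; rewrite -?k3.
case=> [[H /construction1_sound]|[H /construction2_sound]|[k3 [H]]|[k3 [H]]];
  try exact: sound.
- by rewrite k3 in sound; move/construction3_sound; apply: sound.
- by rewrite k3 in sound; move/construction4_sound; apply: sound.
Qed.
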